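(* Let $v$ be a finite place of $K$. For every $r \geqslant 0$, $s \in \mathbb{S}$ and $m \in \mathbb{Z}/(q-1)\mathbb{Z}$, if $f \in \mathcal{M}_s^m(A_v)$ then $\Pi_r\, \Theta^r(f) \in \mathcal{M}_{s+2r}^{m+r}(A_v)$. Thus $\Pi_r\Theta^r$ is a well-defined operator $\mathcal{M}_s^m(A_v) \to \mathcal{M}_{s+2r}^{m+r}(A_v)$.
   Context: $A=\mathbb{F}_q[\theta]$ ($q$ a power of the prime $p$), $K=\mathbb{F}_q(\theta)$. $[i]=\theta^{q^i}-\theta$, $D_0=1$, $D_i=[i]D_{i-1}^q$; Carlitz factorial $\Pi_m=\prod_iD_i^{m_i}$ for $m=\sum m_iq^i$, $0\le m_i\le q-1$. $e_C(x)=\sum_{i\ge0}x^{q^i}/D_i$ is the Carlitz exponential with kernel $A\tilde\pi$, $u(z)=1/e_C(\tilde\pi z)$. Goss polynomials: $\sum_{k\ge1}G_k(t)x^k=tx/(1-te_C(x))$; $\beta_{r,j}\in K$ by $G_{r+1}(t)=\sum_{j=0}^r\beta_{r,j}t^{j+1}$. On power series, $\Theta^r(\sum_nc_nu^n) := \sum_nc_n\sum_{j=0}^r\binom{n+j-1}{j}\beta_{r,j}u^{n+j}$ (equivalently $\sum_j\beta_{r,j}u^{j+1}\partial_u^j(u^{j-1}f)$; it agrees with $(-\tilde\pi)^{-r}\partial_z^r$ on $u$-expansions of functions). $v$ is a finite place with monic irreducible generator $\wp$ of degree $d$, completions $A_v,K_v$; $K\otimes_AA_v[[u]]$ are power series over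 $K_v$ with bounded denominators, $\|f\|_v=q^{-\min_n\mathrm{ord}_v(c_n)}$. $\mathbb{S}=\mathbb{Z}/(q^d-1)\mathbb{Z}\times\mathbb{Z}_p$, $\mathbb{Z}\hookrightarrow\mathbb{S}$ by $n\mapsto(n\bmod q^d-1,n)$. Drinfeld modular forms of weight $k$, type $m$: rigid analytic $f$ on $\Omega=\mathbb{C}_\infty\setminus\mathbb{F}_q((1/\theta))$ with $f(\gamma z)=(\det\gamma)^{-m}(cz+d)^kf(z)$ for $\gamma\in\mathrm{GL}_2(A)$ and with a $u$-expansion; $M_k^m(K)$ those with $K$-coefficients. A $v$-adic modular form of weight $s$ and type $m$ is $f\in K\otimes_AA_v[[u]]$ with $f_i\in M_{k_i}^m(K)$, $\|f_i-f\|_v\to0$, $k_i\to s$ in $\mathbb{S}$; $\mathcal{M}_s^m$ is their space and $\mathcal{M}_s^m(A_v)=\mathcal{M}_s^m\cap A_v[[u]]$. *)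

(* Defs.v *)
From HB Require Import structures.
From mathcomp Require Import all_boot all_order all_algebra.
From mathcomp Require Import all_classical all_reals all_analysis.

Set Implicit Arguments.
Unset Strict Implicit.
Unset Printing Implicit Defensive.

Import Order.TTheory GRing.Theory Num.Theory.
Import numFieldNormedType.Exports.

Local Open Scope classical_set_scope.
Local Open Scope ring_scope.

Section FormalSeries.
Context {S : comNzRingType}.

Definition fps_one : nat -> S := fun n => (n == 0%N)%:R.

Definition fps_mul (a b : nat -> S) : nat -> S :=
  fun n => \sum_(i < n.+1) a i * b (n - i)%N.

Definition fps_exp (a : nat -> S) (j : nat) : nat -> S :=
  iter j (fps_mul a) fps_one.

Lemma fps_exp_lt (a : nat -> S) j n :
  a 0%N = 0 -> (n < j)%N -> fps_exp a j n = 0.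
Proof.
move=> a0; elim: j n => [//|j IH] n lt_nj /=.
rewrite /fps_mul big1 // => -[[|i] lt_in] _ /=; first by rewrite a0 mul0r.
rewrite -/(fps_exp a j) IH ?mulr0 //; rewrite ltnS in lt_in.
by rewrite -ltnS; apply: leq_trans lt_nj; rewrite !ltnS ltn_subrL /=; case: n lt_in.
Qed.

End FormalSeries.

Lemma fps_geometric (S : comNzRingType) (e : nat -> S) : e 0%N = 0 ->
  fps_mul (fun n => fps_one n - 'X * (e n)%:P)
    (fun k => \sum_(j < k) fps_exp e j k.-1 *: 'X^(j.+1)) =1
  (fun n => if n == 1%N then 'X else 0).
Proof.
move=> e0; set g : nat -> {poly S} := fun k => \sum_(j < k) _.
have gE N k : (k.+1 <= N)%N -> g k.+1 = \sum_(j < N) fps_exp e j k *: 'X^(j.+1).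
  move=> leN; rewrite /g (big_ord_widen N (fun j => fps_exp e j k *: 'X^(j.+1)) leN).
  rewrite big_mkcond; apply: eq_bigr => j _; case: ltnP => // ltkj.
  by rewrite fps_exp_lt ?scale0r.
have g0 : g 0%N = 0 by rewrite /g big_ord0.
case=> [|k]; rewrite /fps_mul.
  by rewrite big_ord_recl big_ord0 subnn g0 mulr0 addr0.
have -> : \sum_(i < k.+2) (fps_one i - 'X * (e i)%:P) * g (k.+1 - i)%N =
    g k.+1 - \sum_(i < k.+1) 'X * (e i)%:P * g (k.+1 - i)%N.
  under eq_bigr => i _ do rewrite mulrBl.
  rewrite sumrB; congr (_ - _).
    rewrite big_ord_recl big1 ?addr0; last by move=> i _; rewrite mul0r.
    by rewrite mul1r subn0.
  by rewrite big_ord_recr /= subnn g0 mulr0 addr0.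
have -> : \sum_(i < k.+1) 'X * (e i)%:P * g (k.+1 - i)%N =
          \sum_(j < k.+1) fps_exp e j.+1 k *: 'X^(j.+2).
  transitivity (\sum_(i < k.+1) \sum_(j < k.+1)
      (e i * fps_exp e j (k - i)%N) *: 'X^(j.+2) : {poly S}).
    apply: eq_bigr => i _; have lei : (i <= k)%N by rewrite -ltnS.
    rewrite subSn // (gE k.+1) ?ltnS ?leq_subr //.
    rewrite mulr_sumr; apply: eq_bigr => j _.
    rewrite -scalerAr (mulrC 'X) -mulrA -exprS mul_polyC scalerA.
    by rewrite mulrC.
  rewrite exchange_big; apply: eq_bigr => j _.
  by rewrite -scaler_suml.
rewrite (gE k.+2) // big_ord_recl addrK.
by rewrite /= /fps_one expr1 eqSS; case: (k == 0%N); rewrite ?scale1r ?scale0r.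
Qed.

(* F is the field with q elements and theta = 'X. *)

Section Carlitz.
Variable F : finFieldType.

Notation A := {poly F}.
Notation K := {fraction {poly F}}.
Notation q := #|F|.

Definition inK (a : A) : K := @FracField.tofrac A a.

Definition carlitz_bracket (i : nat) : A := 'X^(q ^ i) - 'X.

Fixpoint carlitz_D (i : nat) : A :=
  if i is i'.+1 then carlitz_bracket i * carlitz_D i' ^+ q else 1.

(* [(m %/ q ^ i) %% q] is the i-th digit of m in base q; all digits of index
   i > m vanish. *)
Definition carlitz_factorial (m : nat) : A :=
  \prod_(i < m.+1) carlitz_D i ^+ ((m %/ q ^ i) %% q).

(* e_C(x) = sum_i x^(q^i) / D_i as a formal power series; the exponents q^i are
   distinct, so the sum has at most one term. *)
Definition carlitz_series : nat -> K :=
  fun n => \sum_(i < n.+1 | n == (q ^ i)%N) (inK (carlitz_D i))^-1.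

(* The coefficient of x^k in t x / (1 - t e_C(x)), computed from the geometric
   series sum_j t^(j+1) x e_C(x)^j; lemma [goss_generating] states the
   defining identity. *)
Definition goss (k : nat) : {poly K} :=
  \sum_(j < k) fps_exp carlitz_series j k.-1 *: 'X^(j.+1).

Lemma carlitz_series0 : carlitz_series 0 = 0.
Proof.
rewrite /carlitz_series big1 // => i; rewrite eq_sym expn_eq0.
by rewrite -leqn0 leqNgt (cardD1 0).
Qed.

Lemma goss_generating :
  fps_mul (fun n => fps_one n - 'X * (carlitz_series n)%:P) goss =1
  (fun n => if n == 1%N then 'X else 0).
Proof. exact: fps_geometric carlitz_series0. Qed.

(* G_(r+1)(t) = sum_j goss_coef r j t^(j+1) *)
Definition goss_coef (r j : nat) : K := (goss r.+1)`_j.+1.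

End Carlitz.

Section AbsoluteValue.
Variables (R : realType) (L : fieldType) (a : L -> R).

Record nonarch_abs : Prop := NonarchAbs {
  abs_ge0 : forall x, 0 <= a x;
  abs_eq0 : forall x, a x = 0 <-> x = 0;
  abs_mul : forall x y, a (x * y) = a x * a y;
  abs_add : forall x y, a (x + y) <= Num.max (a x) (a y) }.

Definition converges (u : nat -> L) (l : L) : Prop :=
  (fun n => a (u n - l)) @ \oo --> (0 : R).

Definition cauchy_seq (u : nat -> L) : Prop :=
  forall e : R, 0 < e ->
    exists N, forall m n, (N <= m)%N -> (N <= n)%N -> a (u m - u n) < e.

Definition abs_complete : Prop :=
  forall u, cauchy_seq u -> exists l, converges u l.

Definition in_closure (X : set L) (z : L) : Prop :=
  forall e : R, 0 < e -> exists2 x, X x & a (z - x) < e.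

(* [0] by convention if the sequence diverges. *)
Definition abs_lim (u : nat -> L) : L := xget 0 [set l | converges u l].

End AbsoluteValue.

Section Cinfty.
Variables (R : realType) (F : finFieldType).

Notation A := {poly F}.
Notation K := {fraction {poly F}}.
Notation q := #|F|.

Definition algebraic_over (L : fieldType) (X : set L) (z : L) : Prop :=
  exists p : {poly L}, [/\ p != 0, forall i, X p`_i & root p z].

(* C_infty, presented up to isomorphism: a complete algebraically closed field
   containing K, whose absolute value extends |a| = q^(deg a), in which the
   elements algebraic over K_infty, the closure of K, are dense. *)
Record Cinfty := MkCinfty {
  Cinf_field :> closedFieldType;
  absC : Cinf_field -> R;
  KtoC : {rmorphism K -> Cinf_field};
  absC_nonarch : nonarch_abs absC;
  absC_deg : forall a : A, a != 0 ->
    absC (KtoC (inK a)) = q%:R ^+ (size a).-1;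
  absC_complete : abs_complete absC;
  absC_dense : forall z,
    in_closure absC (algebraic_over (in_closure absC (range KtoC))) z }.

Variable C : Cinfty.

Notation aC := (@absC C).
Notation iC := (@KtoC C).

(* F_q((1/theta)) *)
Definition Kinfty : set C := in_closure aC (range iC).

Definition Omega : set C := ~` Kinfty.

(* The exhausting admissible covering of Omega by affinoids. *)
Definition Omega_aff (n : nat) : set C :=
  [set z | aC z <= q%:R ^+ n /\ forall x, Kinfty x -> q%:R ^- n <= aC (z - x)].

Definition rigid_analytic (f : C -> C) : Prop :=
  forall n (e : R), 0 < e -> exists g h : {poly C},
    forall z, Omega_aff n z -> h.[z] != 0 /\ aC (f z - g.[z] / h.[z]) < e.

Definition carlitz_exp (x : C) : C :=
  abs_lim aC (fun n => \sum_(i < n) x ^+ (q ^ i) / iC (inK (carlitz_D F i))).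

Definition carlitz_period (w : C) : Prop :=
  forall x, carlitz_exp x = 0 <-> exists a : A, x = iC (inK a) * w.

Definition u_param (w z : C) : C := (carlitz_exp (w * z))^-1.

(* f(z) = sum_n c_n u(z)^n as soon as the distance from z to K_infty is large
   enough. *)
Definition u_expansion (w : C) (f : C -> C) (c : nat -> C) : Prop :=
  exists2 b : R, 0 < b & forall z, (forall x, Kinfty x -> b <= aC (z - x)) ->
    converges aC (fun n => \sum_(i < n) c i * u_param w z ^+ i) (f z).

End Cinfty.

(* Z/nZ for n >= 1, as an additive group. (The library's 'Z_n is Z/2Z when
   n = 1, a case that occurs here.) *)
Notation Zmod n := 'I_(n.-1.+1).

Definition Zmod_of_int (n : nat) (k : int) : Zmod n := inZp `|(k %% n%:Z)%Z|%N.

Section ModularForms.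
Variables (R : realType) (F : finFieldType) (C : Cinfty R F) (w : C).

Notation A := {poly F}.
Notation K := {fraction {poly F}}.
Notation iC := (@KtoC R F C).

(* The values of f outside Omega are irrelevant. *)
Definition modular_function (k : int) (m : Zmod #|F|.-1) (f : C -> C) : Prop :=
  forall (g : 'M[A]_2) (z : C), g \in unitmx -> @Omega R F C z ->
    let e i j := iC (inK (g i j)) in
    f ((e 0 0 * z + e 0 1) / (e 1 0 * z + e 1 1)) =
      iC (inK (\det g)) ^- m * (e 1 0 * z + e 1 1) ^ k * f z.

(* M_k^m(K), each form being identified with its u-expansion. *)
Definition modular_series (k : int) (m : Zmod #|F|.-1) : set (nat -> K) :=
  [set c | exists f : C -> C, [/\ rigid_analytic f, modular_function k m f
                                & u_expansion w f (iC \o c)]].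

End ModularForms.

(* Z_p as the inverse limit of the Z/p^n *)
Record padic (p : nat) := Padic {
  padic_mod : forall n, Zmod (p ^ n);
  padic_compat : forall n, padic_mod n = inZp (padic_mod n.+1) }.

Section Padic.
Variable p : nat.

Lemma padic_dvd n : ((p ^ n).-1.+1 %| (p ^ n.+1).-1.+1)%N.
Proof.
have [->|p_gt0] := posnP p; first by case: n => [|n] //; rewrite !exp0n.
by rewrite !prednK ?expn_gt0 ?p_gt0 // dvdn_exp2l.
Qed.

Lemma padic_of_int_compat (k : int) n :
  Zmod_of_int (p ^ n) k = inZp (Zmod_of_int (p ^ n.+1) k) :> Zmod (p ^ n).
Proof.
apply: val_inj => /=; rewrite (modn_dvdm _ (padic_dvd n)).
have [p0|p_gt0] := posnP p.
  suff -> : (p ^ n).-1.+1 = 1%N by rewrite !modn1.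
  by rewrite p0; case: n => [//|n]; rewrite exp0n.
rewrite !prednK ?expn_gt0 ?p_gt0 //.
have pn0 j : (p ^ j)%:Z != 0 :> int by rewrite eqz_nat -lt0n expn_gt0 p_gt0.
apply/eqP; rewrite -eqz_nat -!modz_nat !gez0_abs ?modz_ge0 //.
rewrite modz_mod eqz_mod_dvd {1}(divz_eq k (p ^ n.+1)%N) addrK.
by rewrite dvdz_mull // dvdzE /= dvdn_exp2l.
Qed.

Definition padic_of_int (k : int) : padic p :=
  Padic (padic_of_int_compat k).

Lemma padic_add_compat (x y : padic p) n :
  padic_mod x n + padic_mod y n = inZp (padic_mod x n.+1 + padic_mod y n.+1)%R.
Proof.
rewrite (padic_compat x) (padic_compat y); apply: val_inj => /=.
by rewrite modnDm (modn_dvdm _ (padic_dvd n)).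
Qed.

Definition padic_add (x y : padic p) : padic p :=
  Padic (padic_add_compat x y).

End Padic.

Definition weight_space (N p : nat) : Type := (Zmod N * padic p)%type.

Section Weights.
Variables N p : nat.

Definition weight_of_int (k : int) : weight_space N p :=
  (Zmod_of_int N k, padic_of_int p k).

Definition weight_add (s t : weight_space N p) : weight_space N p :=
  (s.1 + t.1, padic_add s.2 t.2).

(* Convergence of a sequence of integers in the product of the discrete and
   p-adic topologies. *)
Definition weight_cvg (k : nat -> int) (s : weight_space N p) : Prop :=
  (\forall i \near \oo, (weight_of_int (k i)).1 = s.1) /\
  (forall n, \forall i \near \oo,
     padic_mod (weight_of_int (k i)).2 n = padic_mod s.2 n).

End Weights.

Section Completion.
Variables (R : realType) (F : finFieldType).

Notation A := {poly F}.
Notation K := {fraction {poly F}}.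
Notation q := #|F|.

(* K_v, presented up to isomorphism: a complete field containing K as a dense
   subfield, whose absolute value extends |x|_v = q^(- ord_v x), v being the
   place of the irreducible polynomial P. *)
Record completion (P : A) := Completion {
  Kv_field :> fieldType;
  absv : Kv_field -> R;
  KtoKv : {rmorphism K -> Kv_field};
  absv_nonarch : nonarch_abs absv;
  absv_ord : forall (n : nat) (a : A), ~~ (P %| a)%R ->
    absv (KtoKv (inK (P ^+ n * a))) = q%:R ^- n;
  absv_complete : abs_complete absv;
  absv_dense : forall x, in_closure absv (range KtoKv) x }.

Variables (P : A) (Kv : completion P).

Notation av := (@absv P Kv).
Notation iv := (@KtoKv P Kv).

Definition v_integral : set Kv := [set x | av x <= 1].

Definition gauss_norm (c : nat -> Kv) : \bar R :=
  ereal_sup (range (fun n => (av (c n))%:E)).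

(* The coefficient of u^N in sum_n c_n sum_(j <= r) binom(n+j-1, j)
   goss_coef r j u^(n+j), where n = N - j; for n = j = 0, binom(-1, 0) = 1
   = 'C(0, 0). *)
Definition Theta (r : nat) (c : nat -> Kv) : nat -> Kv :=
  fun N => \sum_(j < r.+1 | (j <= N)%N)
    c (N - j)%N * ('C(N.-1, j)%:R * iv (goss_coef F r j)).

(* The size of P is d + 1. *)
Notation weight p := (weight_space (q ^ (size P).-1).-1 p).

Definition v_modular_form (C : Cinfty R F) (w : C) (p : nat) (s : weight p)
    (m : Zmod q.-1) : set (nat -> Kv) :=
  [set f | (gauss_norm f < +oo)%E /\
    exists (k : nat -> int) (c : nat -> nat -> K),
    [/\ forall i, modular_series w (k i) m (c i),
        (fun i => gauss_norm (fun n => iv (c i n) - f n)) @ \oo --> 0%E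
      & weight_cvg k s]].

Definition v_modular_form_int (C : Cinfty R F) (w : C) (p : nat)
    (s : weight p) (m : Zmod q.-1) : set (nat -> Kv) :=
  [set f | v_modular_form w s m f /\ forall n, v_integral (f n)].

End Completion.

(* Main.v *)
(* Let phi be a form of weight L = 1 mod p, divisible by q^d - 1, with phi = 1 mod P. Since L = 1 in
   characteristic p, Theta(phi) / phi transforms like the false Eisenstein series, and
     sum_i binom(k + r - 1, i) (- Theta phi)^i phi^(r - i) Theta^(r - i) c
   is modular of weight k + 2r + rL and type m + r whenever c is modular of weight k > 0 and type m.
   If moreover Theta(phi) is v-adically small, then multiplying by a power of phi whose total
   exponent is p^n gives a form close to Theta^r c, of weight close to k + 2r; this approximates
   Theta^r on all v-adic forms, which are limits of such c.

   The Eisenstein series of weight q^d - 1, divided by its constant term (of valuation -1 at P),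
   gives phi0 = 1 mod P. Its power phi0^(p-1) has weight 1 mod p. To make Theta(phi) small, apply V,
   f(z) -> f(Pz), repeatedly: Theta V = P V Theta. Up to a small error V preserves the level,
   because the Hecke operator T_P is P^k V + U in weight k: comparing T_P(phi) phi0^(p^n), in which
   V occurs with P^L, and T_P(phi phi0^(p^n)), in which it occurs with a much higher power of P,
   isolates V(phi) after division by P^L.

   Finally Pi_r Theta^r is integral because Pi_r times any coefficient of x^r in a power of e_C lies
   in A, by induction from D_i Pi_(r - q^i) | Pi_r. *)
From Stdlib Require Import Ring.
Require Import Defs.
From HB Require Import structures.
From mathcomp Require Import all_boot all_order all_algebra.
From mathcomp Require Import all_classical all_reals all_analysis.
From mathcomp Require Import lra zify separable cyclic pgroup.

Set Implicit Arguments.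
Unset Strict Implicit.
Unset Printing Implicit Defensive.

Import Order.TTheory GRing.Theory Num.Theory.
Import numFieldNormedType.Exports.
Local Open Scope classical_set_scope.
Local Open Scope ring_scope.

(** Taking p-th powers cannot make Theta(phi) small: Theta is a derivation, so it kills p-th powers,
    but their weights vanish modulo p, whereas the correction by Theta(phi) / phi needs weight 1
    modulo p. This conflict is what brings in V and the Hecke operator. The powers phi0^(p^n) serve
    the opposite purpose: by Frobenius they are 1 modulo P^(p^n), and their weights tend to 0 in the
    weight space, so multiplying by them moves weights without changing limits. They also make
    weights positive, as the binomial identity behind the correction requires. On the analytic side,
    characteristic p replaces iterated derivatives by hyperderivatives, the coefficients of f(z + t)
    in t. Rigid analytic means a uniform limit of rational functions on each affinoid, so the
    existence of these expansions and the analyticity of their coefficients come from averaging over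
    roots of unity. Infinite sums over A, over pairs and over exponents are unordered, so that one
    Fubini lemma rearranges them all. *)

(* The same operation occurs along different canonical paths, which [ring] does not identify; the
   tactics below first fold all of them into the following constants. *)
Section RingTactic.
Variable L : comNzRingType.
Definition rT : Type := L.
Definition rzero : rT := @GRing.zero L.
Definition rone : rT := @GRing.one L.
Definition radd : rT -> rT -> rT := @GRing.add L.
Definition rmul : rT -> rT -> rT := @GRing.mul L.
Definition ropp : rT -> rT := @GRing.opp L.
Definition rexp (x : rT) (n : nat) : rT := @GRing.exp L x n.
Definition rsub (x y : rT) : rT := radd x (ropp y).
Lemma rT_ring : ring_theory rzero rone radd rmul rsub ropp eq.
Proof.
split=> //; [exact: add0r|exact: addrC|exact: addrA|exact: mul1r|exact: mulrC|exact: mulrA|exact: mulrDl|exact: subrr].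
Qed.
(** Applied backwards by the tactics: it restates an equality, whatever the path to its type, as one
    in [rT L], for which [ring] is registered. *)
Lemma radd0_inj (x y : rT) : radd x rzero = radd y rzero -> x = y.
Proof. by rewrite /radd /rzero !addr0. Qed.
End RingTactic.
Definition rinv (L : fieldType) (x : rT L) : rT L := @GRing.inv L x.
Arguments radd : simpl never.
Ltac rring L :=
  rewrite ?exprS ?expr0;
  repeat match goal with
  | |- context [@bigop.body ?A ?B ?C ?D ?E] =>
      let Q := fresh in set Q := (@bigop.body A B C D E); clearbody Q
  | |- context [@GRing.natmul ?V ?x ?n] =>
      let Q := fresh in set Q := (@GRing.natmul V x n); clearbody Q
  end;
  refine (@radd0_inj L _ _ _);
  repeat match goal with
  | |- context [@GRing.add ?V ?x ?y] => change (@GRing.add V x y) with (@radd L x y)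
  | |- context [@GRing.mul ?V ?x ?y] => change (@GRing.mul V x y) with (@rmul L x y)
  | |- context [@GRing.exp ?V ?x ?n] => change (@GRing.exp V x n) with (@rexp L x n)
  | |- context [@GRing.inv ?V ?x] => change (@GRing.inv V x) with (@rinv L x)
  | |- context [@GRing.opp ?V ?x] => change (@GRing.opp V x) with (@ropp L x)
  | |- context [@GRing.zero ?V] => change (@GRing.zero V) with (@rzero L)
  | |- context [@GRing.one ?V] => change (@GRing.one V) with (@rone L)
  end; ring.

(** For rings that are not fields: inverses are not folded. *)
Ltac crring L :=
  rewrite ?exprS ?expr0;
  repeat match goal with
  | |- context [@bigop.body ?A ?B ?C ?D ?E] =>
      let Q := fresh in set Q := (@bigop.body A B C D E); clearbody Q
  | |- context [@GRing.natmul ?V ?x ?n] =>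
      let Q := fresh in set Q := (@GRing.natmul V x n); clearbody Q
  end;
  refine (@radd0_inj L _ _ _);
  repeat match goal with
  | |- context [@GRing.add ?V ?x ?y] => change (@GRing.add V x y) with (@radd L x y)
  | |- context [@GRing.mul ?V ?x ?y] => change (@GRing.mul V x y) with (@rmul L x y)
  | |- context [@GRing.exp ?V ?x ?n] => change (@GRing.exp V x n) with (@rexp L x n)
  | |- context [@GRing.opp ?V ?x] => change (@GRing.opp V x) with (@ropp L x)
  | |- context [@GRing.zero ?V] => change (@GRing.zero V) with (@rzero L)
  | |- context [@GRing.one ?V] => change (@GRing.one V) with (@rone L)
  end; ring.

(** * Sums in ultrametric fields *)

Section NonArch.
Variables (R : realType) (L : fieldType) (a : L -> R) (ha : nonarch_abs a).

Lemma na_ge0 x : 0 <= a x. Proof. exact: abs_ge0 ha x. Qed.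
Lemma na0 : a 0 = 0. Proof. exact/(abs_eq0 ha). Qed.
Lemma naM x y : a (x * y) = a x * a y. Proof. exact: abs_mul ha x y. Qed.
Lemma na_eq0 x : (a x == 0) = (x == 0).
Proof. by apply/eqP/eqP => /(abs_eq0 ha). Qed.
Lemma na_gt0 x : (0 < a x) = (x != 0).
Proof. by rewrite lt_neqAle na_ge0 andbT eq_sym na_eq0. Qed.
Lemma na1 : a 1 = 1.
Proof.
apply: (mulfI (x := a 1)); first by rewrite na_eq0 oner_eq0.
by rewrite -naM !mulr1.
Qed.
Lemma naX n x : a (x ^+ n) = a x ^+ n.
Proof. by elim: n => [|n IH]; rewrite ?expr0 ?na1 // !exprS naM IH. Qed.
Lemma naN x : a (- x) = a x.
Proof.
rewrite -mulN1r naM; suff -> : a (-1) = 1 by rewrite mul1r.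
apply/eqP; rewrite -(eqrXn2 (n := 2)) ?na_ge0 //.
by rewrite -naX sqrrN !expr1n na1.
Qed.
Lemma naV x : a x^-1 = (a x)^-1.
Proof.
have [->|x0] := eqVneq x 0; first by rewrite !(invr0, na0).
have ax0 : a x != 0 by rewrite na_eq0.
by apply: (mulfI ax0); rewrite -naM !divff // na1.
Qed.
Lemma naB x y : a (x - y) = a (y - x). Proof. by rewrite -naN opprB. Qed.
Lemma na_leD x y B : a x <= B -> a y <= B -> a (x + y) <= B.
Proof. by move=> xB yB; apply: le_trans (abs_add ha x y) _; rewrite ge_max xB. Qed.
Lemma na_leB x y B : a x <= B -> a y <= B -> a (x - y) <= B.
Proof. by move=> xB yB; apply: na_leD; rewrite ?naN. Qed.
Lemma na_ltD x y B : a x < B -> a y < B -> a (x + y) < B.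
Proof. by move=> xB yB; apply: le_lt_trans (abs_add ha x y) _; rewrite gt_max xB. Qed.
Lemma na_ltB x y B : a x < B -> a y < B -> a (x - y) < B.
Proof. by move=> xB yB; apply: na_ltD; rewrite ?naN. Qed.
Lemma na_addl x y : a y < a x -> a (x + y) = a x.
Proof.
move=> yx; apply/le_anti; rewrite na_leD ?(ltW yx) //= leNgt; apply/negP => lt.
have := na_ltB lt yx; rewrite addrK ltxx //.
Qed.
Lemma na_addr x y : a x < a y -> a (x + y) = a y.
Proof. by move=> xy; rewrite addrC na_addl. Qed.
Lemma na_nat n : a n%:R <= 1.
Proof.
elim: n => [|n IH]; first by rewrite na0 ler01.
by rewrite -addn1 natrD na_leD ?na1.
Qed.
Lemma na_sum_le (I : eqType) (s : seq I) (P : pred I) F B : 0 <= B ->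
  (forall i, i \in s -> P i -> a (F i) <= B) -> a (\sum_(i <- s | P i) F i) <= B.
Proof.
move=> B0 h; rewrite big_seq_cond; elim/big_ind: _ => [|x y|i /andP[]].
- by rewrite na0.
- exact: na_leD.
- exact: h.
Qed.
Lemma na_sum_lt (I : eqType) (s : seq I) (P : pred I) F B : 0 < B ->
  (forall i, i \in s -> P i -> a (F i) < B) -> a (\sum_(i <- s | P i) F i) < B.
Proof.
move=> B0 h; rewrite big_seq_cond; elim/big_ind: _ => [|x y|i /andP[]].
- by rewrite na0.
- exact: na_ltD.
- exact: h.
Qed.
Lemma na_prod (I : Type) (s : seq I) (P : pred I) F :
  a (\prod_(i <- s | P i) F i) = \prod_(i <- s | P i) a (F i).
Proof. by elim/big_rec2: _ => [|i x y _ <-]; rewrite ?na1 ?naM. Qed.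
Lemma na_eq_small x y : (forall e, 0 < e -> a (x - y) < e) -> x = y.
Proof.
move=> h; apply/eqP; rewrite -subr_eq0 -na_eq0; apply/negPn/negP => ne0.
have gt0 : 0 < a (x - y) by rewrite lt_neqAle eq_sym ne0 na_ge0.
by have := h _ gt0; rewrite ltxx.
Qed.
Lemma convergesP (u : nat -> L) l : converges a u l <->
  forall e, 0 < e -> exists N, forall n, (N <= n)%N -> a (u n - l) < e.
Proof.
split=> [h e e0|h].
  have /cvgrPdist_lt /(_ e e0) [N _ hN] := h.
  exists N => n Nn; have := hN n Nn; rewrite sub0r normrN ger0_norm //.
  exact: na_ge0.
apply/cvgrPdist_lt => e e0; have [N hN] := h e e0.
by exists N => // n /= Nn; rewrite sub0r normrN ger0_norm ?na_ge0 // hN.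
Qed.
End NonArch.

(** * Families of real numbers tending to zero *)

Section RealNull.
Variable R : realType.

(** Convergence to 0 along complements of finite sets, so that no enumeration of the index type
    (polynomials, pairs of them, exponents) has to be chosen. Only upper bounds matter: the families
    in use are nonnegative. *)
Definition rnull (I : eqType) (b : I -> R) : Prop :=
  forall e, 0 < e -> exists B : seq I, forall i, i \notin B -> b i < e.

Lemma rnull_le (I : eqType) (b c : I -> R) :
  (forall i, b i <= c i) -> rnull c -> rnull b.
Proof.
move=> bc nc e e0; have [B hB] := nc e e0.
by exists B => i /hB; apply: le_lt_trans.
Qed.

Lemma rnull_natP (b : nat -> R) :
  rnull b <-> forall e, 0 < e -> exists N, forall n, (N <= n)%N -> b n < e.
Proof.
split=> h e e0; have [B hB] := h e e0.
  exists (\max_(i <- B) i).+1 => n Bn; apply: hB; apply/negP => nB.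
  by move: Bn; rewrite (big_rem n) //= ltnNge leq_maxl.
exists (iota 0 B) => i; rewrite mem_iota /= add0n -leqNgt; exact: hB.
Qed.

Lemma rnull_bounded (I : eqType) (b : I -> R) :
  rnull b -> exists2 M, 0 < M & forall i, b i <= M.
Proof.
move=> /(_ 1 ltr01) [B hB].
exists (\big[Num.max/1]_(i <- B) b i).
  by elim/big_rec: _ => // i x _ x0; rewrite lt_max x0 orbT.
move=> i; have [iB|/hB/ltW bi] := boolP (i \in B).
  by elim: B iB {hB} => // j B IH; rewrite inE big_cons => /orP[/eqP<-|/IH h];
    rewrite le_max ?lexx // h orbT.
by apply: le_trans bi _; elim/big_rec: _ => // j x _ x0; rewrite le_max x0 orbT.
Qed.

Lemma rnullM (I J : eqType) (b : I -> R) (c : J -> R) :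
  (forall i, 0 <= b i) -> (forall j, 0 <= c j) ->
  rnull b -> rnull c -> rnull (fun ij : I * J => b ij.1 * c ij.2).
Proof.
move=> b0 c0 nb nc e e0.
have [M M0 hM] := rnull_bounded nb; have [N N0 hN] := rnull_bounded nc.
have [B hB] := nb (e / N) (divr_gt0 e0 N0).
have [D hD] := nc (e / M) (divr_gt0 e0 M0).
exists [seq (i, j) | i <- B, j <- D] => -[i j] /= nij.
have [iB|/hB bi] := boolP (i \in B).
  have [jD|/hD cj] := boolP (j \in D).
    by case/negP: nij; apply/allpairsP; exists (i, j).
  apply: le_lt_trans (_ : M * c j < e); first exact: ler_wpM2r.
  by rewrite mulrC -ltr_pdivlMr.
apply: le_lt_trans (_ : b i * N < e); first exact: ler_wpM2l.
by rewrite -ltr_pdivlMr.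
Qed.

Lemma rnull_comp (I J : eqType) (f : J -> I) (b : I -> R) :
  injective f -> rnull b -> rnull (b \o f).
Proof.
move=> injf nb e /nb [B hB].
have [g gP] : exists g : I -> seq J, forall i j, f j = i -> j \in g i.
  have /choice : forall i, exists s : seq J, forall j, f j = i -> j \in s.
    move=> i; case: (pselect (exists j, f j = i)) => [[j fj]|nj].
      by exists [:: j] => j'; rewrite -fj => /injf ->; rewrite inE.
    by exists [::] => j fj; case: nj; exists j.
  by case=> g gP; exists g.
exists (flatten [seq g i | i <- B]) => j nj; apply: hB; apply/negP => fB.
by case/negP: nj; apply/flatten_mapP; exists (f j) => //; apply: gP.
Qed.

Lemma rnull_geom (t : R) : 0 <= t < 1 -> rnull (fun n => t ^+ n).
Proof.
move=> /andP[t0 t1]; apply/rnull_natP => e e0.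
have /cvgrPdist_lt /(_ e e0) [N _ hN] : (fun n => t ^+ n) @ \oo --> (0 : R).
  by apply: cvg_expr; rewrite ger0_norm.
exists N => n /hN /=; rewrite sub0r normrN ger0_norm ?exprn_ge0 //.
Qed.

Lemma rnull_scale (I : eqType) (b : I -> R) k : 0 <= k ->
  rnull b -> rnull (fun i => k * b i).
Proof.
move=> k0 nb e e0; have k1 : 0 < k + 1 by lra.
have [B hB] := nb _ (divr_gt0 e0 k1).
exists B => i /hB; rewrite ltr_pdivlMr // => h.
have [b0|/ltW b0] := leP 0 (b i); last by apply: le_lt_trans e0; rewrite mulr_ge0_le0.
by apply: le_lt_trans h; nra.
Qed.
End RealNull.

(** * Unordered summation in a complete ultrametric field *)

Section Sums.
Variables (R : realType) (L : fieldType) (a : L -> R).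
Hypotheses (ha : nonarch_abs a) (hc : abs_complete a).
Add Ring Lring : (rT_ring L).

Definition null (I : eqType) (x : I -> L) := rnull (fun i => a (x i)).

(** Summation along finite subsets. In a complete ultrametric field a family is summable exactly
    when it is null ([hsum_null], [null_hsum]), which turns every rearrangement into an estimate of
    terms. *)
Definition hsum (I : eqType) (x : I -> L) (S : L) : Prop :=
  forall e, 0 < e -> exists B : seq I, forall B', uniq B' -> {subset B <= B'} ->
    a (\sum_(i <- B') x i - S) < e.

Lemma hsum_null (I : eqType) (x : I -> L) S : hsum x S -> null x.
Proof.
move=> hx e e0; have [B hB] := hx e e0; exists B => i iB.
have u1 : uniq (i :: undup B) by rewrite /= mem_undup iB undup_uniq.
have h1 := hB _ u1; have h2 := hB _ (undup_uniq B).
have -> : x i = (\sum_(j <- i :: undup B) x j - S) - (\sum_(j <- undup B) x j - S).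
  by rewrite big_cons; rring L.
apply: na_ltB => //; [apply: h1|apply: h2] => j jB; rewrite ?inE mem_undup jB ?orbT //.
Qed.

Lemma sum_split_le (I : eqType) (x : I -> L) (B B' : seq I) e : 0 < e ->
  (forall i, i \notin B -> a (x i) < e) -> uniq B' -> {subset B <= B'} ->
  a (\sum_(i <- B') x i - \sum_(i <- undup B) x i) < e.
Proof.
move=> e0 hB u' sub; rewrite (bigID (mem B)) /=.
have -> : \sum_(i <- B' | i \in B) x i = \sum_(i <- undup B) x i.
  rewrite -big_filter; apply: perm_big; apply: uniq_perm; rewrite ?filter_uniq ?undup_uniq //.
  move=> i; rewrite mem_filter mem_undup; case iB: (i \in B) => //=; exact: sub.
rewrite addrAC subrr add0r; apply: na_sum_lt => // i _; exact: hB.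
Qed.

Lemma hsum_uniq (I : eqType) (x : I -> L) S T : hsum x S -> hsum x T -> S = T.
Proof.
move=> hS hT; apply: (na_eq_small ha) => e e0.
have [B hB] := hS e e0; have [D hD] := hT e e0.
have u := undup_uniq (B ++ D).
have sB : {subset B <= undup (B ++ D)} by move=> i; rewrite mem_undup mem_cat => ->.
have sD : {subset D <= undup (B ++ D)} by move=> i; rewrite mem_undup mem_cat orbC => ->.
have := na_ltB ha (hD _ u sD) (hB _ u sB).
set X := bigop _ _ _; by have -> : X - T - (X - S) = S - T by rring L.
Qed.

Lemma null_hsum (I : eqType) (x : I -> L) : null x -> exists S, hsum x S.
Proof.
move=> nx.
have i_gt0 n : 0 < (n.+1%:R : R)^-1 by rewrite invr_gt0 ltr0n.
have /choice [B hB] : forall n, exists B : seq I, forall i, i \notin B -> a (x i) < n.+1%:R^-1.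
  by move=> n; exact: nx.
(* The cumulative lists [D n] contain all earlier [B N], so the partial sums over them differ only
   by terms of absolute value below 1 / (N + 1) and form a Cauchy sequence. *)
pose D := fix D n := if n is m.+1 then D m ++ B m.+1 else B 0%N.
have DB n m : (n <= m)%N -> {subset B n <= D m}.
  elim: m => [|m IH]; first by rewrite leqn0 => /eqP->.
  rewrite leq_eqVlt => /orP[/eqP->|]; first by move=> i; rewrite /= mem_cat orbC => ->.
  by rewrite ltnS => /IH h i /h; rewrite /= mem_cat => ->.
pose s n := \sum_(i <- undup (D n)) x i.
have near N B' : uniq B' -> {subset B N <= B'} ->
    a (\sum_(i <- B') x i - \sum_(i <- undup (B N)) x i) < N.+1%:R^-1.
  exact: (sum_split_le (i_gt0 N) (hB N)).
have sN N n : (N <= n)%N -> a (s n - \sum_(i <- undup (B N)) x i) < N.+1%:R^-1.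
  move=> Nn; apply: near; first exact: undup_uniq.
  by move=> i /(DB _ _ Nn); rewrite mem_undup.
have smallN e : 0 < e -> exists N : nat, (N.+1%:R : R)^-1 < e.
  move=> e0; have e1 : 0 <= e^-1 by rewrite invr_ge0 ltW.
  exists (Num.truncn e^-1); rewrite invf_plt ?posrE ?ltr0n ?invr_gt0 //.
  exact: truncnS_gt.
have [S hS] : exists S, converges a s S.
  apply: hc; rewrite /cauchy_seq => t t0; have [N hN] := smallN t t0.
  exists N => m n Nm Nn; apply: lt_trans hN.
  have := na_ltB ha (sN _ _ Nm) (sN _ _ Nn).
  by rewrite opprB addrA addrNK.
exists S => e e0; have [N hN] := smallN e e0.
exists (B N) => B' u' sub.
have /(convergesP ha) /(_ e e0) [M hM] := hS.
have h1 := lt_trans (near _ _ u' sub) hN.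
have h2 := lt_trans (sN _ _ (leq_maxl N M)) hN.
have h3 := hM _ (leq_maxr N M).
have := na_ltD ha (na_ltB ha h1 h2) h3.
set X := bigop _ _ _; set Y := bigop _ _ _; set Z := s _.
by have -> : X - Y - (Z - Y) + (Z - S) = X - S by rring L.
Qed.

Lemma eq_hsum (I : eqType) (x y : I -> L) S : x =1 y -> hsum x S -> hsum y S.
Proof. by move=> /funext ->. Qed.

Lemma hsumD (I : eqType) (x y : I -> L) S T :
  hsum x S -> hsum y T -> hsum (fun i => x i + y i) (S + T).
Proof.
move=> hS hT e e0; have [B hB] := hS e e0; have [D hD] := hT e e0.
exists (B ++ D) => B' u sub; rewrite big_split /= opprD addrACA.
apply: na_ltD => //; [apply: hB|apply: hD] => // i iB; apply: sub;
  by rewrite mem_cat iB ?orbT.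
Qed.

Lemma hsumZ (I : eqType) (x : I -> L) S k :
  hsum x S -> hsum (fun i => k * x i) (k * S).
Proof.
have [->|k0] := eqVneq k 0.
  move=> _ e e0; exists [::] => B' _ _; rewrite mul0r big1 ?subr0 ?na0 // => i.
  by rewrite mul0r.
have ak : 0 < a k by rewrite na_gt0.
move=> hS e e0; have [B hB] := hS _ (divr_gt0 e0 ak).
exists B => B' u sub; rewrite -mulr_sumr -mulrBr naM // mulrC -ltr_pdivlMr //.
exact: hB.
Qed.

Lemma hsumZr (I : eqType) (x : I -> L) S k :
  hsum x S -> hsum (fun i => x i * k) (S * k).
Proof.
move=> /(hsumZ k); rewrite mulrC; apply: eq_hsum => i; exact: mulrC.
Qed.

Lemma hsumN (I : eqType) (x : I -> L) S : hsum x S -> hsum (fun i => - x i) (- S).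
Proof. by move=> /(hsumZ (-1)); rewrite mulN1r; apply: eq_hsum => i; rewrite mulN1r. Qed.

Lemma hsumB (I : eqType) (x y : I -> L) S T :
  hsum x S -> hsum y T -> hsum (fun i => x i - y i) (S - T).
Proof. by move=> hS /hsumN; apply: hsumD. Qed.

Lemma hsum_fin (I : eqType) (x : I -> L) (B : seq I) :
  uniq B -> (forall i, i \notin B -> x i = 0) -> hsum x (\sum_(i <- B) x i).
Proof.
move=> uB hB e e0; exists B => B' u' sub.
rewrite (_ : \sum_(i <- B) x i = \sum_(i <- undup B) x i); last by rewrite undup_id.
by apply: sum_split_le => // i /hB ->; rewrite na0.
Qed.

Lemma hsum_fin0 (I : eqType) (x : I -> L) : (forall i, x i = 0) -> hsum x 0.
Proof. by move=> h; have := @hsum_fin I x [::]; rewrite big_nil; apply. Qed.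

Lemma hsum_le (I : eqType) (x : I -> L) S B : 0 <= B ->
  (forall i, a (x i) <= B) -> hsum x S -> a S <= B.
Proof.
move=> B0 hx hS; rewrite leNgt; apply/negP => lt.
have S0 : 0 < a S by apply: le_lt_trans lt.
have [D hD] := hS _ S0.
have h : a (\sum_(i <- undup D) x i - S) < a S.
  by apply: hD; rewrite ?undup_uniq // => i; rewrite mem_undup.
have lt2 : a (\sum_(i <- undup D) x i) < a S.
  by apply: le_lt_trans lt; apply: na_sum_le => // i _ _.
by have := na_ltB ha lt2 h; rewrite opprB addrC addrNK ltxx.
Qed.

(** The map only has to reach the support of [x]; its partial inverse [g], obtained by choice,
    translates finite lists back and forth. *)
Lemma hsum_reindex (I J : eqType) (f : J -> I) (x : I -> L) S : injective f ->
  (forall i, x i != 0 -> exists j, f j = i) -> hsum (x \o f) S <-> hsum x S.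
Proof.
move=> injf hx.
have [g gP] : exists g : I -> option J, forall i j, g i = Some j <-> f j = i.
  have /choice : forall i, exists o : option J, forall j, o = Some j <-> f j = i.
    move=> i; case: (pselect (exists j, f j = i)) => [[j fj]|nj].
      exists (Some j) => j'; split => [[<-]//|]; by rewrite -fj => /injf ->.
    by exists None => j; split => // fj; case: nj; exists j.
  by case=> g gP; exists g.
have sumg B' : \sum_(i <- B') x i = \sum_(j <- pmap g B') x (f j).
  elim: B' => [|i B' IH]; first by rewrite !big_nil.
  rewrite big_cons /= IH; case gi: (g i) => [j|] /=.
    by rewrite big_cons; have /gP <- := gi.
  have [->|/hx [j /gP]] := eqVneq (x i) 0; rewrite ?add0r // gi //.
have gf j : g (f j) = Some j by apply/gP.
split=> h e e0; have [B hB] := h e e0.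
  exists (map f B) => B' u sub; rewrite sumg; apply: hB.
    apply: (pmap_uniq (g := f)) u => i /=; case gi: (g i) => [j|] //=; exact/gP.
  move=> j jB; rewrite mem_pmap -gf; apply/map_f/sub/map_f/jB.
exists (pmap g B) => B' u sub.
rewrite (_ : \sum_(i <- B') (x \o f) i = \sum_(i <- map f B') x i); last by rewrite big_map.
have /hB : uniq (undup (map f B' ++ B)) := undup_uniq _.
move=> /(_ _); set D := undup _.
have -> : \sum_(i <- map f B') x i = \sum_(i <- D) x i.
  rewrite (sumg D) sumg; apply: perm_big; apply: uniq_perm.
  - apply: (pmap_uniq (g := f)); last by rewrite map_inj_uniq.
    by move=> i /=; case gi: (g i) => [j|] //=; exact/gP.
  - apply: (pmap_uniq (g := f)); last exact: undup_uniq.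
    by move=> i /=; case gi: (g i) => [j|] //=; exact/gP.
  move=> j; rewrite !mem_pmap; apply/mapP/mapP => -[i iB gi]; exists i => //.
    by rewrite mem_undup mem_cat iB.
  move: iB; rewrite mem_undup mem_cat => /orP[//|iB].
  have /esym/gP <- := gi; apply/map_f/sub; rewrite mem_pmap gi; exact: map_f.
by apply=> i iB; rewrite mem_undup mem_cat iB orbT.
Qed.

(** Over finitely many rows, each row sum is approximated by a finite list [D i], long enough for
    the union [E] of these lists to contain [B]. By the ultrametric inequality the errors of the
    rows do not add up. *)
Lemma hsum_Fubini (I J : eqType) (x : I * J -> L) r S :
  (forall i, hsum (fun j => x (i, j)) (r i)) -> hsum x S -> hsum r S.
Proof.
move=> hr hS e e0; have [B hB] := hS e e0.
exists (map fst B) => B' u' sub.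
have /choice [D hD] : forall i, exists D : seq J,
    [/\ uniq D, {subset [seq p.2 | p <- B] <= D} & a (\sum_(j <- D) x (i, j) - r i) < e].
  move=> i; have [D hD] := hr i e e0.
  exists (undup (D ++ [seq p.2 | p <- B])); split; first exact: undup_uniq.
    by move=> j jB; rewrite mem_undup mem_cat jB orbT.
  by apply: hD; rewrite ?undup_uniq // => j jD; rewrite mem_undup mem_cat jD.
pose E := [seq (i, j) | i <- B', j <- D i].
have h1 : a (\sum_(p <- E) x p - S) < e.
  apply: hB.
    apply: allpairs_uniq_dep => //; first by move=> i _; case: (hD i).
    by move=> [i1 j1] [i2 j2] _ _ /= [-> ->].
  move=> [i j] ijB; apply/allpairsPdep; exists i, j; split => //.
    by apply: sub; apply: (map_f fst ijB).
  by case: (hD i) => _ sD _; apply: sD; apply: (map_f snd ijB).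
have h2 : a (\sum_(p <- E) x p - \sum_(i <- B') r i) < e.
  rewrite big_allpairs_dep /= -sumrB; apply: na_sum_lt => // i _ _.
  by case: (hD i).
by have := na_ltB ha h1 h2; rewrite opprB addrC addrA addrNK.
Qed.

Lemma hsum_swap (I J : eqType) (x : I * J -> L) S :
  hsum x S -> hsum (fun p => x (p.2, p.1)) S.
Proof.
move=> h; apply/(@hsum_reindex (J * I)%type _ (fun p : I * J => (p.2, p.1))).
- by move=> [i j] [i' j'] [-> ->].
- by move=> [j i] _; exists (i, j).
- by apply: eq_hsum h => -[].
Qed.

Lemma hsum_exchange (I J : eqType) (x : I * J -> L) r s S : null x ->
  (forall i, hsum (fun j => x (i, j)) (r i)) ->
  (forall j, hsum (fun i => x (i, j)) (s j)) -> hsum r S -> hsum s S.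
Proof.
move=> /null_hsum [S' hS'] hr hs hS.
have <- : S' = S by apply: hsum_uniq hS; apply: hsum_Fubini hS'.
by apply: (@hsum_Fubini J I (fun p => x (p.2, p.1))) => //; apply: hsum_swap.
Qed.

Lemma null_le (I : eqType) (x : I -> L) (b : I -> R) :
  (forall i, a (x i) <= b i) -> rnull b -> null x.
Proof. exact: rnull_le. Qed.

Lemma hsumM (I J : eqType) (x : I -> L) (y : J -> L) S T :
  hsum x S -> hsum y T -> hsum (fun p : I * J => x p.1 * y p.2) (S * T).
Proof.
move=> hS hT.
have nxy : null (fun p : I * J => x p.1 * y p.2).
  apply: null_le (rnullM _ _ (hsum_null hS) (hsum_null hT)) => [i|i|i];
    by rewrite ?na_ge0 ?naM.
have [Z hZ] := null_hsum nxy; suff <- : Z = S * T by [].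
apply: (@hsum_uniq _ (fun i => x i * T)); last exact: hsumZr.
by apply: hsum_Fubini hZ => i; exact: (hsumZ (x i) hT).
Qed.

Lemma hsum_converges (x : nat -> L) S :
  hsum x S -> converges a (fun n => \sum_(i < n) x i) S.
Proof.
move=> hS; apply/(convergesP ha) => e e0; have [B hB] := hS e e0.
exists (\max_(i <- B) i).+1 => n Bn; rewrite -(big_mkord xpredT x).
apply: hB; first exact: iota_uniq.
move=> i iB; rewrite mem_iota subn0 add0n; apply: leq_trans Bn.
by rewrite ltnS (big_rem i) //= leq_maxl.
Qed.

Lemma converges_uniq (u : nat -> L) S T : converges a u S -> converges a u T -> S = T.
Proof.
move=> /(convergesP ha) hS /(convergesP ha) hT; apply: (na_eq_small ha) => e e0.
have [N hN] := hS e e0; have [M hM] := hT e e0.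
have := na_ltB ha (hM _ (leq_maxr N M)) (hN _ (leq_maxl N M)).
set X := u _; by have -> : X - T - (X - S) = S - T by rring L.
Qed.

(** Convergence of the partial sums forces the terms to 0, which already suffices for unordered
    summability. *)
Lemma converges_hsum (x : nat -> L) S :
  converges a (fun n => \sum_(i < n) x i) S -> hsum x S.
Proof.
move=> h; have [T hT] : exists T, hsum x T.
  apply: null_hsum; apply/rnull_natP => e e0.
  have /(convergesP ha) /(_ e e0) [N hN] := h.
  exists N => n Nn; have := na_ltB ha (hN _ (leqW Nn)) (hN _ Nn).
  by rewrite big_ord_recr /= opprB addrA addrNK addrC addKr.
by rewrite (converges_uniq h (hsum_converges hT)).
Qed.

Lemma hsum_recl (x : nat -> L) S : hsum (fun n => x n.+1) S -> hsum x (x 0%N + S).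
Proof.
move=> h; apply: (@eq_hsum _ (fun n => (if n == 0%N then x n else 0) + (if n == 0%N then 0 else x n))).
  by case=> [|n] /=; rewrite ?addr0 ?add0r.
apply: hsumD.
  have := @hsum_fin _ (fun n => if n == 0%N then x n else 0) [:: 0%N].
  rewrite big_seq1 /=; apply=> // i; rewrite inE; by case: eqP.
apply/(@hsum_reindex _ _ succn) => //; first by move=> ? ? [].
by case=> [|n] /=; rewrite ?eqxx // => _; exists n.
Qed.
End Sums.

(** * Formal power series *)

Section FpsRing.
Variable S : comNzRingType.
Implicit Types a b c : nat -> S.

(** A separate name, so that the product is convolution and not the pointwise product of
    functions. *)
Definition fps : Type := nat -> S.

HB.instance Definition _ := GRing.Zmodule.copy fps (nat -> S).

Lemma fps_mulC : commutative (fps_mul (S := S)).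
Proof.
move=> a b; apply/funext => n; rewrite /fps_mul (reindex_inj rev_ord_inj) /=.
apply: eq_bigr => i _; have -> : (n.+1 - i.+1 = n - i)%N by [].
by rewrite subKn 1?mulrC // -ltnS.
Qed.

(** Low coefficients of a product are those of truncated polynomials, from which associativity is
    inherited. *)
Lemma fps_mulE a b n N : (n < N)%N ->
  fps_mul a b n = ((\poly_(i < N) a i) * \poly_(i < N) b i)`_n.
Proof.
move=> nN; rewrite coefM; apply: eq_bigr => i _; rewrite !coef_poly.
by rewrite (leq_ltn_trans _ nN) ?(leq_ltn_trans (leq_subr _ _) nN) // -ltnS.
Qed.

Lemma fps_mulA : associative (fps_mul (S := S)).
Proof.
have key a b c n : fps_mul a (fps_mul b c) n =
    (\poly_(i < n.+1) a i * (\poly_(i < n.+1) b i * \poly_(i < n.+1) c i))`_n.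
  rewrite coefM; apply: eq_bigr => i _; rewrite coef_poly ltn_ord; congr (_ * _).
  by apply: fps_mulE; rewrite ltnS leq_subr.
move=> a b c; apply/funext => n; rewrite key (fps_mulC (fps_mul a b)) key.
by congr (nth _ _ _); rewrite mulrA mulrC.
Qed.

Lemma fps_mul1 : left_id fps_one (fps_mul (S := S)).
Proof.
move=> a; apply/funext => n; rewrite /fps_mul big_ord_recl big1 => [|i _].
  by rewrite /fps_one mul1r subn0 addr0.
by rewrite /fps_one mul0r.
Qed.

Lemma fps_mulDl : left_distributive (fps_mul (S := S)) (@GRing.add fps).
Proof.
move=> a b c; apply/funext => n.
rewrite -[RHS]/(fps_mul a c n + fps_mul b c n) /fps_mul -big_split /=.
by apply: eq_bigr => i _; rewrite -mulrDl.
Qed.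

Lemma fps_one_neq0 : fps_one != 0 :> fps.
Proof. by apply/eqP => /(congr1 (@^~ 0%N)) /eqP; rewrite /fps_one /= oner_eq0. Qed.

HB.instance Definition _ := GRing.Zmodule_isComNzRing.Build fps
  fps_mulA fps_mulC fps_mul1 fps_mulDl fps_one_neq0.

Lemma fpsME (a b : fps) n : (a * b) n = \sum_(i < n.+1) a i * b (n - i)%N.
Proof. by []. Qed.
Lemma fpsDE (a b : fps) n : (a + b) n = a n + b n.
Proof. by []. Qed.
Lemma fpsNE (a : fps) n : (- a) n = - a n.
Proof. by []. Qed.
Lemma fpsBE (a b : fps) n : (a - b) n = a n - b n.
Proof. by []. Qed.
Lemma fps1E n : (1 : fps) n = (n == 0%N)%:R.
Proof. by []. Qed.
Lemma fps0E n : (0 : fps) n = 0.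
Proof. by []. Qed.
Lemma fps_expE (a : fps) j : fps_exp a j = a ^+ j.
Proof. by elim: j => //= j IH; rewrite exprS -IH. Qed.
Lemma fps_sumE (I : Type) (s : seq I) (P : pred I) (F : I -> fps) n :
  (\sum_(i <- s | P i) F i) n = \sum_(i <- s | P i) F i n.
Proof. by elim/big_rec2: _ => // i y x _ <-. Qed.
Lemma fps_natE m n : (m%:R : fps) n = if n == 0%N then m%:R else 0.
Proof.
elim: m => [|m IH]; first by case: ifP.
by rewrite mulrS fpsDE fps1E IH mulrS; case: eqP; rewrite ?addr0.
Qed.

Definition fpsC (k : S) : fps := fun n => if n == 0%N then k else 0.
Definition fpsX : fps := fun n => (n == 1%N)%:R.

Lemma fpsCM k (a : fps) n : (fpsC k * a) n = k * a n.
Proof.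
rewrite fpsME big_ord_recl big1 => [|i _]; first by rewrite /fpsC /= subn0 addr0.
by rewrite /fpsC mul0r.
Qed.

Lemma fpsC_is_zmod_morphism : zmod_morphism fpsC.
Proof. by move=> x y; apply/funext => n; rewrite fpsBE /fpsC; case: eqP; rewrite ?subr0. Qed.
Lemma fpsC_is_monoid_morphism : monoid_morphism fpsC.
Proof.
split; first by apply/funext => n; rewrite fps1E /fpsC; case: eqP.
by move=> x y; apply/funext => n; rewrite fpsCM /fpsC; case: eqP; rewrite ?mulr0.
Qed.
HB.instance Definition _ := GRing.isZmodMorphism.Build S fps fpsC fpsC_is_zmod_morphism.
HB.instance Definition _ := GRing.isMonoidMorphism.Build S fps fpsC fpsC_is_monoid_morphism.

Lemma fpsXM (a : fps) n : (fpsX * a) n.+1 = a n.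
Proof.
rewrite fpsME big_ord_recl big_ord_recl big1 => [|i _]; last first.
  by rewrite /fpsX mul0r.
by rewrite /fpsX mul0r mul1r add0r addr0 /= subSS subn0.
Qed.

Lemma fpsXM0 (a : fps) : (fpsX * a) 0%N = 0.
Proof. by rewrite fpsME big_ord_recl big_ord0 mul0r addr0. Qed.

Lemma fpsXnE j n : (fpsX ^+ j : fps) n = (n == j)%:R.
Proof.
by elim: j n => [|j IH] [|n]; rewrite ?expr0 ?fps1E // exprS ?fpsXM0 ?fpsXM ?IH ?eqSS.
Qed.

Lemma fpsXnM (a : fps) j n : (fpsX ^+ j * a) n = if (j <= n)%N then a (n - j)%N else 0.
Proof.
elim: j n => [|j IH] n; first by rewrite expr0 mul1r subn0.
case: n => [|n]; first by rewrite exprS -mulrA fpsXM0.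
by rewrite exprS -mulrA fpsXM IH subSS.
Qed.

Lemma fps_exp_lt' (a : fps) j n : a 0%N = 0 -> (n < j)%N -> (a ^+ j) n = 0.
Proof. by rewrite -fps_expE; apply: fps_exp_lt. Qed.

Lemma pchar_fps (p : nat) : p \in [pchar S] -> p \in [pchar fps].
Proof.
move=> /andP[pp /eqP p0]; rewrite inE pp /=; apply/eqP/funext => n.
by rewrite fps_natE p0; case: eqP.
Qed.
End FpsRing.

Definition fps_map (S T : comNzRingType) (h : S -> T) (a : fps S) : fps T :=
  fun n => h (a n).

Section FpsMap.
Variables (S T : comNzRingType) (h : {rmorphism S -> T}).
Lemma fps_map_is_zmod_morphism : zmod_morphism (fps_map h).
Proof. by move=> x y; apply/funext => n; rewrite fpsBE /fps_map fpsBE rmorphB. Qed.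
Lemma fps_map_is_monoid_morphism : monoid_morphism (fps_map h).
Proof.
split; first by apply/funext => n; rewrite /fps_map !fps1E rmorph_nat.
move=> x y; apply/funext => n; rewrite fpsME /fps_map fpsME rmorph_sum.
by apply: eq_bigr => i _; rewrite rmorphM.
Qed.
HB.instance Definition _ :=
  GRing.isZmodMorphism.Build (fps S) (fps T) (fps_map h) fps_map_is_zmod_morphism.
HB.instance Definition _ :=
  GRing.isMonoidMorphism.Build (fps S) (fps T) (fps_map h) fps_map_is_monoid_morphism.
Lemma fps_mapE (a : fps S) n : fps_map h a n = h (a n). Proof. by []. Qed.
Lemma fps_mapC k : fps_map h (fpsC k) = fpsC (h k).
Proof. by apply/funext => n; rewrite /fps_map /fpsC; case: eqP; rewrite ?rmorph0. Qed.
End FpsMap.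

(** * Evaluation of power series at a point *)

Section Eval.
Variables (R : realType) (L : fieldType) (a : L -> R).
Hypotheses (ha : nonarch_abs a) (hc : abs_complete a).
Add Ring Lring : (rT_ring L).
Implicit Types c d : fps L.

(** A relation and not a function, since it also asserts convergence. *)
Definition ev c (t S : L) : Prop := hsum a (fun n => c n * t ^+ n) S.

Lemma ev_uniq c t S T : ev c t S -> ev c t T -> S = T.
Proof. exact: hsum_uniq. Qed.

Lemma evD c d t S T : ev c t S -> ev d t T -> ev (c + d) t (S + T).
Proof.
by move=> hS hT; apply: eq_hsum (hsumD ha hS hT) => n; rewrite fpsDE mulrDl.
Qed.
Lemma evB c d t S T : ev c t S -> ev d t T -> ev (c - d) t (S - T).
Proof.
by move=> hS hT; apply: eq_hsum (hsumB ha hS hT) => n; rewrite fpsBE mulrBl.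
Qed.
Lemma ev0 t : ev 0 t 0.
Proof. by apply: hsum_fin0 => // n; rewrite fps0E mul0r. Qed.

Lemma evM c d t S T : ev c t S -> ev d t T -> ev (c * d) t (S * T).
Proof.
move=> hS hT; have h := hsumM ha hc hS hT.
pose y (p : nat * nat) := if (p.2 <= p.1)%N then c p.2 * d (p.1 - p.2)%N * t ^+ p.1 else 0.
have {}h : hsum a y (S * T).
  apply/(@hsum_reindex _ _ _ _ _ (fun p : nat * nat => ((p.1 + p.2)%N, p.1))).
  - move=> [i j] [i' j'] E; have /= E1 := congr1 snd E; have /= := congr1 fst E.
    by rewrite E1 => /addnI ->.
  - move=> [n i]; rewrite /y /=; case: leqP => [le_in _|]; last by rewrite eqxx.
    by exists (i, (n - i)%N); rewrite /= subnKC.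
  apply: eq_hsum h => -[i j]; rewrite /y /= leq_addr addnC addnK exprD; rring L.
apply: (hsum_Fubini ha _ h) => n; rewrite fpsME mulr_suml.
rewrite (_ : \sum_(i < n.+1) _ = \sum_(i <- iota 0 n.+1) y (n, i)).
  apply: hsum_fin => //; first exact: iota_uniq.
  by move=> i; rewrite mem_iota add0n /= ltnS /y /=; case: leqP.
rewrite -[iota 0 n.+1]/(index_iota 0 n.+1) big_mkord; apply: eq_bigr => i _.
by rewrite /y /= -ltnS ltn_ord.
Qed.

Lemma evC k t : ev (fpsC k) t k.
Proof.
have := @hsum_fin _ _ _ ha _ (fun n => fpsC k n * t ^+ n) [:: 0%N] isT.
rewrite big_seq1 /fpsC /= expr0 mulr1; apply=> i; rewrite inE.
by case: eqP => // _ _; rewrite mul0r.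
Qed.
Lemma ev1 t : ev 1 t 1. Proof. by rewrite -(rmorph1 (@fpsC L)); apply: evC. Qed.
Lemma evX t : ev (fpsX L) t t.
Proof.
have := @hsum_fin _ _ _ ha _ (fun n => fpsX L n * t ^+ n) [:: 1%N] isT.
rewrite big_seq1 /fpsX /= expr1 mul1r; apply=> i; rewrite inE.
by case: eqP => // _ _; rewrite mul0r.
Qed.
Lemma evXn c t S n : ev c t S -> ev (c ^+ n) t (S ^+ n).
Proof.
by move=> h; elim: n => [|n IH]; rewrite ?expr0 ?exprS; [apply: ev1|apply: evM].
Qed.
Lemma evZ k c t S : ev c t S -> ev (fpsC k * c) t (k * S).
Proof. by apply: evM; apply: evC. Qed.
Lemma evN c t S : ev c t S -> ev (- c) t (- S).
Proof. by rewrite -[- c]sub0r -[- S]sub0r; apply: evB; apply: ev0. Qed.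
Lemma ev_sum (I : Type) (s : seq I) (P : pred I) (F : I -> fps L) G t :
  (forall i, P i -> ev (F i) t (G i)) ->
  ev (\sum_(i <- s | P i) F i) t (\sum_(i <- s | P i) G i).
Proof.
by move=> h; elim/big_rec2: _ => [|i x y Pi]; [apply: ev0|apply: evD; apply: h].
Qed.

Lemma ev_null c t S : ev c t S -> rnull (fun n => a (c n) * a t ^+ n).
Proof. by move=> /(hsum_null ha); apply: rnull_le => n; rewrite naM // naX. Qed.

Lemma null_ev c t : rnull (fun n => a (c n) * a t ^+ n) -> exists S, ev c t S.
Proof.
by move=> h; apply: (null_hsum ha hc); apply: null_le h => n; rewrite naM // naX.
Qed.

(** The zeros t0 e^j accumulate at 0. If c_n is the first nonzero coefficient, the later terms at t0
    e^j are bounded by a constant times |e|^(j(n+1)), which for large j is smaller than |c_n t0^n|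
    |e|^(jn). *)
Lemma pseries_uniq c (e t0 : L) : t0 != 0 -> 0 < a e < 1 -> e != 0 ->
  (forall j, ev c (t0 * e ^+ j) 0) -> c = 0.
Proof.
move=> t00 /andP[e0 e1] ne0 h; apply/funext => n; rewrite fps0E.
elim/ltn_ind: n => n IH; apply/eqP/negPn/negP => cn0.
have [B B0 hB] := rnull_bounded (ev_null (h 0%N)).
rewrite expr0 mulr1 in hB.
pose m := a (c n) * a t0 ^+ n.
have m0 : 0 < m by rewrite mulr_gt0 ?exprn_gt0 // na_gt0.
have [j /(_ j (leqnn _)) hj] : exists N, forall k, (N <= k)%N -> a e ^+ k < m / B.
  have /rnull_natP : rnull (fun k => a e ^+ k) by apply: rnull_geom; rewrite (ltW e0) e1.
  by apply; rewrite divr_gt0.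
set t := t0 * e ^+ j; have at_ : a t = a t0 * a e ^+ j by rewrite naM // naX.
have ej1 : a e ^+ j <= 1 by rewrite exprn_ile1 // ltW.
have ej0 : 0 < a e ^+ j by rewrite exprn_gt0.
have hS := h j; rewrite -/t in hS.
pose x i := if i == n then c n * t ^+ n else 0.
have hx : hsum a x (c n * t ^+ n).
  have := @hsum_fin _ _ _ ha _ x [:: n] isT; rewrite big_seq1 /x eqxx; apply=> i.
  by rewrite inE; case: eqP.
have := hsum_le ha (B := B * a e ^+ j ^+ n.+1) _ _ (hsumB ha hS hx).
rewrite sub0r naN // naM // naX // at_ exprMn mulrA -/m.
have B1 : 0 <= B * a e ^+ j ^+ n.+1 by rewrite mulr_ge0 ?exprn_ge0 // ltW.
move=> /(_ B1) => H.
have : m * a e ^+ j ^+ n <= B * a e ^+ j ^+ n.+1.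
  apply: H => i; rewrite /x; case: eqP => [->|/eqP]; first by rewrite subrr na0.
  rewrite neq_ltn => /orP[/IH->|lt_ni]; first by rewrite mul0r subrr na0.
  rewrite subr0 naM // naX // at_ exprMn mulrA ler_pM ?mulr_ge0 ?exprn_ge0 ?na_ge0 //.
  by apply: ler_wiXn2l => //; exact: ltW.
have Xn : 0 < a e ^+ j ^+ n by rewrite exprn_gt0.
rewrite exprS mulrA ler_pM2r // leNgt => /negP; apply.
by rewrite mulrC -ltr_pdivlMr.
Qed.
End Eval.

(** * The base field and the absolute value at infinity *)

(** By Cauchy's theorem a prime divisor of the cardinality is the additive order of an element, and
    p kills every element. *)
Lemma pnat_card_finField (F : finFieldType) p : p \in [pchar F] -> p.-nat #|F|.
Proof.
move=> pF; have [pp _] := andP pF.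
apply/pnatP; first by rewrite (cardD1 0).
move=> r pr rF; rewrite -cardsT in rF.
have [x _ ox] := Cauchy (G := fingroup.setT_group _) pr rF.
have : (x ^+ p)%g == 1%g.
  apply/eqP; by rewrite -[(x ^+ p)%g]/(x *+ p) -mulr_natr (pcharf0 pF) mulr0.
rewrite -order_dvdn ox dvdn_prime2 // => /eqP->; exact: eqxx.
Qed.

Lemma card_finField_gt1 (F : finFieldType) : (1 < #|F|)%N.
Proof. by rewrite (cardD1 0) (cardD1 1) !inE oner_eq0. Qed.

Lemma expf_card_unit (F : finFieldType) (x : F) : x != 0 -> x ^+ #|F|.-1 = 1.
Proof.
move=> x0; have inj : injective ( *%R x) by apply: mulfI.
have : \prod_(y : F | y != 0) y = \prod_(y : F | x * y != 0) (x * y).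
  by rewrite (reindex_inj inj).
rewrite [RHS](eq_bigl (fun y => y != 0)) => [|y]; last by rewrite mulf_eq0 negb_or x0.
rewrite big_split /= prodr_const.
have -> : #|[pred y : F | y != 0]| = #|F|.-1.
  exact: cardC1.
set Q := \prod_(i | _) i => E; apply/esym/(mulIf (x := Q)); last by rewrite mul1r.
by apply/prodf_neq0 => y.
Qed.

Lemma expf_card (F : finFieldType) (x : F) : x ^+ #|F| = x.
Proof.
have q1 := card_finField_gt1 F.
have [->|x0] := eqVneq x 0; first by rewrite expr0n; case: #|F| q1.
by rewrite -[#|F|]prednK 1?ltnW // exprS expf_card_unit ?mulr1.
Qed.

(** X^N - 1 is coprime to its derivative N X^(N-1), hence has N distinct roots. *)
Lemma prim_root_ex (L : closedFieldType) (N : nat) : N%:R != 0 :> L ->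
  exists z : L, N.-primitive_root z.
Proof.
move=> N0; have Ngt0 : (0 < N)%N by case: N N0 => //; rewrite eqxx.
have [r] := closed_field_poly_normal ('X^N - 1 : {poly L}).
rewrite (monicP (monicXnsubC 1 Ngt0)) scale1r => rE.
have rP z : (z \in r) = (N.-unity_root z).
  by rewrite -root_prod_XsubC -rE.
have szr : size r = N.
  by have := size_prod_XsubC r id; rewrite -rE size_XnsubC // => -[].
have unr : uniq r.
  rewrite -separable_prod_XsubC -rE unlock derivB derivXn derivC subr0.
  apply/coprimepP => d d1; rewrite -scaler_nat dvdpZr // => d2.
  have : d %| 1.
    have -> : 1 = 'X^(N.-1) * 'X - ('X^N - 1) :> {poly L}.
      by rewrite -exprSr prednK // opprB addrC addrNK.
    by rewrite dvdp_sub // dvdp_mulr.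
  by rewrite dvdp1 size_poly_eq1.
have := @has_prim_root _ N r Ngt0; rewrite unr szr leqnn => /(_ _ isT isT).
rewrite (_ : all _ r); last by apply/allP => z; rewrite rP.
by move=> /(_ isT)/hasP[z _ zP]; exists z.
Qed.

Lemma sum_prim_root (L : fieldType) (N m : nat) (z : L) : N.-primitive_root z ->
  \sum_(t < N) z ^+ (m * t) = if (N %| m)%N then N%:R else 0.
Proof.
move=> zP; rewrite (prim_order_dvd zP); case: eqP => [zm|/eqP zm].
  rewrite (eq_bigr (fun=> 1)) => [|t _]; last by rewrite exprM zm expr1n.
  by rewrite sumr_const card_ord.
apply: (mulfI (x := z ^+ m - 1)); first by rewrite subr_eq0.
rewrite mulr0 (eq_bigr (fun t : 'I_N => (z ^+ m) ^+ t)) => [|t _]; last by rewrite exprM.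
by rewrite -subrX1 -exprM mulnC exprM (prim_expr_order zP) expr1n subrr.
Qed.

HB.instance Definition _ (F : finFieldType) :=
  GRing.RMorphism.copy (@inK F) (@FracField.tofrac {poly F}).

Section CinftyBasics.
Variables (R : realType) (F : finFieldType) (C : Cinfty R F).
Notation A := {poly F}.
Notation K := {fraction {poly F}}.
Notation aC := (@absC R F C).
Notation iC := (@KtoC R F C).
Notation q := #|F|.
Notation qR := (#|F|%:R : R).

Definition iA (a : A) : C := iC (inK a).
HB.instance Definition _ := GRing.RMorphism.copy iA (iC \o @inK F).
Lemma iAE a : iA a = iC (inK a). Proof. by []. Qed.

Let ha := absC_nonarch C.
Let hc := @absC_complete R F C.

Lemma qR_gt1 : 1 < qR.
Proof. by rewrite ltr1n card_finField_gt1. Qed.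
Lemma qR_gt0 : 0 < qR. Proof. exact: lt_trans ltr01 qR_gt1. Qed.
Lemma qR_ge1 : 1 <= qR. Proof. exact/ltW/qR_gt1. Qed.
Hint Resolve qR_gt0 qR_gt1 qR_ge1 : core.

Lemma aC_iA (a : A) : a != 0 -> aC (iA a) = qR ^+ (size a).-1.
Proof. exact: absC_deg. Qed.

Lemma iA_eq0 a : (iA a == 0) = (a == 0).
Proof. by rewrite /iA fmorph_eq0 /inK tofrac_eq0. Qed.

Lemma aC_theta : aC (iA 'X) = qR.
Proof. by rewrite aC_iA ?polyX_eq0 // size_polyX expr1. Qed.

Lemma aC_iA_ge1 a : a != 0 -> 1 <= aC (iA a).
Proof. by move=> a0; rewrite aC_iA // exprn_ege1. Qed.

Lemma aC_const (k : F) : aC (iA k%:P) <= 1.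
Proof.
have [->|k0] := eqVneq k 0; first by rewrite rmorph0 (na0 ha) ler01.
by rewrite aC_iA ?polyC_eq0 // size_polyC k0 expr0.
Qed.

Lemma fracP (k : K) : exists a b : A, b != 0 /\ k = inK a / inK b.
Proof.
exists (frac (repr k)).1, (frac (repr k)).2.
have d0 := denom_ratioP (repr k); split => //.
apply: (canRL (mulfK _)); first by rewrite tofrac_eq0.
rewrite -{1}[k]reprK /inK; unlock FracField.tofrac.
rewrite -[LHS]FracField.pi_mul; apply/eqmodP.
by rewrite /= FracField.equivfE /FracField.mulf !numden_Ratio ?mulr1 ?mulf_neq0 ?oner_eq0 // mulrC.
Qed.

Lemma pchar_C p : p \in [pchar F] -> p \in [pchar C].
Proof.
move=> /andP[pp /eqP p0]; rewrite inE pp /=.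
have -> : p%:R = iA (p%:R%:P) by rewrite !rmorph_nat.
by rewrite p0 !rmorph0.
Qed.

Lemma frob_C p (hp : p \in [pchar F]) (x y : C) n : (x + y) ^+ (q ^ n) = x ^+ (q ^ n) + y ^+ (q ^ n).
Proof.
apply: exprDn_pchar; rewrite pnatX; apply/orP; left.
by rewrite (eq_pnat _ (pcharf_eq (pchar_C hp))); apply: pnat_card_finField.
Qed.
End CinftyBasics.

(** * Rigid analytic functions on the upper half plane *)

Section Rigid.
Variables (R : realType) (F : finFieldType) (C : Cinfty R F) (p : nat).
Hypothesis hp : p \in [pchar F].
Notation A := {poly F}.
Notation K := {fraction {poly F}}.
Notation aC := (@absC R F C).
Notation iC := (@KtoC R F C).
Notation iA := (@iA R F C).
Notation q := #|F|.
Notation qR := (#|F|%:R : R).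
Add Ring Cring : (rT_ring C).

Let ha := absC_nonarch C.
Let hc := @absC_complete R F C.
Let q1 : 1 < qR := qR_gt1 R F.
Let q0 : 0 < qR := qR_gt0 R F.
Let qge1 : 1 <= qR := qR_ge1 R F.
Hint Resolve q1 q0 qge1 : core.

(** The distance is measured to K instead of its closure: for b > 0 this is the same condition
    ([Kinfty_farP]), and it is stable under the operations used later without passing to limits. *)
Definition far (b : R) (z : C) : Prop := forall k : K, b <= aC (z - iC k).

Lemma Kinfty_farP b z : 0 < b ->
  (forall x, Kinfty x -> b <= aC (z - x)) <-> far b z.
Proof.
move=> b0; split=> h => [k|x hx].
  by apply: h => e e0; exists (iC k); [exists k|rewrite subrr (na0 ha)].
have [_ [k _ <-] hk] := hx b b0.
rewrite leNgt; apply/negP => lt; have := h k; rewrite leNgt => /negP; apply.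
have := na_ltD ha lt hk; by rewrite addrA addrNK.
Qed.

Lemma far_le b b' z : b' <= b -> far b z -> far b' z.
Proof. by move=> bb h k; apply: le_trans (h k). Qed.

Lemma far_add b z e : far b z -> aC e < b -> far b (z + e).
Proof.
move=> h eb k; have := h k; rewrite !leNgt; apply: contraNN => lt.
by have := na_ltB ha lt eb; rewrite addrAC addrK.
Qed.

Lemma OmegaP z : Omega z <-> exists2 b : R, 0 < b & far b z.
Proof.
split=> [nz|[b b0 h] hz]; last first.
  have /(Kinfty_farP _ b0) /(_ z hz) := h.
  by rewrite subrr (na0 ha) leNgt b0.
apply: contrapT => h; apply: nz => e e0.
have [k hk] : exists k : K, ~ (e <= aC (z - iC k)).
  apply: contrapT => h2; apply: h; exists e => // k.
  by apply: contrapT => h3; apply: h2; exists k.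
by exists (iC k); [exists k|rewrite ltNge; apply/negP].
Qed.

Lemma Omega_affP n z : Omega_aff n z <-> aC z <= qR ^+ n /\ far (qR ^- n) z.
Proof.
have b0 : 0 < qR ^- n by rewrite invr_gt0 exprn_gt0.
by split=> -[h1 /(Kinfty_farP _ b0) h2].
Qed.

Lemma q_archi (x : R) : exists n, x <= qR ^+ n.
Proof.
exists (Num.bound x); apply: (@le_trans _ _ (2%:R ^+ Num.bound x)).
  by apply/ltW/upper_nthrootP.
by apply: lerXn2r; rewrite ?nnegrE ?ler0n // ler_nat card_finField_gt1.
Qed.

Lemma Omega_ex z : Omega (C := C) z -> exists n, Omega_aff n z.
Proof.
move=> /OmegaP [b b0 h]; have [n hn] := q_archi (aC z); have [m hm] := q_archi b^-1.
exists (maxn n m); apply/Omega_affP; split.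
  by apply: le_trans hn _; rewrite ler_weXn2l // leq_maxl.
apply: far_le h; rewrite invf_ple ?posrE ?exprn_gt0 //.
by apply: le_trans hm _; rewrite ler_weXn2l // leq_maxr.
Qed.

Lemma Omega_aff_Omega n z : Omega_aff (C := C) n z -> Omega z.
Proof.
by move=> /Omega_affP [_ h]; apply/OmegaP; exists (qR ^- n); rewrite // invr_gt0 exprn_gt0.
Qed.

Lemma Omega_aff_shift n z e : Omega_aff n z -> aC e < qR ^- n -> Omega_aff n (z + e).
Proof.
move=> /Omega_affP [h1 h2] he; apply/Omega_affP; split; last exact: far_add.
apply: na_leD => //; apply: le_trans (ltW he) _; apply: (@le_trans _ _ 1).
  by rewrite invf_le1 ?exprn_gt0 // exprn_ege1.
by rewrite exprn_ege1.
Qed.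

(** Its absolute value q^-(n+1) is below q^-n, so the closed disc of this radius around a point of
    [Omega_aff n] stays inside [Omega_aff n]. *)
Definition tdisc n : C := iA 'X ^- n.+1.
Lemma aC_tdisc n : aC (tdisc n) = qR ^- n.+1.
Proof. by rewrite /tdisc naV // naX // aC_theta. Qed.
Lemma tdisc_neq0 n : tdisc n != 0.
Proof. by rewrite invr_neq0 // expf_neq0 // iA_eq0 polyX_eq0. Qed.
Lemma tdisc_lt n m : (n <= m)%N -> aC (tdisc m) < qR ^- n.
Proof.
by move=> nm; rewrite aC_tdisc ltf_pV2 ?posrE ?exprn_gt0 // ltr_eXn2l.
Qed.

Definition rigid_on n (f : C -> C) := forall e : R, 0 < e ->
  exists g h : {poly C}, forall z, Omega_aff n z -> h.[z] != 0 /\ aC (f z - g.[z] / h.[z]) < e.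

Lemma poly_bounded (g : {poly C}) (B : R) :
  exists2 M, 0 < M & forall z, aC z <= B -> aC g.[z] <= M.
Proof.
elim/poly_ind: g => [|g c [M M0 IH]].
  by exists 1 => // z _; rewrite horner0 (na0 ha).
exists (M * (Num.max B 0) + aC c + 1).
  have B0 : 0 <= Num.max B 0 by rewrite le_max lexx orbT.
  have c0 := na_ge0 ha c; have MB : 0 <= M * Num.max B 0 by rewrite mulr_ge0 // ltW.
  by lra.
move=> z zB; rewrite hornerMXaddC.
have B0 : 0 <= Num.max B 0 by rewrite le_max lexx orbT.
have c0 := na_ge0 ha c; have MB : 0 <= M * Num.max B 0 by rewrite mulr_ge0 // ltW.
apply: na_leD => //; last by lra.
rewrite naM //; apply: (@le_trans _ _ (M * Num.max B 0)); last by lra.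
by apply: ler_pM; rewrite ?na_ge0 ?IH // le_max zB.
Qed.

(** A point outside the affinoid is either too large or too close to some element of K, and [z]
    keeps its distance from both kinds. Applied to the roots of a denominator, this bounds it from
    below. *)
Lemma root_far n z x : Omega_aff n z -> ~ Omega_aff n x -> qR ^- n <= aC (z - x).
Proof.
move=> /Omega_affP [h1 h2] nx; have [le|lt] := leP (aC x) (qR ^+ n).
  have [k hk] : exists k, aC (x - iC k) < qR ^- n.
    apply: contrapT => h; apply: nx; apply/Omega_affP; split => // k.
    by rewrite leNgt; apply/negP => lt; apply: h; exists k.
  have := h2 k; rewrite !leNgt; apply: contraNN => lt.
  by have := na_ltD ha lt hk; rewrite addrA addrNK.
rewrite na_addr // ?naN //; last exact: le_lt_trans lt.
apply: le_trans (ltW lt); apply: (@le_trans _ _ 1).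
  by rewrite invf_le1 ?exprn_gt0 // exprn_ege1.
by rewrite exprn_ege1.
Qed.

Lemma poly_split (h : {poly C}) :
  exists (k : C) (r : seq C), forall z, h.[z] = k * \prod_(x <- r) (z - x).
Proof.
have [r hr] := closed_field_poly_normal h; exists (lead_coef h), r => z.
rewrite {1}hr hornerZ horner_prod; congr (_ * _).
by apply: eq_bigr => x _; rewrite hornerXsubC.
Qed.

Lemma denom_lower n (h : {poly C}) : (forall z, Omega_aff n z -> h.[z] != 0) ->
  exists2 k : R, 0 < k & forall z, Omega_aff n z -> k <= aC h.[z].
Proof.
move=> h0; have [[z0 hz0]|nz] := pselect (exists z, Omega_aff (C := C) n z); last first.
  by exists 1 => // z hz; case: nz; exists z.
have [l [r hE]] := poly_split h.
have l0 : l != 0 by have := h0 _ hz0; rewrite hE mulf_eq0 negb_or => /andP[].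
exists (aC l * \prod_(x <- r) qR ^- n).
  by rewrite mulr_gt0 ?na_gt0 // prodr_gt0 // => x _; rewrite invr_gt0 exprn_gt0.
move=> z hz; rewrite hE naM // ler_wpM2l ?na_ge0 // na_prod // !big_seq.
apply: ler_prod => x xr; rewrite invr_ge0 exprn_ge0 ?(ltW q0) //=.
apply: root_far => // hx; have := h0 _ hx; rewrite hE (big_rem x) //=.
by rewrite subrr mul0r mulr0 eqxx.
Qed.

Lemma rigid_on_bounded n f : rigid_on n f ->
  exists2 M, 0 < M & forall z, Omega_aff n z -> aC (f z) <= M.
Proof.
move=> /(_ 1 ltr01) [g [h gh]].
have [k k0 hk] := denom_lower (fun z hz => (gh z hz).1).
have [M M0 hM] := poly_bounded g (qR ^+ n).
exists (M / k + 1); first by rewrite addr_gt0 // divr_gt0.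
have Mk : 0 < M / k by rewrite divr_gt0.
move=> z hz; have [h0 fe] := gh z hz; have /Omega_affP [zn _] := hz.
rewrite -[f z](subrK (g.[z] / h.[z])); apply: na_leD => //; first by lra.
rewrite naM // naV //; apply: (@le_trans _ _ (M / k)); last by lra.
apply: ler_pM; rewrite ?invr_ge0 ?na_ge0 ?hM // lef_pV2 ?posrE ?hk //.
by rewrite na_gt0.
Qed.

Lemma rigid_on_eq n f f' : (forall z, Omega_aff n z -> f z = f' z) ->
  rigid_on n f -> rigid_on n f'.
Proof.
move=> ff h e e0; have [g [k gk]] := h e e0.
by exists g, k => z hz; rewrite -ff //; apply: gk.
Qed.

Lemma rigid_on_poly n (g : {poly C}) : rigid_on n (fun z => g.[z]).
Proof.
by move=> e e0; exists g, 1 => z _; rewrite hornerC oner_eq0 divr1 subrr (na0 ha).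
Qed.

Lemma rigid_on_rat n (g h : {poly C}) : (forall z, Omega_aff n z -> h.[z] != 0) ->
  rigid_on n (fun z => g.[z] / h.[z]).
Proof. by move=> h0 e e0; exists g, h => z /h0 ->; rewrite subrr (na0 ha). Qed.

Lemma rigid_on_const n k : rigid_on n (fun=> k).
Proof.
by apply: rigid_on_eq (rigid_on_poly n k%:P) => z _; rewrite hornerC.
Qed.

Lemma rigid_onD n f g : rigid_on n f -> rigid_on n g -> rigid_on n (fun z => f z + g z).
Proof.
move=> hf hg e e0; have [a [b ab]] := hf e e0; have [c [d cd]] := hg e e0.
exists (a * d + c * b), (b * d) => z hz.
have [b0 h1] := ab z hz; have [d0 h2] := cd z hz.
rewrite !hornerE mulf_neq0 //; split => //.
have -> : f z + g z - (a.[z] * d.[z] + c.[z] * b.[z]) / (b.[z] * d.[z]) =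
   (f z - a.[z] / b.[z]) + (g z - c.[z] / d.[z]).
  by rewrite -addf_div // opprD addrACA.
exact: na_ltD.
Qed.

Lemma rigid_onM n f g : rigid_on n f -> rigid_on n g -> rigid_on n (fun z => f z * g z).
Proof.
move=> hf hg e e0; have [M M0 hM] := rigid_on_bounded hf.
have [N N0 hN] := rigid_on_bounded hg.
(* The bound [M] on the error keeps the approximant [x] of [f z] itself bounded by [M]. *)
have eM : 0 < Num.min (e / N) M by rewrite lt_min divr_gt0.
have [a [b ab]] := hf _ eM.
have [c [d cd]] := hg (e / M) (divr_gt0 e0 M0).
exists (a * c), (b * d) => z hz.
have [b0 h1] := ab z hz; have [d0 h2] := cd z hz.
rewrite !hornerE mulf_neq0 //; split => //; rewrite -mulf_div.
set x := _ / _ in h1 *; set y := _ / _ in h2 *.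
have -> : f z * g z - x * y = (f z - x) * g z + x * (g z - y) by rring C.
have xM : aC x <= M.
  rewrite -[x](subKr (f z)); apply: na_leB => //; first exact: hM.
  by move: h1; rewrite lt_min => /andP[_ /ltW].
apply: na_ltD => //; rewrite naM //.
  apply: (@le_lt_trans _ _ (aC (f z - x) * N)); first by rewrite ler_wpM2l ?na_ge0 ?hN.
  by rewrite -ltr_pdivlMr //; move: h1; rewrite lt_min => /andP[].
apply: (@le_lt_trans _ _ (M * aC (g z - y))); first by rewrite ler_wpM2r ?na_ge0.
by rewrite mulrC -ltr_pdivlMr.
Qed.

Lemma rigid_onX n f j : rigid_on n f -> rigid_on n (fun z => f z ^+ j).
Proof.
move=> hf; elim: j => [|j IH].
  by apply: rigid_on_eq (rigid_on_const n 1) => z; rewrite expr0.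
by apply: rigid_on_eq (rigid_onM hf IH) => z; rewrite exprS.
Qed.

Lemma rigid_on_sum n (I : Type) (s : seq I) (P : pred I) f :
  (forall i, P i -> rigid_on n (f i)) -> rigid_on n (fun z => \sum_(i <- s | P i) f i z).
Proof.
move=> hf; elim: s => [|i s IH].
  by apply: rigid_on_eq (rigid_on_const n 0) => z _; rewrite big_nil.
case Pi: (P i).
  apply: rigid_on_eq (rigid_onD (hf i Pi) IH) => z _; by rewrite big_cons Pi.
by apply: rigid_on_eq IH => z _; rewrite big_cons Pi.
Qed.

Lemma rigid_on_lim n f :
  (forall e, 0 < e -> exists2 g, rigid_on n g & forall z, Omega_aff n z -> aC (f z - g z) < e) ->
  rigid_on n f.
Proof.
move=> hf e e0; have [g hg fg] := hf e e0; have [a [b ab]] := hg e e0.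
exists a, b => z hz; have [b0 h] := ab z hz; split => //.
by have := na_ltD ha (fg z hz) h; rewrite addrA addrNK.
Qed.

Lemma rigid_on_comp n m f (k e : C) :
  (forall z, Omega_aff n z -> Omega_aff m (k * z + e)) ->
  rigid_on m f -> rigid_on n (fun z => f (k * z + e)).
Proof.
move=> hz hf d d0; have [a [b ab]] := hf d d0.
exists (a \Po (k *: 'X + e%:P)), (b \Po (k *: 'X + e%:P)) => z hn.
by rewrite !horner_comp !hornerE; apply: ab; apply: hz.
Qed.

Lemma ev_poly (g : {poly C}) t : ev aC (fun n => g`_n : C) t g.[t].
Proof.
rewrite horner_coef -(big_mkord xpredT (fun i => g`_i * t ^+ i)).
apply: hsum_fin => //; first exact: iota_uniq.
move=> i; rewrite mem_iota subn0 add0n /= -leqNgt => si.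
by rewrite nth_default ?mul0r.
Qed.

Lemma ev_inv_lin (x t : C) : aC t < aC x ->
  ev aC (fun n => x^-1 ^+ n.+1 : C) t (x - t)^-1.
Proof.
move=> tx; have x0 : x != 0 by rewrite -(na_gt0 ha); apply: le_lt_trans tx; apply: na_ge0.
set c : fps C := fun n => _.
have [S hS] : exists S, ev aC c t S.
  apply: null_ev => //; apply: (@rnull_le _ _ _ (fun n => (aC x)^-1 * (aC t / aC x) ^+ n)).
    move=> n; rewrite /c (naX ha) (naV ha) exprS exprMn -mulrA.
    by rewrite [_ * aC t ^+ n]mulrC.
  apply: rnull_scale; first by rewrite invr_ge0 na_ge0.
  apply: rnull_geom; rewrite divr_ge0 ?na_ge0 //= ltr_pdivrMr ?mul1r //.
  by rewrite na_gt0.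
suff <- : S = (x - t)^-1 by [].
have tx0 : x - t != 0 by rewrite -(na_gt0 ha) na_addl ?naN // na_gt0.
apply: (mulfI tx0); rewrite divff //.
apply: (@ev_uniq _ _ _ ha ((fpsC x - fpsX C) * c) t).
  by apply: (evM ha hc) => //; apply: (evB ha) => //; [apply: (evC ha)|apply: (evX ha)].
suff -> : (fpsC x - fpsX C) * c = 1 by apply: (ev1 ha).
apply/funext => -[|n]; rewrite mulrBl fpsBE fpsCM ?fpsXM0 ?fpsXM fps1E /c.
  by rewrite subr0 expr1 divff.
by rewrite exprS mulrA divff // mul1r subrr.
Qed.

(** The denominator splits into linear factors; none of its roots lies in the closed disc, so each
    factor is inverted by a geometric series converging there. *)
Lemma rat_ev (g h : {poly C}) z (t0 : C) :
  (forall t, aC t <= aC t0 -> h.[z + t] != 0) ->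
  exists c : fps C, forall t, aC t <= aC t0 -> ev aC c t (g.[z + t] / h.[z + t]).
Proof.
move=> h0; have [k [r hE]] := poly_split h.
have [d hd] : exists d : fps C, forall t, aC t <= aC t0 ->
    ev aC d t (\prod_(x <- r) (z + t - x)^-1).
  have {h0}: forall x t, x \in r -> aC t <= aC t0 -> z + t - x != 0.
    move=> x t xr /h0; rewrite hE (big_rem x) //= !mulf_eq0 !negb_or.
    by case/and3P.
  elim: r {hE} => [|x r IH] h0.
    by exists 1 => t _; rewrite big_nil; apply: (ev1 ha).
  have [d hd] := IH (fun y t yr => h0 y t (mem_behead (s := x :: r) yr)).
  pose gx : fps C := fun n => (x - z)^-1 ^+ n.+1.
  exists (- gx * d) => t ht.
  rewrite big_cons; apply: (evM ha hc) => //; last exact: hd.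
  have -> : (z + t - x)^-1 = - (x - z - t)^-1.
    by rewrite -invrN; congr (_^-1); rring C.
  apply: (evN ha) => //; apply: ev_inv_lin.
  rewrite ltNge; apply/negP => le; have := h0 x (x - z) (mem_head _ _) (le_trans le ht).
  by rewrite subrKC subrr eqxx.
pose gz : fps C := fun n => (g \Po ('X + z%:P))`_n.
exists (fpsC k^-1 * (gz * d)) => t ht.
have -> : g.[z + t] / h.[z + t] = k^-1 * (g.[z + t] * \prod_(x <- r) (z + t - x)^-1).
  by rewrite hE prodfV invfM; exact: mulrCA.
apply: (evZ ha hc) => //; apply: (evM ha hc) => //; last exact: hd.
rewrite (_ : g.[z + t] = (g \Po ('X + z%:P)).[t]); first exact: ev_poly.
by rewrite horner_comp !hornerE addrC.
Qed.

(** A discrete Cauchy formula: averaging over the N-th roots of unity extracts the coefficient j, up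
    to the terms whose index differs from j by a multiple of N. Taking N = 1 modulo p removes the
    division by N, and N > N0 + j pushes the unwanted indices beyond N0. The weights [u t] are the
    powers of the root to the exponent -jt, written with N - j. *)
Lemma root_average (t0 : C) (j N0 : nat) :
  exists (N : nat) (u v : 'I_N -> C),
  [/\ forall t, aC (u t) = 1, forall t, aC (v t) = 1 &
    forall (c : fps C) (S : 'I_N -> C) (B : R), 0 <= B ->
      (forall t, ev aC c (t0 * v t) (S t)) ->
      (forall i, (N0 <= i)%N -> aC (c i) * aC t0 ^+ i <= B) ->
      aC (\sum_t u t * S t - c j * t0 ^+ j) <= B].
Proof.
have [pp _] := andP hp; have p0 := prime_gt0 pp.
pose N := (p * (N0 + j)).+1.
have N0N : (N0 + j < N)%N by rewrite ltnS leq_pmull.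
have N1 : N%:R = 1 :> C by rewrite /N -addn1 natrD natrM (pcharf0 (pchar_C C hp)) mul0r add0r.
have [w wP] : exists w : C, N.-primitive_root w.
  by apply: prim_root_ex; rewrite N1 oner_eq0.
have wN := prim_expr_order wP.
have aw : aC w = 1.
  apply/eqP; rewrite -(eqrXn2 (n := N)) ?na_ge0 //.
  by rewrite -naX // wN na1 // expr1n.
exists N, (fun t => w ^+ ((N - j) * t)), (fun t => w ^+ t); split=> [t|t|].
- by rewrite naX // aw expr1n.
- by rewrite naX // aw expr1n.
move=> c S B B0 hS hB; set T := \sum_t _.
pose x i := c i * t0 ^+ i * (if (N %| N - j + i)%N then N%:R else 0).
have hT : hsum aC x T.
  have : hsum aC (fun i => \sum_(t < N) w ^+ ((N - j) * t) * (c i * (t0 * w ^+ t) ^+ i)) T.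
    rewrite /T; elim: (index_enum _) => [|t s IH].
      rewrite big_nil; apply: hsum_fin0 => // i; by rewrite big_nil.
    rewrite big_cons; have := hsumD ha (hsumZ ha (w ^+ ((N - j) * t)) (hS t)) IH.
    by apply: eq_hsum => i; rewrite big_cons.
  apply: eq_hsum => i; rewrite /x -(sum_prim_root _ wP) mulr_sumr.
  apply: eq_bigr => t _; rewrite exprMn -exprM mulnDl exprD [(i * t)%N]mulnC; rring C.
pose y i := if i == j then c j * t0 ^+ j else 0.
have hy : hsum aC y (c j * t0 ^+ j).
  have := @hsum_fin _ _ _ ha _ y [:: j] isT; rewrite big_seq1 /y eqxx; apply=> i.
  by rewrite inE; case: eqP.
have jN : (j <= N)%N by apply: leq_trans (ltnW N0N); rewrite leq_addl.
apply: (hsum_le ha B0 _ (hsumB ha hT hy)) => i.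
rewrite /x /y; case: (eqVneq i j) => [->|ij].
  by rewrite subnK // dvdnn N1 mulr1 subrr (na0 ha).
rewrite subr0; case: ifP => [|_]; last by rewrite mulr0 (na0 ha).
rewrite N1 mulr1 naM // naX // => dv; apply: hB.
rewrite leqNgt; apply/negP => iN0.
have /dvdnP [l] : (N %| N - j + i)%N by [].
case: l => [|[|l]].
- by lia.
- by move/eqP: ij; rewrite mul1n; lia.
- move=> E; have : (N - j + i < 2 * N)%N by lia.
  by rewrite E ltn_mul2r /= ltnNge.
Qed.

(** If the term of index j exceeded [M], one could choose N0 beyond which all terms are at most half
    of it; the average from [root_average], which is at most [M], would then be too close to it. *)
Lemma cauchy_estimate (c : fps C) (t0 : C) (M : R) : 0 <= M ->
  (forall t, aC t <= aC t0 -> exists2 S, ev aC c t S & aC S <= M) ->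
  forall j, aC (c j) * aC t0 ^+ j <= M.
Proof.
move=> M0 hM j; rewrite leNgt; apply/negP; set m := _ * _ => Mm.
have m0 : 0 < m by apply: le_lt_trans Mm.
have m2 : 0 < m / 2 by rewrite divr_gt0.
have [S0 hS0 _] := hM t0 (lexx _).
have /rnull_natP /(_ _ m2) [N0 hN0] := ev_null ha hS0.
have [N [u [v [u1 v1 avg]]]] := root_average t0 j N0.
have /choice [S hS] : forall t : 'I_N, exists S, ev aC c (t0 * v t) S /\ aC S <= M.
  move=> t; have [|S h1 h2] := hM (t0 * v t); last by exists S.
  by rewrite naM // v1 mulr1.
have small := avg c S _ (ltW m2) (fun t => (hS t).1) (fun i hi => ltW (hN0 i hi)).
set T := \sum_t _ in small.
have TM : aC T <= M.
  by apply: na_sum_le => // t _ _; rewrite naM // u1 mul1r; case: (hS t).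
have : aC (c j * t0 ^+ j) <= Num.max M (m / 2).
  rewrite -[c j * _](subKr T); apply: na_leB => //.
    by rewrite le_max TM.
  by rewrite le_max small orbT.
rewrite naM // naX // -/m.
rewrite le_max => /orP[|]; first by rewrite leNgt Mm.
lra.
Qed.

Definition lexp (f : C -> C) (z : C) (c : fps C) : Prop :=
  exists2 d : R, 0 < d & forall t, aC t < d -> ev aC c t (f (z + t)).

Lemma lexp_uniq f z c d : lexp f z c -> lexp f z d -> c = d.
Proof.
move=> [r r0 hr] [s s0 hs]; apply/eqP; rewrite -subr_eq0; apply/eqP.
have [n hn] := q_archi (Num.min r s)^-1.
have rs0 : 0 < Num.min r s by rewrite lt_min r0.
have tn : aC (tdisc n) < Num.min r s.
  rewrite aC_tdisc invf_plt ?posrE ?exprn_gt0 //.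
  by apply: le_lt_trans hn _; rewrite ltr_eXn2l.
have /andP[e0 e1] : 0 < aC (tdisc 0) < 1.
  by rewrite na_gt0 // tdisc_neq0 aC_tdisc expr1 invf_lt1.
apply: (pseries_uniq ha (tdisc_neq0 n) (e := tdisc 0)); rewrite ?e0 ?tdisc_neq0 // => j.
have : aC (tdisc n * tdisc 0 ^+ j) < Num.min r s.
  apply: le_lt_trans tn; rewrite naM // naX // ler_piMr ?na_ge0 //.
  by rewrite exprn_ile1 ?na_ge0 // ltW.
rewrite lt_min => /andP[h1 h2]; rewrite -(subrr (f (z + tdisc n * tdisc 0 ^+ j))).
by apply: (evB ha) => //; [apply: hr|apply: hs].
Qed.

(** The i-th hyperderivative, with value 0 where no local expansion exists. It replaces the i-th
    derivative over i!, which makes no sense in characteristic p. *)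
Definition hd (f : C -> C) (i : nat) (z : C) : C := xget 0 [set c | lexp f z c] i.

Lemma hdE f z c i : lexp f z c -> hd f i z = c i.
Proof. by move=> h; rewrite /hd; case: xgetP => [d _ hd|/(_ c)//]; rewrite (lexp_uniq h hd). Qed.

(** The rational approximants have expansions by [rat_ev]. The Cauchy estimate, applied to their
    differences, makes the coefficients converge uniformly in the index after scaling by |t0|^j, so
    the limit series represents [f]. *)
Lemma rigid_on_disc n f z : rigid_on n f -> Omega_aff n z ->
  exists c : fps C, forall t, aC t <= aC (tdisc n) -> ev aC c t (f (z + t)).
Proof.
move=> hf hz; set t0 := tdisc n.
have disc t : aC t <= aC t0 -> Omega_aff n (z + t).
  by move=> h; apply: Omega_aff_shift hz _; apply: le_lt_trans h (tdisc_lt _).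
have approx e : 0 < e -> exists2 d : fps C, True & forall t, aC t <= aC t0 ->
    exists2 S, ev aC d t S & aC (f (z + t) - S) < e.
  move=> e0; have [g [h gh]] := hf e e0.
  have [d hd] := rat_ev g (fun t ht => (gh _ (disc t ht)).1).
  exists d => // t ht; exists (g.[z + t] / h.[z + t]); first exact: hd.
  exact: (gh _ (disc t ht)).2.
pose ee (n : nat) := (n.+1%:R : R)^-1.
have ee0 k : 0 < ee k by rewrite invr_gt0 ltr0n.
have eesmall e : 0 < e -> exists k : nat, ee k < e.
  move=> e0; exists (Num.truncn e^-1); rewrite /ee invf_plt ?posrE ?ltr0n ?invr_gt0 //.
  exact: truncnS_gt.
have eele k l : (k <= l)%N -> ee l <= ee k.
  by move=> kl; rewrite lef_pV2 ?posrE ?ltr0n // ler_nat ltnS.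
have /choice [d hd] : forall k, exists d : fps C, forall t, aC t <= aC t0 ->
    exists2 S, ev aC d t S & aC (f (z + t) - S) < ee k.
  by move=> k; have [d _ hd] := approx _ (ee0 k); exists d.
have dd k l : (k <= l)%N -> forall j, aC (d l j - d k j) * aC t0 ^+ j <= ee k.
  move=> kl; apply: (@cauchy_estimate (d l - d k)); first exact/ltW.
  move=> t ht; have [S hS S1] := hd l t ht; have [T hT T1] := hd k t ht.
  exists (S - T); first exact: (evB ha).
  have := na_ltB ha T1 (lt_le_trans S1 (eele _ _ kl)).
  by rewrite opprB addrC addrA addrNK => /ltW.
have t0j j : 0 < aC t0 ^+ j by rewrite exprn_gt0 // na_gt0 // tdisc_neq0.
have /choice [c hcj] : forall j, exists l, converges aC (fun k => d k j) l.
  move=> j; apply: hc => e e0; have [N hN] := eesmall (e * aC t0 ^+ j) (mulr_gt0 e0 (t0j j)).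
  exists N; suff key k : (N <= k)%N -> aC (d k j - d N j) < e.
    move=> k l Nk Nl; have := na_ltB ha (key k Nk) (key l Nl).
    by rewrite opprB addrA addrNK.
  by move=> Nk; rewrite -(ltr_pM2r (t0j j)); apply: le_lt_trans hN; apply: dd.
have cd k j : aC (c j - d k j) * aC t0 ^+ j <= ee k.
  rewrite -ler_pdivlMr // leNgt; apply/negP => lt.
  have /(convergesP ha) /(_ _ (lt_trans (divr_gt0 (ee0 k) (t0j j)) lt)) [N hN] := hcj j.
  have h1 := hN _ (leq_maxl N k).
  have h2 : aC (d (maxn N k) j - d k j) <= ee k / aC t0 ^+ j.
    by rewrite ler_pdivlMr //; apply: dd; rewrite leq_maxr.
  have := na_ltB ha (le_lt_trans h2 lt) h1.
  by rewrite opprB addrC addrA addrNK ltxx.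
exists (c : fps C) => t ht.
have cdt k i : aC ((c i - d k i) * t ^+ i) <= ee k.
  apply: le_trans (cd k i); rewrite naM // naX // ler_wpM2l ?na_ge0 //.
  by apply: lerXn2r; rewrite ?nnegrE ?na_ge0.
have [S hS] : exists S, ev aC c t S.
  apply: null_hsum => // e e0; have [k hk] := eesmall e e0.
  have [T /(hsum_null ha) /(_ e e0) [B hB] _] := hd k t ht.
  exists B => i iB; rewrite -[c i](subrK (d k i)) mulrDl; apply: na_ltD => //; last exact: hB.
  exact: le_lt_trans hk.
suff <- : S = f (z + t) by [].
apply: (na_eq_small ha) => e e0; have [k hk] := eesmall e e0.
have [T hT T1] := hd k t ht.
have h : aC (S - T) <= ee k.
  apply: (hsum_le ha (ltW (ee0 k)) _ (evB ha hS hT)) => i.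
  by rewrite fpsBE cdt.
have := na_ltB ha (le_lt_trans h hk) (lt_trans T1 hk).
by rewrite opprB addrA addrNK.
Qed.

Lemma rigid_lexp f z : rigid_analytic f -> Omega z -> lexp f z (fun i => hd f i z).
Proof.
move=> hf /Omega_ex [n hz]; have [c hc'] := rigid_on_disc (hf n) hz.
have h : lexp f z c.
  by exists (aC (tdisc n)); [rewrite na_gt0 // tdisc_neq0|move=> t /ltW; apply: hc'].
by rewrite (_ : (fun i => _) = c) //; apply/funext => i; apply: hdE.
Qed.

Lemma hd_disc n f z : rigid_on n f -> Omega_aff n z ->
  forall t, aC t <= aC (tdisc n) -> ev aC (fun i => hd f i z) t (f (z + t)).
Proof.
move=> hf hz; have [c hc'] := rigid_on_disc hf hz.
have h : lexp f z c.
  by exists (aC (tdisc n)); [rewrite na_gt0 // tdisc_neq0|move=> t /ltW; apply: hc'].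
by rewrite (_ : (fun i => _) = c) //; apply/funext => i; apply: hdE.
Qed.

(** The coefficient is a uniform limit of weighted averages of translates of [f], each of which is
    again a uniform limit of rational functions on the affinoid. *)
Lemma rigid_on_hd n f j : rigid_on n f -> rigid_on n (hd f j).
Proof.
move=> hf; apply: rigid_on_lim => e e0.
have [M M0 hM] := rigid_on_bounded hf.
have bound z : Omega_aff n z -> forall i, aC (hd f i z) * aC (tdisc n) ^+ i <= M.
  move=> hz; apply: (cauchy_estimate (ltW M0)) => t ht; exists (f (z + t)).
    exact: (hd_disc hf hz ht).
  by apply: hM; apply: Omega_aff_shift hz _; apply: le_lt_trans ht (tdisc_lt _).
(* On a radius q times smaller than that of the Cauchy bound [M], the term of index i is at most M
   q^-i, uniformly in [z]. *)
set t0 := tdisc n.+1.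
have t0d : aC t0 = aC (tdisc n) * qR^-1 by rewrite /t0 !aC_tdisc [in LHS]exprSr invfM mulrC.
have t00 : 0 < aC t0 by rewrite na_gt0 // tdisc_neq0.
have t0le : aC t0 <= aC (tdisc n).
  by rewrite t0d ler_piMr ?na_ge0 // invf_le1.
have [N0 hN0] : exists N0, forall i, (N0 <= i)%N -> M * qR^-1 ^+ i < e * aC t0 ^+ j.
  have /rnull_natP : rnull (fun i => M * qR^-1 ^+ i).
    by apply: rnull_scale; [exact: ltW|apply: rnull_geom; rewrite invr_ge0 ltW //= invf_lt1].
  by apply; rewrite mulr_gt0 ?exprn_gt0.
have [N [u [v [u1 v1 avg]]]] := root_average t0 j N0.
have atv t : aC (t0 * v t) = aC t0 by rewrite naM // v1 mulr1.
exists (fun z => t0 ^- j * \sum_t u t * f (1 * z + t0 * v t)).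
  apply: rigid_onM; first exact: rigid_on_const.
  apply: rigid_on_sum => t _; apply: rigid_onM; first exact: rigid_on_const.
  apply: (@rigid_on_comp n n) => // z hz; rewrite mul1r; apply: Omega_aff_shift hz _.
  by rewrite atv; apply: tdisc_lt.
move=> z hz; set T := \sum_t _.
rewrite -(ltr_pM2r (exprn_gt0 j t00)) -naX // -naM // mulrBl mulrAC mulVf; last first.
  by rewrite expf_neq0 // tdisc_neq0.
rewrite mul1r naX // naB //.
pose B := M * qR^-1 ^+ N0.
have hB := hN0 N0 (leqnn _); apply: le_lt_trans hB.
apply: (avg (fun i => hd f i z)).
- by rewrite mulr_ge0 ?exprn_ge0 ?invr_ge0 ?(ltW M0) ?(ltW q0).
- move=> t; rewrite mul1r; have ht : aC (t0 * v t) <= aC (tdisc n) by rewrite atv.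
  exact: (hd_disc hf hz ht).
move=> i N0i; rewrite t0d exprMn mulrA.
apply: ler_pM; rewrite ?mulr_ge0 ?exprn_ge0 ?(na_ge0 ha) ?invr_ge0 ?(ltW q0) ?bound //.
by apply: ler_wiXn2l => //; rewrite ?invr_ge0 ?(ltW q0) // invf_le1.
Qed.
End Rigid.

(** * The Carlitz exponential *)

Section Exponential.
Variables (R : realType) (F : finFieldType) (C : Cinfty R F) (p : nat).
Hypothesis hp : p \in [pchar F].
Notation A := {poly F}.
Notation K := {fraction {poly F}}.
Notation aC := (@absC R F C).
Notation iC := (@KtoC R F C).
Notation iA := (@iA R F C).
Notation q := #|F|.
Notation qR := (#|F|%:R : R).
Notation e := (@carlitz_exp R F C).
Add Ring Cring2 : (rT_ring C).

Let ha := absC_nonarch C.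
Let hc := @absC_complete R F C.
Let q1 : 1 < qR := qR_gt1 R F.
Let q0 : 0 < qR := qR_gt0 R F.
Let qge1 : 1 <= qR := qR_ge1 R F.
Let qn1 : (1 < q)%N := card_finField_gt1 F.
Hint Resolve q1 q0 qge1 qn1 : core.

Lemma aC_expq_sub i : (0 < i)%N -> aC (iA (carlitz_bracket F i)) = qR ^+ (q ^ i).
Proof.
move=> i0; rewrite /carlitz_bracket rmorphB rmorphXn na_addl ?naX ?naN // ?aC_theta //.
by rewrite -[ltLHS]expr1 ltr_eXn2l // -[1%N](expn0 q) ltn_exp2l.
Qed.

Lemma aC_D i : aC (iA (carlitz_D F i)) = qR ^+ (i * q ^ i).
Proof.
elim: i => [|i IH]; first by rewrite rmorph1 na1 // mul0n.
rewrite /= rmorphM rmorphXn naM // naX // IH aC_expq_sub // -exprM -exprD.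
by congr (_ ^+ _); rewrite -mulnA -expnSr mulSn.
Qed.

Lemma D_neq0 i : iA (carlitz_D F i) != 0.
Proof. by rewrite -(na_gt0 ha) aC_D exprn_gt0. Qed.

Definition eterm (x : C) (i : nat) : C := x ^+ (q ^ i) / iA (carlitz_D F i).

Lemma aC_eterm x i : aC (eterm x i) = (aC x / qR ^+ i) ^+ (q ^ i).
Proof. by rewrite /eterm naM // naX // naV // aC_D expr_div_n -exprM. Qed.

Lemma eterm_null x : null aC (eterm x).
Proof.
have [n hn] := q_archi F (2 * aC x).
apply/rnull_natP => d d0.
have h2a : (0 : R) <= 2^-1 by rewrite invr_ge0 ler0n.
have h2b : (2^-1 : R) < 1 by lra.
have /rnull_natP /(_ d d0) [N hN] : rnull (fun n => (2^-1 : R) ^+ n).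
  by apply: rnull_geom; rewrite h2a h2b.
exists (maxn n N) => i; rewrite geq_max => /andP[ni Ni].
apply: le_lt_trans (hN i Ni); rewrite aC_eterm.
have qi : 0 < qR ^+ i by rewrite exprn_gt0.
have le2 : aC x / qR ^+ i <= 2^-1.
  rewrite ler_pdivrMr // -ler_pdivrMl ?invr_gt0 // invrK.
  by apply: le_trans hn _; rewrite ler_weXn2l.
apply: (@le_trans _ _ (2^-1 ^+ (q ^ i))).
  by apply: lerXn2r; rewrite ?nnegrE ?divr_ge0 ?(na_ge0 ha) ?(ltW qi).
apply: ler_wiXn2l; [lra|lra|].
by apply: ltnW; apply: ltn_expl.
Qed.

Lemma e_hsum x : hsum aC (eterm x) (e x).
Proof.
have [S hS] := null_hsum ha hc (eterm_null x).
have cS := hsum_converges ha hS.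
suff -> : e x = S by [].
rewrite /carlitz_exp /abs_lim; case: xgetP => [T _ hT|/(_ S)/(_ cS) //].
exact: (converges_uniq ha hT cS).
Qed.

Lemma hsum_frob (I : eqType) (x : I -> C) S :
  hsum aC x S -> hsum aC (fun i => x i ^+ q) (S ^+ q).
Proof.
have frobB (y z : C) : (y - z) ^+ q = y ^+ q - z ^+ q.
  have := frob_C hp (y - z) z 1; rewrite expn1 addrNK => ->; by rewrite addrK.
move=> h d d0; have d1 : 0 < Num.min d 1 by rewrite lt_min d0 ltr01.
have [B hB] := h _ d1; exists B => B' u s.
have -> : \sum_(i <- B') x i ^+ q = (\sum_(i <- B') x i) ^+ q.
  elim: B' {u s hB} => [|i B' IH].
    by rewrite !big_nil expr0n; case: (q) (qn1).
  by rewrite !big_cons IH; have := frob_C hp (x i) (\sum_(j <- B') x j) 1; rewrite expn1 => ->.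
rewrite -frobB naX //; have := hB _ u s; set y := aC _.
rewrite lt_min => /andP[yd y1]; apply: le_lt_trans yd.
have y0 : 0 <= y by apply: na_ge0.
by rewrite -[leRHS]expr1; apply: ler_wiXn2l => //; [exact: ltW|exact: ltnW].
Qed.

Lemma eD x y : e (x + y) = e x + e y.
Proof.
apply: (hsum_uniq ha (e_hsum _)); apply: eq_hsum (hsumD ha (e_hsum x) (e_hsum y)) => i.
by rewrite /eterm (frob_C hp) mulrDl.
Qed.

Lemma e0 : e 0 = 0.
Proof. by apply: (addIr (e 0)); rewrite -eD !add0r. Qed.

Lemma eN x : e (- x) = - e x.
Proof. by apply: (addIr (e x)); rewrite -eD !addNr e0. Qed.

Lemma eB x y : e (x - y) = e x - e y. Proof. by rewrite eD eN. Qed.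

Lemma e_sum (I : Type) (s : seq I) (P : pred I) f :
  e (\sum_(i <- s | P i) f i) = \sum_(i <- s | P i) e (f i).
Proof. by elim/big_rec2: _ => [|i x y _ <-]; rewrite ?e0 ?eD. Qed.

Lemma expf_cardX (k : F) i : k ^+ (q ^ i) = k.
Proof. by elim: i => [|i IH]; rewrite ?expr1 // expnS exprM expf_card IH. Qed.

Lemma e_const (k : F) x : e (iA k%:P * x) = iA k%:P * e x.
Proof.
apply: (hsum_uniq ha (e_hsum _)); apply: eq_hsum (hsumZ ha _ (e_hsum x)) => i.
by rewrite /eterm exprMn -rmorphXn -polyC_exp expf_cardX mulrA.
Qed.

(** Termwise: theta^(q^i) = theta + [i], and the factor [i] cancels against D_i = [i] D_(i-1)^q,
    leaving the q-th power of the preceding term. *)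
Lemma e_theta x : e (iA 'X * x) = iA 'X * e x + e x ^+ q.
Proof.
apply: (hsum_uniq ha (e_hsum _)).
have h1 := hsumZ ha (iA 'X) (e_hsum x).
have h2 : hsum aC (fun i => if i is j.+1 then eterm x j ^+ q else 0) (e x ^+ q).
  by rewrite -[e x ^+ q]add0r; apply: (hsum_recl ha (x := fun i => if i is j.+1 then eterm x j ^+ q else 0)); apply: hsum_frob; apply: e_hsum.
apply: eq_hsum (hsumD ha h1 h2) => -[|i] /=.
  by rewrite /eterm expn0 !expr1 rmorph1 addr0 !divr1.
rewrite /eterm /= expr_div_n -exprM -expnSr exprMn rmorphM rmorphXn.
have D0 := D_neq0 i; set D := iA _ in D0 *.
have b0 : iA (carlitz_bracket F i.+1) != 0 by rewrite -(na_gt0 ha) aC_expq_sub // exprn_gt0.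
have Dq : D ^+ q != 0 by rewrite expf_neq0.
have {1}-> : iA 'X ^+ (q ^ i.+1) = iA 'X + iA (carlitz_bracket F i.+1).
  by rewrite /carlitz_bracket rmorphB rmorphXn addrC addrNK.
rewrite mulrDl mulrDl mulrA; congr (_ + _).
by rewrite invfM mulrACA mulfV // mul1r.
Qed.

(** A radius above q but below q^(q/(q-1)), up to which [e] is an isometry; [kap] < 1 expresses the
    upper bound. Exceeding q is what makes the q-th power dominate in [e_theta_grow], even for q =
    2. *)
Definition rr : R := qR + 1.
Definition kap : R := rr ^+ q.-1 / qR ^+ q.
Lemma rr_gt0 : 0 < rr. Proof. by rewrite /rr addr_gt0. Qed.
Lemma rr_gtq : qR < rr. Proof. by rewrite /rr ltrDl. Qed.
Lemma rr_gt1 : 1 < rr. Proof. exact: lt_trans rr_gtq. Qed.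
Lemma kap_ge0 : 0 <= kap.
Proof. by rewrite divr_ge0 ?exprn_ge0 ?(ltW rr_gt0) ?(ltW q0). Qed.

Lemma bernoulli (x : R) n : -1 <= x -> 1 + n%:R * x <= (1 + x) ^+ n.
Proof.
move=> x1; elim: n => [|n IH]; first by rewrite mul0r addr0 expr0.
rewrite exprS; apply: (@le_trans _ _ ((1 + x) * (1 + n%:R * x))); last first.
  have x2 : 0 <= 1 + x by lra.
  exact: ler_wpM2l x2 _ _ IH.
rewrite -natr1; have n0 : 0 <= n%:R :> R by []; nra.
Qed.

(** Bernoulli's inequality for (1 - 1/(q+1))^(q-1) gives 2 (q+1)^(q-1) <= q^(q-1) (q+1), and (q+1)/2
    < q. *)
Lemma kap_lt1 : kap < 1.
Proof.
have rr0 := rr_gt0; have qq : 0 < qR ^+ q by rewrite exprn_gt0.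
rewrite /kap ltr_pdivrMr // mul1r.
have rq : 0 < rr ^+ q.-1 by rewrite exprn_gt0.
have s0 : 0 < rr^-1 by rewrite invr_gt0.
have sE : rr * rr^-1 = 1 by rewrite divff ?lt0r_neq0.
have h : 2 * rr^-1 <= (qR * rr^-1) ^+ q.-1.
  have -> : qR * rr^-1 = 1 + (- rr^-1) by rewrite -{2}sE -mulN1r -mulrDl /rr addrK.
  apply: le_trans (bernoulli _ _); last by rewrite lerN2 invf_le1 // ltW // rr_gt1.
  have -> : q.-1%:R = rr - 2 :> R.
    by rewrite -subn1 natrB ?(ltnW qn1) // /rr; lra.
  nra.
rewrite exprMn exprVn in h.
have : rr ^+ q.-1 * 2 <= qR ^+ q.-1 * rr.
  have := ler_wpM2r (mulr_ge0 (ltW rq) (ltW rr0)) h.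
  by rewrite [leLHS]mulrACA mulVf ?lt0r_neq0 // mulr1 [leRHS]mulrA divfK ?lt0r_neq0 // [leLHS]mulrC.
have qp : 0 < qR ^+ q.-1 by rewrite exprn_gt0.
have -> : qR ^+ q = qR ^+ q.-1 * qR by rewrite -exprSr prednK // ltnW.
move: rq; rewrite /rr; set X := _ ^+ _; set Y := _ ^+ q.-1 in qp * => X0 XY.
have := mulr_gt0 qp (_ : 0 < qR - 1); rewrite subr_gt0 => /(_ q1); lra.
Qed.

Lemma rr_bound i : (0 < i)%N -> rr ^+ (q ^ i).-1 <= kap * qR ^+ (i * q ^ i).
Proof.
have k0 := kap_ge0; have k1 := ltW kap_lt1; have r0 := ltW rr_gt0.
case: i => // i _; elim: i => [|i IH].
  by rewrite expn1 mul1n /kap divfK // expf_neq0 // lt0r_neq0.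
have -> : (q ^ i.+2).-1 = (q.-1 * q ^ i.+1 + (q ^ i.+1).-1)%N.
  have : (0 < q ^ i.+1)%N by rewrite expn_gt0 ltnW.
  by rewrite [(q ^ i.+2)%N]expnS; move: (q ^ i.+1)%N qn1 => m; nia.
rewrite exprD exprM.
have -> : rr ^+ q.-1 = kap * qR ^+ q by rewrite /kap divfK // expf_neq0 // lt0r_neq0.
apply: (@le_trans _ _ (qR ^+ (q * q ^ i.+1) * (kap * qR ^+ (i.+1 * q ^ i.+1)))).
  apply: ler_pM; rewrite ?exprn_ge0 ?mulr_ge0 ?exprn_ge0 ?(ltW q0) //.
  rewrite exprMn -exprM ler_piMl ?exprn_ge0 ?(ltW q0) //.
  by rewrite exprn_ile1.
rewrite mulrCA -exprD ler_wpM2l // ler_weXn2l // [(i.+2 * _)%N]mulSn leq_add ?leq_mul //; by rewrite ?leq_exp2l // expnS.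
Qed.

Lemma eterm_small x i : aC x <= rr -> aC (eterm x i.+1) <= kap * aC x.
Proof.
move=> xr; rewrite aC_eterm expr_div_n -exprM ler_pdivrMr ?exprn_gt0 //.
have k0 := kap_ge0; have r0 := ltW rr_gt0; have x0 := na_ge0 ha x.
have -> : (q ^ i.+1)%N = (q ^ i.+1).-1.+1 by rewrite prednK // expn_gt0 ltnW.
rewrite [_ ^+ _.+1]exprSr [in X in _ <= X]prednK ?expn_gt0 1?ltnW // mulrAC.
apply: ler_wpM2r => //; apply: (@le_trans _ _ (rr ^+ (q ^ i.+1).-1)).
  by apply: lerXn2r; rewrite ?nnegrE.
exact: rr_bound.
Qed.

Lemma e_sub_small x : aC x <= rr -> aC (e x - x) <= kap * aC x.
Proof.
move=> xr.
have B0 : 0 <= kap * aC x by rewrite mulr_ge0 ?kap_ge0 ?(na_ge0 ha).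
have [S hS] := null_hsum ha hc (rnull_comp succn_inj (eterm_null x)).
have := hsum_recl ha hS; rewrite /eterm expn0 expr1 rmorph1 divr1 => h.
rewrite (hsum_uniq ha (e_hsum x) h) addrC addKr.
by apply: (hsum_le ha B0 _ hS) => i; apply: eterm_small.
Qed.

Lemma aC_e_small x : aC x <= rr -> aC (e x) = aC x.
Proof.
move=> xr; have [->|x0] := eqVneq x 0; first by rewrite e0.
rewrite -[e x](subrK x) na_addr //; apply: le_lt_trans (e_sub_small xr) _.
by rewrite -[ltRHS]mul1r ltr_pM2r ?kap_lt1 // na_gt0.
Qed.

(** Successive correction: [d n] is the defect left after n steps, it shrinks by the factor [kap]
    each time, and [e] maps the sum of the first n defects to y - d_n. *)
Lemma e_lift y : aC y <= rr -> exists2 x, aC x = aC y & e x = y.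
Proof.
move=> yr; pose d n := iter n (fun t => t - e t) y.
have dS n : d n.+1 = d n - e (d n) by [].
have k0 := kap_ge0; have k1 := kap_lt1.
have dle n : aC (d n) <= kap ^+ n * aC y.
  elim: n => [|n IH]; first by rewrite expr0 mul1r.
  have dr : aC (d n) <= rr.
    apply: le_trans IH (le_trans _ yr); rewrite ler_piMl ?(na_ge0 ha) //.
    by rewrite exprn_ile1 // ltW.
  rewrite dS naB //; apply: le_trans (e_sub_small dr) _.
  by rewrite exprS -mulrA ler_wpM2l.
have nd : null aC d.
  apply: (@rnull_le _ _ _ (fun n => aC y * kap ^+ n)).
    by move=> n; rewrite mulrC.
  by apply: rnull_scale; [apply: na_ge0|apply: rnull_geom; rewrite k0].
have [x hx] := null_hsum ha hc nd; exists x.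
  have B0 : 0 <= kap * aC y by rewrite mulr_ge0 ?(na_ge0 ha).
  have [S hS] := null_hsum ha hc (rnull_comp succn_inj nd).
  have small : aC (x - y) <= kap * aC y.
    rewrite (hsum_uniq ha hx (hsum_recl ha hS)) addrC addKr.
    apply: (hsum_le ha B0 _ hS) => i; apply: le_trans (dle _) _.
    rewrite exprS -mulrA ler_wpM2l // ler_piMl ?(na_ge0 ha) //.
    by rewrite exprn_ile1 // ltW.
  have [y0|y0] := eqVneq y 0.
    move: small; rewrite y0 subr0 na0 // mulr0 => h; apply/le_anti.
    by rewrite h (na_ge0 ha).
  rewrite -[x](subrK y) na_addr //; apply: le_lt_trans small _.
  by rewrite -[ltRHS]mul1r ltr_pM2r // na_gt0.
apply: (na_eq_small ha) => t t0.
have t1 : 0 < Num.min t rr by rewrite lt_min t0 rr_gt0.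
have /(convergesP ha) /(_ _ t1) [N hN] := hsum_converges ha hx.
have /rnull_natP /(_ t t0) [M hM] := nd.
set n := maxn N M; pose sn := \sum_(i < n) d i.
have es : e sn = y - d n.
  rewrite /sn; elim: (n) => [|m IH]; first by rewrite big_ord0 e0 subrr.
  rewrite dS big_ord_recr /= eD IH; rring C.
have -> : e x - y = e (x - sn) - d n by rewrite eB es; rring C.
have := hN n (leq_maxl _ _); rewrite naB // lt_min => /andP[h1 h2].
apply: na_ltB => //; last by apply: hM; rewrite leq_maxr.
by rewrite aC_e_small // ltW.
Qed.

(** Once |e(x)| is at least [rr], the q-th power dominates in [e_theta] and multiplies the absolute
    value by more than q. *)
Lemma e_theta_grow n x : rr <= aC (e x) -> rr * qR ^+ n <= aC (e (iA 'X ^+ n * x)).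
Proof.
move=> h; elim: n => [|n IH]; first by rewrite expr0 mulr1 mul1r.
rewrite [iA 'X ^+ _]exprS -mulrA e_theta; set y := e _ in IH *.
have yr : rr <= aC y.
  by apply: le_trans IH; rewrite ler_peMr ?(ltW rr_gt0) // exprn_ege1.
have y0 : 0 < aC y by apply: lt_le_trans yr; apply: rr_gt0.
have gq : qR < aC y ^+ q.-1.
  apply: (@lt_le_trans _ _ rr); first by rewrite /rr; lra.
  have y1 : 1 <= aC y by apply: le_trans yr; apply/ltW/rr_gt1.
  apply: (le_trans yr); rewrite -[leLHS]expr1 ler_weXn2l //.
  by rewrite -ltnS prednK // ltnW.
have yq : aC (y ^+ q) = aC y ^+ q.-1 * aC y.
  by rewrite naX // -exprSr prednK // ltnW.
have lt : aC (iA 'X * y) < aC (y ^+ q).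
  by rewrite yq naM // aC_theta // ltr_pM2r.
rewrite na_addr // yq [qR ^+ n.+1]exprS mulrCA; apply: ler_pM => //; last exact: ltW.
by rewrite mulr_ge0 ?exprn_ge0 ?(ltW q0) ?(ltW rr_gt0).
Qed.

Variable (w : C).
Hypothesis hw : carlitz_period w.

Lemma e_iAw a : e (iA a * w) = 0.
Proof. by apply/hw; exists a. Qed.

(** With [w] = 0 the only zero of [e] would be 0. But a root l of l^(q-1) = -theta is small enough
    to be lifted to some x, and then e(theta x) = theta l + l^q = 0 with x nonzero. *)
Lemma w_neq0 : w != 0.
Proof.
apply/eqP => w0.
have qp : (0 < q.-1)%N by rewrite -ltnS prednK // ltnW.
have [l hl] := @solve_monicpoly _ q.-1 (fun i => if i == 0%N then - iA 'X else 0) qp.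
have {hl} : l ^+ q.-1 = - iA 'X.
  rewrite hl; case: (q.-1) qp => // m _; rewrite big_ord_recl big1 /= ?expr0 ?mulr1 ?addr0 //.
  by move=> i _; rewrite mul0r.
move=> hl; have al : aC l ^+ q.-1 = qR by rewrite -naX // hl naN // aC_theta.
have l0 : l != 0.
  by rewrite -(na_gt0 ha) lt_neqAle (na_ge0 ha) andbT eq_sym; apply/eqP => l0;
    have := q0; rewrite -al l0 expr0n; case: (q.-1) qp => //=; rewrite ltxx.
have lr : aC l <= rr.
  rewrite leNgt; apply/negP => lt; have : qR < aC l ^+ q.-1.
    apply: (@lt_le_trans _ _ (aC l)); first by apply: lt_trans lt; rewrite /rr; lra.
    by rewrite -[leLHS]expr1 ler_weXn2l // ltW // (lt_trans rr_gt1).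
  by rewrite al ltxx.
have [x ax ex] := e_lift lr.
have : e (iA 'X * x) = 0.
  rewrite e_theta ex -[(q in _ ^+ q)]prednK 1?ltnW // exprSr hl mulNr subrr //.
move=> /hw [a]; rewrite w0 mulr0 => /eqP; rewrite mulf_eq0 iA_eq0 polyX_eq0 /=.
by rewrite -(na_eq0 ha) ax na_eq0 // (negbTE l0).
Qed.

Lemma e_near x : aC (e x) <= rr -> exists a, aC (x - iA a * w) = aC (e x).
Proof.
move=> /e_lift [y ay ey]; have : e (x - y) = 0 by rewrite eB ey subrr.
by move=> /hw [a xy]; exists a; rewrite -[iA a * w]xy subKr.
Qed.

Lemma w_ge : rr <= aC w.
Proof.
rewrite leNgt; apply/negP => /ltW /aC_e_small.
have -> : e w = 0 by rewrite -[w]mul1r -(rmorph1 iA) e_iAw.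
by rewrite na0 // => /esym/eqP; rewrite na_eq0 // (negbTE w_neq0).
Qed.

Lemma far_scale (k : K) b z : k != 0 -> far b z -> far (aC (iC k) * b) (iC k * z).
Proof.
move=> k0 h l; have -> : iC k * z - iC l = iC k * (z - iC (l / k)).
  by rewrite rmorphM fmorphV mulrBr [iC k * (_ * _)]mulrCA divff ?fmorph_eq0 // mulr1.
by rewrite naM // ler_wpM2l // (na_ge0 ha).
Qed.

Lemma far_shift (k : K) b z : far b z -> far b (z + iC k).
Proof. by move=> h l; rewrite -addrA -rmorphB -opprB rmorphN; apply: h. Qed.

Lemma e_far1 z : far 1 z -> rr <= aC (e (w * z)).
Proof.
move=> h; rewrite leNgt; apply/negP => lt; have [a] := e_near (ltW lt).
have := h (inK a); rewrite -iAE => h1 h2.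
move: lt; rewrite -h2 mulrC -mulrBl naM // ltNge => /negP; apply.
apply: le_trans w_ge _; rewrite -[leLHS]mul1r; apply: ler_wpM2r => //; exact: na_ge0.
Qed.

Lemma e_far (B : R) : exists2 b, 0 < b & forall z, far b z -> B <= aC (e (w * z)).
Proof.
have [n hn] := q_archi F B; exists (qR ^+ n); first by rewrite exprn_gt0.
move=> z hz; pose k : K := inK 'X ^- n.
have k0 : k != 0 by rewrite invr_neq0 // expf_neq0 // tofrac_eq0 polyX_eq0.
have kE : iC k = iA 'X ^- n by rewrite /k fmorphV rmorphXn.
have := far_scale k0 hz; rewrite kE (naV ha) (naX ha) aC_theta mulVf ?lt0r_neq0 ?exprn_gt0 //.
move=> /e_far1 /(e_theta_grow n); rewrite mulrCA mulVKf; last first.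
  by rewrite expf_neq0 // iA_eq0 polyX_eq0.
apply: le_trans; apply: le_trans hn _; rewrite ler_peMl ?exprn_ge0 ?(ltW q0) //.
exact/ltW/rr_gt1.
Qed.

Lemma e_wz_neq0 z : Omega z -> e (w * z) != 0.
Proof.
move=> /OmegaP [b b0 hz]; apply/eqP => /hw [a]; rewrite mulrC => /(mulIf w_neq0) za.
by have := hz (inK a); rewrite -iAE za subrr na0 // leNgt b0.
Qed.

Notation u := (@u_param R F C w).

Lemma far_u (s : R) : 0 < s ->
  exists2 b, 0 < b & forall z, far b z -> aC (u z) <= s.
Proof.
move=> s0; have [b b0 hb] := e_far s^-1; exists b => // z /hb h.
rewrite /u_param naV // invf_ple ?posrE //.
by apply: lt_le_trans h; rewrite invr_gt0.
Qed.

Lemma u_neq0 z : Omega z -> u z != 0.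
Proof. by move=> hz; rewrite invr_eq0 e_wz_neq0. Qed.

Lemma far_Omega b z : 0 < b -> far b z -> @Omega R F C z.
Proof. by move=> b0 h; apply/OmegaP; exists b. Qed.

(** A square root of theta^(2n+1) has an absolute value that no element of K has, so its distance to
    any element of K is at least its own absolute value. *)
Lemma far_ex b : exists z : C, far b z.
Proof.
have [n hn] := q_archi F b.
have [z hz] := @solve_monicpoly _ 2 (fun i => if i == 0%N then iA 'X ^+ (2 * n).+1 else 0) isT.
have {hz} : z ^+ 2 = iA 'X ^+ (2 * n).+1.
  by rewrite hz big_ord_recl big_ord1 /= expr0 mulr1 mul0r addr0.
move=> hz; have az : aC z ^+ 2 = qR ^+ (2 * n).+1 by rewrite -naX // hz naX // aC_theta.
exists z => k; have [a [c [c0 ->]]] := fracP k.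
have zb : b <= aC z.
  apply: le_trans hn _; rewrite -(ler_pXn2r (n := 2)) ?nnegrE ?exprn_ge0 ?(na_ge0 ha) ?(ltW q0) //.
  by rewrite az -exprM mulnC ler_weXn2l.
apply: le_trans zb _.
have ne : aC z != aC (iC (inK a / inK c)).
  apply/eqP => E; have := az; rewrite E rmorphM fmorphV -!iAE naM // naV //.
  have [->|a0] := eqVneq a 0.
    by rewrite rmorph0 na0 // mul0r expr0n /= => /esym/eqP; rewrite expf_eq0 (gt_eqF q0) andbF.
  rewrite !aC_iA // expr_div_n => /(canRL (divfK _)); rewrite expf_neq0 ?expf_neq0 ?lt0r_neq0 //.
  move=> /(_ isT); rewrite -!exprM -exprD => /(ieexprIn q0 (negbT (gt_eqF q1))); lia.
have [lt|gt|eq] := ltgtP (aC z) (aC (iC (inK a / inK c))).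
- by rewrite na_addr ?naN // ltW.
- by rewrite na_addl ?naN.
- by move: ne; rewrite eq eqxx.
Qed.
End Exponential.

(** * Expansions in the parameter u and hyperderivatives *)

Section CarlitzSeries.
Variable F : finFieldType.
Notation q := #|F|.
Notation cs := (carlitz_series F : fps {fraction {poly F}}).

Lemma carlitz_series_pow i : cs (q ^ i)%N = (inK (carlitz_D F i))^-1.
Proof.
have qn1 := card_finField_gt1 F.
rewrite /carlitz_series (bigD1 (inord i)) /=; last first.
  by rewrite inordK // ltnS ltnW // ltn_expl.
rewrite inordK ?ltnS ?(ltnW (ltn_expl _ _)) // big1 ?addr0 // => j /andP[/eqP E ji].
case/eqP: ji; apply/val_inj; rewrite /= inordK ?ltnS ?(ltnW (ltn_expl _ _)) //.
by apply/eqP; rewrite -(eqn_exp2l _ _ qn1) -E.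
Qed.

Lemma carlitz_series_npow n : (forall i, n != (q ^ i)%N) -> cs n = 0.
Proof. by move=> h; rewrite /carlitz_series big1 // => i /eqP E; have := h i; rewrite -E eqxx. Qed.

Lemma carlitz_seriesP n :
  (exists2 i, n = (q ^ i)%N & cs n = (inK (carlitz_D F i))^-1) \/ cs n = 0.
Proof.
case: (pselect (exists i, n = (q ^ i)%N)) => [[i ->]|h]; [left|right].
  by exists i => //; apply: carlitz_series_pow.
by apply: carlitz_series_npow => i; apply/eqP => E; apply: h; exists i.
Qed.

Lemma goss_coefE r j : goss_coef F r j = (cs ^+ j) r.
Proof.
rewrite /goss_coef /goss coef_sum.
have E (i : 'I_r.+1) : (fps_exp cs i r *: 'X^(i.+1))`_j.+1 =
    if val i == j then (cs ^+ j) r else 0.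
  rewrite coefZ coefXn eqSS eq_sym; case: eqP => [<-|]; rewrite ?mulr1 ?mulr0 //.
  by rewrite fps_expE.
rewrite (eq_bigr _ (fun i _ => E i)) -big_mkcond /=.
have [jr|rj] := ltnP j r.+1.
  by rewrite (big_pred1 (Ordinal jr)).
by rewrite big1 ?fps_exp_lt' ?carlitz_series0.
Qed.
End CarlitzSeries.

(** [Theta] over any field receiving K, to be used over K itself, over the completion at v and over
    C_infty. *)
Definition thetaG (F : finFieldType) (L : fieldType) (h : {fraction {poly F}} -> L)
    (r : nat) (c : nat -> L) : nat -> L :=
  fun N => \sum_(j < r.+1 | (j <= N)%N)
    c (N - j)%N * ('C(N.-1, j)%:R * h (goss_coef F r j)).

Section UExpansion.
Variables (R : realType) (F : finFieldType) (C : Cinfty R F) (p : nat).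
Hypothesis hp : p \in [pchar F].
Notation A := {poly F}.
Notation K := {fraction {poly F}}.
Notation aC := (@absC R F C).
Notation iC := (@KtoC R F C).
Notation iA := (@iA R F C).
Notation q := #|F|.
Notation qR := (#|F|%:R : R).
Notation e := (@carlitz_exp R F C).
Add Ring Cring3 : (rT_ring C).
Notation cs := (carlitz_series F : fps K).
Notation csC := (fps_map iC cs).

Let ha := absC_nonarch C.
Let hc := @absC_complete R F C.
Let q1 : 1 < qR := qR_gt1 R F.
Let q0 : 0 < qR := qR_gt0 R F.
Let qge1 : 1 <= qR := qR_ge1 R F.
Let qn1 : (1 < q)%N := card_finField_gt1 F.
Hint Resolve q1 q0 qge1 qn1 : core.

Lemma ev_cs x : ev aC csC x (e x).
Proof.
apply/(@hsum_reindex _ _ _ _ _ (fun i => (q ^ i)%N)).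
- by move=> i j /eqP; rewrite eqn_exp2l // => /eqP.
- move=> n; case: (carlitz_seriesP F n) => [[i -> _]|E]; first by exists i.
  by rewrite fps_mapE E rmorph0 mul0r eqxx.
apply: eq_hsum (e_hsum x) => i /=.
by rewrite fps_mapE carlitz_series_pow fmorphV mulrC.
Qed.

Lemma aC_cs_le n : aC (csC n) <= 1.
Proof.
rewrite fps_mapE; case: (carlitz_seriesP F n) => [[i _ ->]|->]; last by rewrite rmorph0 na0.
by rewrite fmorphV naV // -iAE aC_D invf_le1 ?exprn_gt0 // exprn_ege1.
Qed.

Definition cbound (c : fps C) (t B : R) := forall n, aC (c n) * t ^+ n <= B.

Lemma cboundM c d t B D : 0 <= t -> 0 <= B -> 0 <= D ->
  cbound c t B -> cbound d t D -> cbound (c * d) t (B * D).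
Proof.
move=> t0 B0 D0 hcb hd n; rewrite fpsME.
have [->|tn0] := eqVneq (t ^+ n) 0; first by rewrite mulr0 mulr_ge0.
have tn : 0 < t ^+ n by rewrite lt_neqAle eq_sym tn0 exprn_ge0.
rewrite -ler_pdivlMr //; apply: na_sum_le => //; first by rewrite divr_ge0 ?mulr_ge0 // ltW.
move=> i _ _; rewrite ler_pdivlMr // naM //.
have -> : t ^+ n = t ^+ i * t ^+ (n - i) by rewrite -exprD subnKC // -ltnS.
by rewrite mulrACA; apply: ler_pM; rewrite ?mulr_ge0 ?exprn_ge0 ?(na_ge0 ha) //.
Qed.

Lemma cbound1 t : cbound 1 t 1.
Proof. by case=> [|n]; rewrite fps1E ?(na1 ha) ?(na0 ha) ?mul0r // expr0 mulr1. Qed.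

Lemma cboundX c t B j : 0 <= t -> 0 <= B -> cbound c t B -> cbound (c ^+ j) t (B ^+ j).
Proof.
move=> t0 B0 hb; elim: j => [|j IH]; first by rewrite !expr0; apply: cbound1.
by rewrite !exprS; apply: cboundM => //; apply: exprn_ge0.
Qed.

Lemma aC_csX_le j r : aC ((csC ^+ j) r) <= 1.
Proof.
have h : cbound csC 1 1 by move=> n; rewrite expr1n mulr1 aC_cs_le.
by have := cboundX j ler01 ler01 h r; rewrite !expr1n mulr1.
Qed.

(** By induction on n: multiplying by 1 - x lowers n, by Pascal's rule. For n = 0 the truncated
    predecessor gives the series 1, as it should. *)
Lemma negbin (n : nat) (x : C) : aC x < 1 ->
  ev aC (fun j => 'C((n + j).-1, j)%:R : C) x ((1 - x) ^- n).
Proof.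
move=> x1; pose g n : fps C := fun j => 'C((n + j).-1, j)%:R.
have x10 : 1 - x != 0 by rewrite -(na_gt0 ha) na_addl ?naN ?na1.
rewrite -/(g n); elim: n => [|n IH].
  rewrite expr0 invr1; suff -> : g 0%N = 1 by apply: (ev1 ha).
  by apply/funext => -[|j]; rewrite /g fps1E // bin_small.
have [S hS] : exists S, ev aC (g n.+1) x S.
  apply: null_ev => //; apply: (@rnull_le _ _ _ (fun j => aC x ^+ j)).
    by move=> j; rewrite ler_piMl ?exprn_ge0 ?(na_ge0 ha) //; apply: na_nat.
  by apply: rnull_geom; rewrite (na_ge0 ha).
suff <- : S = (1 - x) ^- n.+1 by [].
apply: (mulfI x10); rewrite exprS invfM mulVKf //.
have h := evM ha hc (evB ha (ev1 ha x) (evX ha x)) hS.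
apply: (ev_uniq ha h); suff -> : (1 - fpsX C) * g n.+1 = g n by [].
apply/funext => -[|j]; rewrite mulrBl mul1r fpsBE ?fpsXM0 ?fpsXM /g.
  by rewrite !bin0 subr0.
by rewrite !addnS /= addSn binS natrD addrK.
Qed.

Variable (w : C).
Hypothesis hw : carlitz_period w.
Notation u := (@u_param R F C w).

Lemma u_expansionP f c : u_expansion w f c <->
  exists2 b : R, 0 < b & forall z, far b z -> ev aC (c : fps C) (u z) (f z).
Proof.
split=> -[b b0 h]; exists b => // z hz.
  by have /(Kinfty_farP _ b0) hz' := hz; exact: (converges_hsum ha hc (h z hz')).
by have /(Kinfty_farP _ b0) hz' := hz; exact: (hsum_converges ha (h z hz')).
Qed.

Lemma u_expansion_null f c : u_expansion w f c ->
  exists2 s, 0 < s & rnull (fun n => aC (c n) * s ^+ n).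
Proof.
move=> /u_expansionP [b b0 h]; have [z hz] := far_ex C hp b.
exists (aC (u z)); last exact: (ev_null ha (h z hz)).
by rewrite na_gt0 // (u_neq0 hp hw (far_Omega b0 hz)).
Qed.

(** Put v = u(z) and x = -wt. By additivity of [e], u(z + t) = v / (1 - v e(x)). Expanding its
    powers by [negbin], and then e(x)^j in powers of x, produces in degree r precisely the sum that
    defines Theta^r. The rest is the convergence needed to exchange the sums. *)
Lemma theta_local (c : fps C) z : e (w * z) != 0 ->
  rnull (fun n => aC (c n) * aC (u z) ^+ n) ->
  exists T : fps C, (forall r, ev aC (thetaG iC r c : fps C) (u z) (T r)) /\
  exists2 d : R, 0 < d & forall t, aC t < d ->
    exists2 V, ev aC c (u (z + t)) V & ev aC (fun r => (- w) ^+ r * T r : C) t V.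
Proof.
move=> Ez cn; set v := u z in cn *; pose bet r j := (csC ^+ j) r.
have betE r j : iC (goss_coef F r j) = bet r j.
  by rewrite goss_coefE /bet -rmorphXn.
have bet0 r j : (r < j)%N -> bet r j = 0.
  by move=> rj; apply: fps_exp_lt' => //; rewrite fps_mapE carlitz_series0 rmorph0.
have bet1 r j : aC (bet r j) <= 1 by apply: aC_csX_le.
pose av := aC v; have av0 : 0 <= av by apply: na_ge0.
have v0 : v != 0 by rewrite invr_eq0.
pose bn (n j : nat) : C := 'C((n + j).-1, j)%:R.
pose y r (nj : nat * nat) := c nj.1 * bn nj.1 nj.2 * v ^+ (nj.1 + nj.2) * bet r nj.2.
have yb r nj : aC (y r nj) <= (aC (c nj.1) * av ^+ nj.1) * (if (nj.2 <= r)%N then av ^+ nj.2 else 0).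
  case: nj => n j; rewrite /y /=; case: leqP => [jr|/bet0 ->]; last by rewrite !mulr0 na0.
  have b1 : aC (bn n j * bet r j) <= 1.
    by rewrite naM // mulr_ile1 ?(na_ge0 ha) //; apply: na_nat.
  have -> : c n * bn n j * v ^+ (n + j) * bet r j = (bn n j * bet r j) * (c n * v ^+ (n + j)).
    by rring C.
  rewrite naM // [aC (c n * _)]naM // naX // exprD -[leRHS]mulrA.
  by rewrite ler_piMl // !mulr_ge0 ?exprn_ge0 ?(na_ge0 ha).
have yn r : null aC (y r).
  apply: (null_le (yb r)).
  apply: (rnullM (b := fun n => aC (c n) * av ^+ n)
                 (c := fun j => if (j <= r)%N then av ^+ j else 0)) => //.
  - by move=> i; rewrite mulr_ge0 ?exprn_ge0 ?(na_ge0 ha).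
  - by move=> j; case: ifP; rewrite ?exprn_ge0.
  move=> t t0; exists (iota 0 r.+1) => j; rewrite mem_iota add0n ltnS /=.
  by case: leqP.
have /choice [T hT] : forall r, exists T, hsum aC (y r) T.
  by move=> r; apply: null_hsum.
exists T; split=> [r|].
  pose y' (Nj : nat * nat) := if (Nj.2 <= Nj.1)%N
    then c (Nj.1 - Nj.2)%N * ('C(Nj.1.-1, Nj.2)%:R * bet r Nj.2) * v ^+ Nj.1 else 0.
  have h' : hsum aC y' (T r).
    apply/(@hsum_reindex _ _ _ _ _ (fun nj : nat * nat => ((nj.1 + nj.2)%N, nj.2))).
    - move=> [i j] [i' j'] E; have /= E1 := congr1 snd E; have /= := congr1 fst E.
      by rewrite E1 => /addIn ->.
    - move=> [N j]; rewrite /y' /=; case: leqP => [jN _|]; last by rewrite eqxx.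
      by exists ((N - j)%N, j); rewrite /= subnK.
    apply: eq_hsum (hT r) => -[n j]; rewrite /y' /y /= leq_addl addnK /bn; rring C.
  apply: (hsum_Fubini ha _ h') => N; rewrite /thetaG mulr_suml.
  set s := [seq j <- iota 0 r.+1 | (j <= N)%N].
  rewrite (_ : \sum_(j < r.+1 | (j <= N)%N) _ = \sum_(j <- s) y' (N, j)).
    apply: hsum_fin => //; first by rewrite filter_uniq // iota_uniq.
    move=> j; rewrite mem_filter mem_iota add0n /= ltnS /y' /= negb_and.
    by case: leqP => //= _; rewrite -ltnNge => /bet0 ->; rewrite !mulr0 mul0r.
  rewrite big_filter -[iota 0 r.+1]/(index_iota 0 r.+1) big_mkord.
  by apply: eq_bigr => j jN; rewrite /y' /= jN betE.
(* [sg] satisfies |v| sg < 1 while |x| is at most its square: as j <= r, one factor sg^j makes the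
   sum over j converge and sg^r the sum over r. *)
have [m hm] := q_archi F (av * qR); pose sg : R := qR ^- m.+1.
have sg0 : 0 < sg by rewrite invr_gt0 exprn_gt0.
have sg1 : sg < 1 by rewrite invf_lt1 ?exprn_gt0 // exprn_egt1.
have sgv : av * sg < 1.
  rewrite ltr_pdivrMr ?exprn_gt0 // mul1r exprS.
  have : av <= qR ^+ m by apply: le_trans hm; rewrite ler_peMr.
  move=> h; apply: le_lt_trans h _; rewrite ltr_pMl ?exprn_gt0 //.
have w0 := w_neq0 hp hw; have aw : 0 < aC w by rewrite na_gt0.
exists (sg ^+ 2 / aC w); first by rewrite divr_gt0 ?exprn_gt0.
move=> t; rewrite ltr_pdivlMr // mulrC -naM // => wt.
set x := - (w * t); have ax : aC x <= sg ^+ 2 by rewrite naN // ltW.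
have ex : aC (e x) <= sg ^+ 2.
  rewrite (aC_e_small hp) //; apply: le_trans ax _.
  by apply: le_trans (ltW (rr_gt1 R F)); rewrite exprn_ile1 // ltW.
have vex : aC (v * e x) < 1.
  rewrite naM //; apply: le_lt_trans sgv; rewrite ler_wpM2l //.
  by apply: le_trans ex _; rewrite expr2 ler_piMl // ltW.
have uE : u (z + t) = v / (1 - v * e x).
  rewrite /u_param mulrDr (eD hp) -[w * t]opprK -/x (eN hp) -[RHS]invrK; congr _^-1.
  have vE : v^-1 = e (w * z) by rewrite /v /u_param invrK.
  by rewrite invfM (invrK (1 - _)) mulrBr mulr1 mulrA mulVf // mul1r vE.
pose X (p : (nat * nat) * nat) := y p.2 p.1 * x ^+ p.2.
have Xb p0 : aC (X p0) <= ((aC (c p0.1.1) * av ^+ p0.1.1) * (av * sg) ^+ p0.1.2) * sg ^+ p0.2.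
  case: p0 => -[n j] r; rewrite /X /= naM // naX //.
  have [jr|rj] := leqP j r; last first.
    by rewrite /y bet0 // mulr0 na0 // mul0r !mulr_ge0 ?exprn_ge0 ?mulr_ge0 ?(na_ge0 ha) ?(ltW sg0).
  have := yb r (n, j); rewrite /= jr => h1.
  have h2 : aC x ^+ r <= sg ^+ j * sg ^+ r.
    apply: (@le_trans _ _ (sg ^+ r * sg ^+ r)).
      by rewrite -exprMn -expr2; apply: lerXn2r; rewrite ?nnegrE ?exprn_ge0 ?(na_ge0 ha) ?(ltW sg0).
    by rewrite ler_wpM2r ?exprn_ge0 ?(ltW sg0) // ler_wiXn2l // ltW.
  apply: le_trans (ler_pM _ _ h1 h2) _; rewrite ?exprn_ge0 ?(na_ge0 ha) //.
  by rewrite exprMn !mulrA.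
have Xn : null aC X.
  apply: (null_le Xb).
  apply: (rnullM (b := fun nj : nat * nat => aC (c nj.1) * av ^+ nj.1 * (av * sg) ^+ nj.2)
                 (c := fun r => sg ^+ r)).
  - by move=> i; rewrite !mulr_ge0 ?exprn_ge0 ?mulr_ge0 ?(na_ge0 ha) ?(ltW sg0).
  - by move=> i; rewrite exprn_ge0 // ltW.
  - apply: (rnullM (b := fun n => aC (c n) * av ^+ n) (c := fun j => (av * sg) ^+ j)) => //.
    + by move=> i; rewrite mulr_ge0 ?exprn_ge0 ?(na_ge0 ha).
    + by move=> i; rewrite exprn_ge0 ?mulr_ge0 ?(ltW sg0).
    by apply: rnull_geom; rewrite mulr_ge0 ?(ltW sg0).
  by apply: rnull_geom; rewrite sg1 ltW.
pose r1 (nj : nat * nat) := c nj.1 * bn nj.1 nj.2 * v ^+ (nj.1 + nj.2) * e x ^+ nj.2.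
have hr1 nj : hsum aC (fun r => X (nj, r)) (r1 nj).
  set k := c nj.1 * bn nj.1 nj.2 * v ^+ (nj.1 + nj.2).
  have h : hsum aC (fun r => k * (bet r nj.2 * x ^+ r)) (k * e x ^+ nj.2).
    exact: (hsumZ ha k (evXn ha hc nj.2 (ev_cs x))).
  by apply: eq_hsum h => r; rewrite /X /y /= mulrA.
have [Z hZ] := null_hsum ha hc Xn.
have hr1Z : hsum aC r1 Z by apply: (hsum_Fubini ha hr1 hZ).
exists Z.
  apply: (hsum_Fubini ha _ hr1Z) => n /=.
  have := hsumZ ha (c n * v ^+ n) (negbin n vex).
  rewrite -mulrA -exprVn -exprMn -uE; apply: eq_hsum => j.
  by rewrite /r1 /bn /= exprD exprMn; rring C.
apply: (hsum_exchange ha hc Xn hr1) hr1Z => r.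
rewrite /X /=; have := hsumZr ha (x ^+ r) (hT r).
by rewrite (_ : T r * x ^+ r = (- w) ^+ r * T r * t ^+ r) // /x -mulNr exprMn; rring C.
Qed.

Lemma u_expansion_hd f c r : u_expansion w f c ->
  u_expansion w (hd f r) (fun N => (- w) ^+ r * thetaG iC r c N).
Proof.
move=> /u_expansionP [b b0 h]; apply/u_expansionP; exists b => // z hz.
have Ez := e_wz_neq0 hp hw (far_Omega b0 hz).
have [T [hT [d d0 hd']]] := theta_local Ez (ev_null ha (h z hz)).
rewrite (@hdE _ _ _ f z (fun r => (- w) ^+ r * T r) r).
  by apply: eq_hsum (hsumZ ha ((- w) ^+ r) (hT r)) => N; rewrite mulrA.
exists (Num.min d b); first by rewrite lt_min d0.
move=> t; rewrite lt_min => /andP[td tb]; have [V V1 V2] := hd' t td.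
suff <- : V = f (z + t) by [].
by apply: (ev_uniq ha V1); apply: h; apply: far_add.
Qed.

(** The case f = u of the preceding computation, where Theta^r gives the Goss polynomial of index r
    + 1. It is used to evaluate the lattice sums of (z + b)^-(r+1). *)
Lemma lexp_u z : Omega z -> lexp u z (fun r => (- w) ^+ r * (map_poly iC (goss F r.+1)).[u z]).
Proof.
move=> hz; have Ez := e_wz_neq0 hp hw hz.
have cn : rnull (fun n => aC (fpsX C n) * aC (u z) ^+ n) by apply: (ev_null ha (evX ha (u z))).
have [T [hT [d d0 hd']]] := theta_local Ez cn.
have TE r : T r = (map_poly iC (goss F r.+1)).[u z].
  apply: (ev_uniq ha (hT r)); have := ev_poly (map_poly iC (goss F r.+1)) (u z).
  rewrite (_ : (fun n => _) = thetaG iC r (fpsX C)) //; apply/funext => -[|N].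
    rewrite coef_map (_ : (goss F r.+1)`_0 = 0); last first.
      by rewrite /goss coef_sum big1 // => j _; rewrite coefZ coefXn mulr0.
    transitivity (0 : C); first exact: rmorph0.
    rewrite /thetaG big1 // => j; rewrite leqn0 => /eqP ->; rewrite /fpsX mul0r //.
  rewrite coef_map -/(goss_coef F r N) /thetaG.
  have [Nr|rN] := ltnP N r.+1; last first.
    rewrite goss_coefE fps_exp_lt' ?carlitz_series0 //.
    transitivity (0 : C); first exact: rmorph0.
    rewrite big1 // => j jN.
    rewrite /fpsX; case: eqP => [E|]; last by rewrite mul0r.
    by have := ltn_ord j; move: E rN jN; lia.
  rewrite (bigD1 (Ordinal Nr)) /= ?leqnSn // subSnn /fpsX eqxx mul1r binn mul1r.
  rewrite big1 ?addr0 // => j /andP[jN /eqP ne]; case: eqP; rewrite ?mul0r //.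
  by move=> E; case: ne; apply/val_inj => /=; move: E jN; lia.
exists d => // t td; have [V V1 V2] := hd' t td.
rewrite (ev_uniq ha (evX ha _) V1).
by rewrite (_ : (fun r => _) = (fun r => (- w) ^+ r * T r)) //; apply/funext => r; rewrite TE.
Qed.
End UExpansion.

(** * Transformation of hyperderivatives under GL_2 *)

Lemma bin_trinomial N s i : (i <= s)%N ->
  ('C(N, i) * 'C(N - i, s - i) = 'C(N, s) * 'C(s, i))%N.
Proof.
move=> is_; have [sN|Ns] := leqP s N; last first.
  rewrite (bin_small Ns) mul0n; have [iN|Ni] := leqP i N; last by rewrite bin_small.
  by rewrite [X in (_ * X)%N]bin_small ?muln0 // ltn_sub2r // (leq_ltn_trans iN).
have iN := leq_trans is_ sN.
apply/eqP; rewrite -(eqn_pmul2r (fact_gt0 i)) -(eqn_pmul2r (fact_gt0 (s - i))).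
rewrite -(eqn_pmul2r (fact_gt0 (N - s))); apply/eqP.
have e1 := bin_fact iN; have e2 := bin_fact sN; have e3 := bin_fact is_.
have E : (N - i - (s - i) = N - s)%N by lia.
have e4 := bin_fact (leq_sub2r i sN); rewrite E in e4.
transitivity N`!.
  by rewrite -e1 -e4 -!mulnA; congr (_ * _)%N; rewrite mulnCA.
by rewrite -e2 -e3 -!mulnA.
Qed.

Section ZmodPow.
Variables (n : nat) (L : comNzRingType) (x : L).
Hypotheses (n0 : (0 < n)%N) (xn : x ^+ n = 1).

Lemma expr_modn k : x ^+ (k %% n) = x ^+ k.
Proof. by rewrite [in RHS](divn_eq k n) exprD mulnC exprM xn expr1n mul1r. Qed.

Lemma expr_ZmodD (m m' : Zmod n) : x ^+ nat_of_ord (m + m') = x ^+ m * x ^+ m'.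
Proof.
rewrite /=; move: (nat_of_ord m) (nat_of_ord m') => a b.
by rewrite prednK // expr_modn exprD.
Qed.

Lemma expr_Zmod_of_nat (r : nat) : x ^+ nat_of_ord (Zmod_of_int n r) = x ^+ r.
Proof. by rewrite /= prednK // expr_modn modz_nat absz_nat expr_modn. Qed.
End ZmodPow.

Section Mobius.
Variables (R : realType) (F : finFieldType) (C : Cinfty R F) (p : nat).
Hypothesis hp : p \in [pchar F].
Notation A := {poly F}.
Notation K := {fraction {poly F}}.
Notation aC := (@absC R F C).
Notation iC := (@KtoC R F C).
Notation iA := (@iA R F C).
Notation q := #|F|.
Notation qR := (#|F|%:R : R).
Add Ring Cring4 : (rT_ring C).

Let ha := absC_nonarch C.
Let hc := @absC_complete R F C.

Variable g : 'M[A]_2.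
Hypothesis gu : g \in unitmx.
Notation e i j := (iA (g i j)).
Notation D := (iA (\det g)).

Lemma det2 : \det g = g 0 0 * g 1 1 - g 0 1 * g 1 0.
Proof.
rewrite (expand_det_row _ 0) big_ord_recl big_ord1 /cofactor !det_mx11 !mxE.
rewrite /= expr0 expr1 mul1r mulN1r mulrN.
by congr (g _ _ * g _ _ - g _ _ * g _ _); apply/val_inj.
Qed.

Lemma det_unit : exists2 k : F, k != 0 & \det g = k%:P.
Proof.
move: gu; rewrite unitmxE poly_unitE => /andP[/eqP s1 u].
exists (\det g)`_0; first by move: u; rewrite unitfE.
by apply: size1_polyC; rewrite s1.
Qed.

Lemma D_neq0' : D != 0.
Proof. by have [k k0 ->] := det_unit; rewrite iA_eq0 polyC_eq0. Qed.

Lemma D_pow : D ^+ q.-1 = 1.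
Proof.
by have [k k0 ->] := det_unit; rewrite -rmorphXn -polyC_exp expf_card_unit // !rmorph1.
Qed.

Lemma aC_Ddet : aC D = 1.
Proof.
by have [k k0 ->] := det_unit; rewrite aC_iA ?polyC_eq0 // size_polyC k0 expr0.
Qed.

Lemma DE : D = e 0 0 * e 1 1 - e 0 1 * e 1 0.
Proof. by rewrite det2 rmorphB !rmorphM. Qed.

Definition jfac (z : C) := e 1 0 * z + e 1 1.
Definition mob (z : C) := (e 0 0 * z + e 0 1) / jfac z.

Lemma far_lin b z (x y : K) : 0 < b -> far b z -> aC (iC x) * b <= aC (iC x * z + iC y).
Proof.
move=> b0 hz; have [->|x0] := eqVneq x 0.
  by rewrite (rmorph0 iC) (na0 ha) mul0r (na_ge0 ha).
have -> : iC x * z + iC y = iC x * (z - iC (- y / x)).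
  rewrite rmorphM fmorphV rmorphN mulrBr mulNr mulrN opprK [iC x * (_ * _)]mulrCA.
  by rewrite divff ?fmorph_eq0 // mulr1.
by rewrite naM // ler_wpM2l ?(na_ge0 ha).
Qed.

Lemma jfac_neq0 z : Omega z -> jfac z != 0.
Proof.
move=> /OmegaP [b b0 hz]; apply/eqP => j0.
have := far_lin (inK (g 1 0)) (inK (g 1 1)) b0 hz; rewrite -!iAE -/(jfac z) j0 (na0 ha).
rewrite pmulr_lle0 // => c0; have {}c0 : e 1 0 = 0.
  by apply/eqP; rewrite -(na_eq0 ha); apply/eqP/le_anti; rewrite c0 (na_ge0 ha).
move: j0; rewrite /jfac c0 mul0r add0r => d0.
by have := D_neq0'; rewrite DE c0 d0 !mulr0 subrr eqxx.
Qed.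

(** If [mob g z] were close to k in K, the linear form with coefficient row (x, y) = (1, -k) g would
    be small at [z], hence x and y would be small. Then det g = x g_11 - y g_10 would have absolute
    value below 1, although it is a unit constant. *)
Lemma mob_Omega z : Omega z -> Omega (mob z).
Proof.
move=> hz; have J0 := jfac_neq0 hz; have /OmegaP [b b0 fz] := hz.
set c := e 1 0; set d := e 1 1.
have [c0 d0 z0] : [/\ 0 <= aC c, 0 <= aC d & 0 <= aC z] by rewrite !(na_ge0 ha).
pose M := b^-1 + 1 + aC z / b; pose N := aC c + aC d + 1.
have bi : 0 < b^-1 by rewrite invr_gt0.
have zb : 0 <= aC z / b by rewrite divr_ge0 // ltW.
have M0 : 0 < M by rewrite /M; lra.
have N0 : 0 < N by rewrite /N; lra.
pose t := (M * N)^-1; have t0 : 0 < t by rewrite invr_gt0 mulr_gt0.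
have tMN : t * M * N = 1 by rewrite -mulrA mulVf // lt0r_neq0 // mulr_gt0.
apply/OmegaP; exists (t / aC (jfac z)); first by rewrite divr_gt0 // na_gt0.
move=> k; pose x := inK (g 0 0) - k * inK (g 1 0); pose y := inK (g 0 1) - k * inK (g 1 1).
have xE : iC x = e 0 0 - iC k * c by rewrite rmorphB rmorphM.
have yE : iC y = e 0 1 - iC k * d by rewrite rmorphB rmorphM.
have -> : mob z - iC k = (iC x * z + iC y) / jfac z.
  rewrite /mob -[iC k](mulfK J0) -mulrBl xE yE; congr (_ / _).
  by rewrite /jfac -/c -/d; rring C.
rewrite (naM ha) (naV ha) ler_wpM2r ?invr_ge0 ?(na_ge0 ha) // leNgt; apply/negP => lt.
have xb := far_lin x y b0 fz.
have x1 : aC (iC x) <= t * M.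
  have : aC (iC x) * b < t by apply: le_lt_trans lt.
  rewrite -ltr_pdivlMr // => /ltW h; apply: le_trans h _; rewrite ler_wpM2l ?(ltW t0) // /M; lra.
have y1 : aC (iC y) <= t * M.
  rewrite -[iC y](addKr (iC x * z)) addrC; apply: na_leB => //.
    apply: le_trans (ltW lt) _; rewrite -[leLHS]mulr1 ler_wpM2l ?(ltW t0) // /M; lra.
  rewrite naM //; have : aC (iC x) * b < t by apply: le_lt_trans lt.
  rewrite -ltr_pdivlMr // => /ltW h.
  apply: (@le_trans _ _ (t / b * aC z)); first by rewrite ler_wpM2r.
  rewrite -mulrA ler_wpM2l ?(ltW t0) // mulrC /M; lra.
have DE' : D = iC x * d - iC y * c by rewrite DE xE yE -/c -/d; rring C.
have : aC D < 1.
  rewrite DE' -tMN; have tM : 0 < t * M by rewrite mulr_gt0.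
  by apply: na_ltB => //; rewrite naM //;
    [apply: (@le_lt_trans _ _ (t * M * aC d))|apply: (@le_lt_trans _ _ (t * M * aC c))];
    rewrite ?ler_wpM2r // ltr_pM2l // /N; lra.
by rewrite aC_Ddet ltxx.
Qed.

(** The change of local parameter: a shift at [mob g z] comes from the shift s / (1 - Xs) at [z],
    with X = g_10 / J and J the automorphy factor. *)
Lemma mob_shift z s : Omega z -> 1 - e 1 0 / jfac z * s != 0 ->
  mob z + D / jfac z ^+ 2 * s = mob (z + s / (1 - e 1 0 / jfac z * s)) /\
  jfac (z + s / (1 - e 1 0 / jfac z * s)) = jfac z / (1 - e 1 0 / jfac z * s).
Proof.
move=> hz; have J0 := jfac_neq0 hz; set X := e 1 0 / jfac z; set v := 1 - X * s => v0.
have vJ : v * jfac z = jfac z - e 1 0 * s by rewrite /v mulrBl mul1r /X mulrAC divfK.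
have JE : jfac (z + s / v) = jfac z / v.
  apply: (mulIf v0); rewrite divfK //.
  rewrite {1}/jfac [e 1 0 * (_ + _)]mulrDr mulrDl mulrDl -[e 1 0 * (s / v) * v]mulrA divfK //.
  have -> : e 1 0 * z * v + e 1 0 * s + e 1 1 * v = v * jfac z + e 1 0 * s.
    by rewrite /jfac; rring C.
  by rewrite vJ addrNK.
split=> //; rewrite /mob JE; set N := e 0 0 * z + e 0 1.
have NE : (e 0 0 * (z + s / v) + e 0 1) / (jfac z / v) = (N * v + e 0 0 * s) / jfac z.
  rewrite invf_div mulrA; congr (_ / _); rewrite [e 0 0 * (_ + _)]mulrDr /N !mulrDl.
  by rewrite -[e 0 0 * (s / v) * v]mulrA divfK // addrAC.
rewrite NE; apply: (mulIf (expf_neq0 2 J0)).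
have -> : (N * v + e 0 0 * s) / jfac z * jfac z ^+ 2 = (N * v + e 0 0 * s) * jfac z.
  by rewrite expr2 mulrA divfK.
have -> : (N / jfac z + D / jfac z ^+ 2 * s) * jfac z ^+ 2 = N * jfac z + D * s.
  rewrite mulrDl; congr (_ + _); first by rewrite expr2 mulrA divfK.
  by rewrite mulrAC divfK // expf_neq0.
rewrite [(_ + _) * jfac z]mulrDl -[N * v * _]mulrA vJ DE /N /jfac; rring C.
Qed.
End Mobius.

Section SerreIdentity.
Variable S : comNzRingType.
Add Ring Sring : (rT_ring S).

(** Collecting the terms that contain [f j] and applying trinomial revision, the inner sum becomes
    the binomial expansion of (X b - (a + X b))^(r - j), in which X cancels. *)
Lemma serre_identity (N r : nat) (a b X : S) (f : nat -> S) :
  (r <= N)%N ->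
  \sum_(i < r.+1) 'C(N, i)%:R * (- (a + X * b)) ^+ i * b ^+ (r - i) *
     (\sum_(j < (r - i).+1) 'C(N - i, r - i - j)%:R * X ^+ (r - i - j) * f j) =
  \sum_(i < r.+1) 'C(N, i)%:R * (- a) ^+ i * b ^+ (r - i) * f (r - i)%N.
Proof.
move=> rN.
pose T i j := 'C(N, i)%:R * (- (a + X * b)) ^+ i * b ^+ (r - i) *
   ('C(N - i, r - i - j)%:R * X ^+ (r - i - j) * f j).
transitivity (\sum_(i < r.+1) \sum_(j < r.+1 | (i + j <= r)%N) T i j).
  apply: eq_bigr => i _; have ir : (i <= r)%N by rewrite -ltnS.
  rewrite mulr_sumr (big_ord_widen r.+1 (T i)) ?ltnS ?leq_subr //.
  by apply: eq_bigl => j; rewrite ltnS leq_subRL.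
rewrite (exchange_big_dep xpredT) //= [RHS](reindex_inj rev_ord_inj) /=.
apply: eq_bigr => j _; have jr : (j <= r)%N by rewrite -ltnS.
rewrite subSS subKn //; set s := (r - j)%N.
transitivity (\sum_(i < s.+1) T i j).
  rewrite (big_ord_widen r.+1 (T^~ j)) ?ltnS ?leq_subr //.
  by apply: eq_bigl => i; rewrite ltnS /s leq_subRL // addnC.
have E (i : 'I_s.+1) : T i j =
    'C(N, s)%:R * b ^+ j * f j * ((X * b) ^+ (s - i) * (- (a + X * b)) ^+ i *+ 'C(s, i)).
  have is_ : (i <= s)%N by rewrite -ltnS.
  have e1 : (r - i - j = s - i)%N by rewrite /s -subnDA addnC subnDA.
  have e2 : (r - i = j + (s - i))%N by move: is_; rewrite /s; lia.
  rewrite /T e1 e2 exprD exprMn -[_ *+ 'C(s, i)]mulr_natl.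
  have := congr1 (fun n => n%:R : S) (bin_trinomial N is_); rewrite !natrM => e3.
  transitivity (('C(N, i)%:R * 'C(N - i, s - i)%:R) * ((- (a + X * b)) ^+ i *
     (b ^+ j * b ^+ (s - i)) * X ^+ (s - i) * f j)); first by crring S.
  by rewrite e3; crring S.
rewrite (eq_bigr _ (fun i _ => E i)) -mulr_sumr -exprDn opprD addrC addrNK.
by crring S.
Qed.
End SerreIdentity.

Section Modular.
Variables (R : realType) (F : finFieldType) (C : Cinfty R F) (p : nat).
Hypothesis hp : p \in [pchar F].
Notation A := {poly F}.
Notation K := {fraction {poly F}}.
Notation aC := (@absC R F C).
Notation iC := (@KtoC R F C).
Notation iA := (@iA R F C).
Notation q := #|F|.
Notation qR := (#|F|%:R : R).
Add Ring Cring5 : (rT_ring C).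

Let ha := absC_nonarch C.
Let hc := @absC_complete R F C.
Variable (w : C).
Hypothesis hw : carlitz_period w.
Notation u := (@u_param R F C w).

(** The i-th term becomes c_i t^i (1 - Xt)^-(k+i), to which [negbin] applies with exponent k + i. *)
Lemma mobius_ev (c : fps C) (X : C) (k : nat) (d : R) (f : C -> C) : 0 < d ->
  (forall t, aC t < d -> ev aC c t (f t)) ->
  exists2 d' : R, 0 < d' & forall t, aC t < d' -> [/\ aC (X * t) < 1, aC t < d &
    ev aC (fun r => \sum_(i < r.+1) 'C((k + r).-1, r - i)%:R * X ^+ (r - i) * c i : C) t
      ((1 - X * t) ^- k * f (t / (1 - X * t)))].
Proof.
move=> d0 hf; have X1 : 0 < aC X + 1 by rewrite ltr_wpDl ?(na_ge0 ha).
exists (Num.min d (aC X + 1)^-1); first by rewrite lt_min d0 invr_gt0.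
move=> t; rewrite lt_min => /andP[td tX].
have Xt : aC (X * t) < 1.
  rewrite naM //; apply: (@le_lt_trans _ _ ((aC X + 1) * aC t)).
    by rewrite ler_wpM2r ?(na_ge0 ha) // lerDl.
  by move: tX; rewrite -[ltRHS]mul1r ltr_pdivlMr // mulrC.
set v := 1 - X * t; have av : aC v = 1 by rewrite na_addl ?naN ?na1.
have v0 : v != 0 by rewrite -(na_gt0 ha) av.
split=> //; have tv : aC (t / v) < d by rewrite naM // naV // av invr1 mulr1.
pose Y (p : nat * nat) := c p.1 * t ^+ p.1 * ('C((k + p.1 + p.2).-1, p.2)%:R * (X * t) ^+ p.2).
have Yn : null aC Y.
  apply: (null_le (b := fun p => (aC (c p.1) * aC t ^+ p.1) * aC (X * t) ^+ p.2)).
    move=> [i n]; rewrite /Y /= !(naM ha) !(naX ha) ler_wpM2l ?mulr_ge0 ?exprn_ge0 ?(na_ge0 ha) //.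
    by rewrite (naM ha) ler_piMl ?exprn_ge0 ?mulr_ge0 ?(na_ge0 ha) // na_nat.
  apply: (rnullM (b := fun i => aC (c i) * aC t ^+ i) (c := fun n => aC (X * t) ^+ n)).
  - by move=> i; rewrite mulr_ge0 ?exprn_ge0 ?(na_ge0 ha).
  - by move=> i; rewrite exprn_ge0 ?(na_ge0 ha).
  - exact: (ev_null ha (hf t td)).
  by apply: rnull_geom; rewrite (na_ge0 ha).
have [Z hZ] := null_hsum ha hc Yn.
have ZE : Z = v ^- k * f (t / v).
  have h := hsumZ ha (v ^- k) (hf _ tv); apply: (hsum_uniq ha _ h).
  apply: (hsum_Fubini ha _ hZ) => i.
  rewrite (_ : v ^- k * (c i * (t / v) ^+ i) = c i * t ^+ i * v ^- (k + i)).
    exact: (hsumZ ha (c i * t ^+ i) (negbin (k + i) Xt)).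
  by rewrite exprMn exprVn exprD invfM; rring C.
rewrite -ZE.
pose Y' (p : nat * nat) := if (p.2 <= p.1)%N
  then 'C((k + p.1).-1, p.1 - p.2)%:R * X ^+ (p.1 - p.2) * c p.2 * t ^+ p.1 else 0.
have hY' : hsum aC Y' Z.
  apply/(@hsum_reindex _ _ _ _ _ (fun p : nat * nat => ((p.1 + p.2)%N, p.1))).
  - move=> [i j] [i' j'] E; have /= E1 := congr1 snd E; have /= := congr1 fst E.
    by rewrite E1 => /addnI ->.
  - move=> [n i]; rewrite /Y' /=; case: leqP => [le_in _|]; last by rewrite eqxx.
    by exists (i, (n - i)%N); rewrite /= subnKC.
  apply: eq_hsum hZ => -[i n]; rewrite /Y /Y' /= leq_addr [(i + n)%N]addnC addnK exprD exprMn.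
  by rewrite [(n + i)%N]addnC addnA; rring C.
apply: (hsum_Fubini ha _ hY') => r; rewrite mulr_suml.
rewrite (_ : \sum_(i < r.+1) _ = \sum_(i <- iota 0 r.+1) Y' (r, i)).
  apply: hsum_fin => //; first exact: iota_uniq.
  by move=> i; rewrite mem_iota add0n /= ltnS /Y' /=; case: leqP.
rewrite -[iota 0 r.+1]/(index_iota 0 r.+1) big_mkord; apply: eq_bigr => i _.
by rewrite /Y' /= -ltnS ltn_ord.
Qed.

Lemma lexp_hd0 (f : C -> C) z : rigid_analytic f -> Omega z -> hd f 0 z = f z.
Proof.
move=> hf hz; have [d d0 h] := rigid_lexp hp hf hz.
have := h 0; rewrite (na0 ha) addr0 => /(_ d0) h0; apply: (ev_uniq ha _ h0).
have := @hsum_fin _ _ _ ha _ (fun n => hd f n z * 0 ^+ n) [:: 0%N] isT.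
rewrite big_seq1 expr0 mulr1; apply=> i; rewrite inE => i0.
by rewrite expr0n (negbTE i0) mulr0.
Qed.

(** [mob_shift] and the functional equation turn the expansion of [f] at [mob g z] into that of (1 -
    Xs)^-k f(z + s / (1 - Xs)), which [mobius_ev] computes; rescaling s to t supplies the powers of
    J^2 / det g. *)
Lemma modular_hd (f : C -> C) (k : nat) (m : Zmod q.-1) (g : 'M[A]_2) z r :
  rigid_analytic f -> modular_function k m f -> g \in unitmx -> Omega (C := C) z ->
  hd f r (mob g z) = iA (\det g) ^- (m + r) * jfac g z ^+ (k + 2 * r) *
    \sum_(i < r.+1) 'C((k + r).-1, r - i)%:R * (iA (g 1 0) / jfac g z) ^+ (r - i) * hd f i z.
Proof.
move=> hf mf gu hz; set D := iA (\det g); set J := jfac g z; set X := _ / J.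
have J0 : J != 0 by apply: jfac_neq0.
have D0 : D != 0 by apply: D_neq0'.
have [d d0 hd'] := rigid_lexp hp hf hz.
have [b b0 fz] := (OmegaP z).1 hz.
have db0 : 0 < Num.min d b by rewrite lt_min d0.
have hf' t : aC t < Num.min d b -> ev aC (fun i => hd f i z) t (f (z + t)).
  by rewrite lt_min => /andP[td _]; apply: hd'.
have [d1 d10 h1] := mobius_ev X k (f := fun t => f (z + t)) db0 hf'.
pose G r := \sum_(i < r.+1) 'C((k + r).-1, r - i)%:R * X ^+ (r - i) * hd f i z.
have JD0 : J ^+ 2 / D != 0 by rewrite mulf_neq0 ?invr_neq0 ?expf_neq0.
have aJD : 0 < aC (J ^+ 2 / D) by rewrite na_gt0.
rewrite (@hdE _ _ _ f (mob g z) (fun r => D ^- m * J ^+ k * (G r * (J ^+ 2 / D) ^+ r))).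
  by rewrite -/(G r) exprD exprD invfM exprMn exprVn -exprM; rring C.
exists (d1 / aC (J ^+ 2 / D)); first by rewrite divr_gt0.
move=> t; rewrite ltr_pdivlMr // -naM //; set s := t * _ => sd1.
have [Xs sdb evs] := h1 s sd1.
have aXs : aC (1 - X * s) = 1 by rewrite na_addl ?naN ?na1.
have Xs0 : 1 - X * s != 0 by rewrite -(na_gt0 ha) aXs.
have [E1 E2] := mob_shift gu hz Xs0.
have tE : t = D / J ^+ 2 * s.
  by rewrite /s mulrCA -[D / _]invf_div mulVf // mulr1.
have hz' : Omega (z + s / (1 - X * s)).
  apply/OmegaP; exists b => //; apply: far_add => //.
  by rewrite naM // naV // aXs invr1 mulr1; move: sdb; rewrite lt_min => /andP[].
rewrite {2}tE E1 (mf g _ gu hz') -/(jfac g (z + s / (1 - X * s))) E2 -/J -iAE -/D.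
have := hsumZ ha (D ^- m * J ^+ k) evs.
rewrite (_ : D ^- m * J ^+ k * _ = D ^- m * (J / (1 - X * s)) ^ Posz k * f (z + s / (1 - X * s))).
  by apply: eq_hsum => i; rewrite /s -/(G i) exprMn; rring C.
by rewrite -exprnP exprMn exprVn; rring C.
Qed.

(** A Serre derivative of order r, with [hd phi 1] / [phi] in the role of the false Eisenstein
    series, and multiplied by phi^r to clear denominators. *)
Definition serreF (k r : nat) (f phi : C -> C) (z : C) : C :=
  \sum_(i < r.+1) 'C((k + r).-1, i)%:R * (- hd phi 1 z) ^+ i * phi z ^+ (r - i) * hd f (r - i) z.

Lemma modular_serreF f phi (k L r : nat) (m : Zmod q.-1) : (0 < k)%N ->
  L%:R = 1 :> C -> rigid_analytic f -> modular_function k m f ->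
  rigid_analytic phi -> modular_function (C := C) L 0 phi ->
  modular_function (k + 2 * r + r * L)%N (m + Zmod_of_int _ r) (serreF k r f phi).
Proof.
move=> k0 L1 hf mf hphi mphi g z gu hz e; rewrite {}/e.
rewrite -!iAE -[iA (g 1 0) * z + _]/(jfac g z) -[(_ + _) / jfac g z]/(mob g z).
have D0 := D_neq0' C gu; have J0 := jfac_neq0 gu hz.
have Dq := D_pow C gu.
have qp : (0 < q.-1)%N by rewrite -ltnS prednK ?card_finField_gt1 // ltnW // card_finField_gt1.
rewrite (expr_ZmodD qp Dq) (expr_Zmod_of_nat qp Dq) -exprD -exprnP.
set D := iA (\det g) in D0 Dq *; set J := jfac g z in J0 *; pose X := iA (g 1 0) / J.
have phiE : phi (mob g z) = J ^+ L * phi z.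
  by rewrite (mphi g z gu hz) expr0 invr1 mul1r -exprnP.
(* Because [L] is 1 in C, the anomaly is exactly [X * phi z]: the substitution of a + X b for a in
   [serre_identity]. *)
have phi1E : hd phi 1 (mob g z) = D^-1 * J ^+ (L + 2) * (hd phi 1 z + X * phi z).
  rewrite (modular_hd 1 hphi mphi gu hz) add0n expr1 muln1 !big_ord_recr big_ord0 /=.
  rewrite subn0 subnn addn1 /= bin1 bin0 L1 expr0 expr1 add0r !mul1r.
  by rewrite (lexp_hd0 hphi hz) [X * _ + _]addrC.
rewrite /serreF phiE phi1E.
have [|rN] := boolP (r == 0%N).
  move=> /eqP ->; rewrite !big_ord_recr !big_ord0 /= !subnn !expr0 !bin0 !mul1r !add0r.
  rewrite (modular_hd 0 hf mf gu hz) big_ord_recr big_ord0 /= ?muln0 ?addn0 ?mul0n ?addn0.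
  by rewrite subnn bin0 expr0 !mul1r add0r.
(* This is where k > 0 enters. *)
have rk : (r <= (k + r).-1)%N by lia.
transitivity (D ^- (m + r) * J ^+ (k + 2 * r + r * L) *
  \sum_(i < r.+1) 'C((k + r).-1, i)%:R * (- (hd phi 1 z + X * phi z)) ^+ i * phi z ^+ (r - i) *
     (\sum_(j < (r - i).+1) 'C((k + r).-1 - i, r - i - j)%:R * X ^+ (r - i - j) * hd f j z)); last first.
  by rewrite (serre_identity (hd phi 1 z) (phi z) X (fun j => hd f j z) rk).
rewrite mulr_sumr; apply: eq_bigr => i _; have ir : (i <= r)%N by rewrite -ltnS.
rewrite (modular_hd (r - i) hf mf gu hz) -/D -/J -/X.
have -> : ((k + (r - i)).-1 = (k + r).-1 - i)%N by lia.
set Sg := \sum_(j < _) _; rewrite -mulrN exprMn exprMn exprVn exprMn -!exprM.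
have -> : (m + r = m + (r - i) + i)%N by rewrite -addnA subnK.
have -> : (k + 2 * r + r * L = (L + 2) * i + L * (r - i) + (k + 2 * (r - i)))%N by nia.
rewrite [D ^+ (_ + i)]exprD invfM [J ^+ (_ + (k + _))]exprD [J ^+ (_ + L * _)]exprD.
by rring C.
Qed.
End Modular.

(** * Operations on modular series *)

Section ThetaFormal.
Variable F : finFieldType.
Notation K := {fraction {poly F}}.

Definition thK (r : nat) (c : fps K) : fps K := thetaG id r c.

Lemma thetaG_map (L : fieldType) (h : {rmorphism K -> L}) r (c : fps K) :
  thetaG h r (fps_map h c) = fps_map h (thK r c) :> fps L.
Proof.
apply/funext => N; rewrite fps_mapE /thK /thetaG rmorph_sum.
by apply: eq_bigr => j _; rewrite !rmorphM rmorph_nat fps_mapE.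
Qed.

Definition serreS (k r : nat) (c phi : fps K) : fps K :=
  \sum_(i < r.+1) fpsC 'C((k + r).-1, i)%:R * (- thK 1 phi) ^+ i * phi ^+ (r - i) * thK (r - i) c.
End ThetaFormal.

Section MulShuffle.
Variable S : comNzRingType.
Add Ring Sring9 : (rT_ring S).
Lemma mul_shuffle (x y v a b d d' : S) : x * y * v = 1 ->
  a * b * d * d' = x * (a * (y * b) * d * (v * d')).
Proof. by move=> E; rewrite -[LHS]mul1r -E; crring S. Qed.
End MulShuffle.

Section ModularSeries.
Variables (R : realType) (F : finFieldType) (C : Cinfty R F) (p : nat).
Hypothesis hp : p \in [pchar F].
Notation A := {poly F}.
Notation K := {fraction {poly F}}.
Notation aC := (@absC R F C).
Notation iC := (@KtoC R F C).
Notation iA := (@iA R F C).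
Notation q := #|F|.
Notation qR := (#|F|%:R : R).
Add Ring Cring6 : (rT_ring C).

Let ha := absC_nonarch C.
Let hc := @absC_complete R F C.
Variable (w : C).
Hypothesis hw : carlitz_period w.
Notation u := (@u_param R F C w).
Notation MS := (modular_series w).

Definition ux (f : C -> C) (c : fps C) := exists2 b : R, 0 < b &
  forall z, far b z -> ev aC c (u z) (f z).

Lemma uxP f c : u_expansion w f c <-> ux f c.
Proof. exact: u_expansionP. Qed.

Lemma ux_op2 (op : C -> C -> C) (opf : fps C -> fps C -> fps C) f g c d :
  (forall c d t S T, ev aC c t S -> ev aC d t T -> ev aC (opf c d) t (op S T)) ->
  ux f c -> ux g d -> ux (fun z => op (f z) (g z)) (opf c d).
Proof.
move=> hop [b b0 h] [b' b'0 h']; exists (Num.max b b'); first by rewrite lt_max b0.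
move=> z hz; apply: hop; [apply: h|apply: h']; apply: far_le hz; rewrite le_max lexx ?orbT //.
Qed.

Lemma uxD f g c d : ux f c -> ux g d -> ux (fun z => f z + g z) (c + d).
Proof. by apply: (ux_op2 (op := +%R)) => *; apply: (evD ha). Qed.
Lemma uxM f g c d : ux f c -> ux g d -> ux (fun z => f z * g z) (c * d).
Proof. by apply: (ux_op2 (op := *%R)) => *; apply: (evM ha hc). Qed.
Lemma uxC k : ux (fun=> k) (fpsC k).
Proof. by exists 1 => // z _; apply: (evC ha). Qed.
Lemma uxX f c n : ux f c -> ux (fun z => f z ^+ n) (c ^+ n).
Proof. by move=> [b b0 h]; exists b => // z hz; apply: (evXn ha hc); apply: h. Qed.
Lemma uxN f c : ux f c -> ux (fun z => - f z) (- c).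
Proof. by move=> [b b0 h]; exists b => // z hz; apply: (evN ha); apply: h. Qed.
Lemma ux_sum (I : Type) (s : seq I) (P : pred I) f c :
  (forall i, P i -> ux (f i) (c i)) ->
  ux (fun z => \sum_(i <- s | P i) f i z) (\sum_(i <- s | P i) c i).
Proof.
move=> h; elim: s => [|i s [b b0 IH]].
  by exists 1 => // z _; rewrite !big_nil; apply: (ev0 ha).
rewrite big_cons; case: ifP => Pi; last first.
  by exists b => // z hz; rewrite big_cons Pi; apply: IH.
have [b' b'0 h'] : ux (fun z => f i z + \sum_(i <- s | P i) f i z) (c i + \sum_(i <- s | P i) c i).
  by apply: uxD; [apply: h|exists b].
by exists b' => // z hz; rewrite big_cons Pi; apply: h'.
Qed.
Lemma eq_ux f g c : f =1 g -> ux f c -> ux g c.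
Proof. by move=> /funext ->. Qed.

Lemma rigid_of_on (f : C -> C) : (forall n, rigid_on n f) -> rigid_analytic f.
Proof. by []. Qed.

Lemma MS_intro (f : C -> C) (c : fps K) (k : int) m : rigid_analytic f ->
  modular_function k m f -> ux f (fps_map iC c) -> MS k m c.
Proof. by move=> h1 h2 /uxP h3; exists f. Qed.

Lemma MS_elim k m (c : fps K) : MS k m c -> exists f : C -> C, [/\ rigid_analytic f,
  modular_function k m f & ux f (fps_map iC c)].
Proof. by move=> [f [h1 h2 h3]]; exists f; split=> //; apply/uxP. Qed.

Lemma qp : (0 < q.-1)%N.
Proof. by rewrite -ltnS prednK ?card_finField_gt1 // ltnW // card_finField_gt1. Qed.

Lemma MS_M k k' m m' (c c' : fps K) : MS k m c -> MS k' m' c' -> MS (k + k') (m + m') (c * c').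
Proof.
move=> /MS_elim [f [h1 h2 h3]] /MS_elim [f' [h1' h2' h3']].
apply: (@MS_intro (fun z => f z * f' z)); last by rewrite rmorphM; apply: uxM.
  by apply: rigid_of_on => n; apply: rigid_onM; [exact: h1|exact: h1'].
move=> g z gu hz e; rewrite {}/e (h2 g z gu hz) (h2' g z gu hz).
have J0 := jfac_neq0 gu hz; have Dq := D_pow C gu.
rewrite -!iAE -[iA (g 1 0) * z + _]/(jfac g z) (expr_ZmodD qp Dq) invfM.
set J := jfac g z in J0 *; have -> : J ^ (k + k') = J ^ k * J ^ k' by apply: expfzDr.
by move: (J ^ k) (J ^ k') => a b; rring C.
Qed.

Lemma MS_scale k m (c : fps K) (x : K) : MS k m c -> MS k m (fpsC x * c).
Proof.
move=> /MS_elim [f [h1 h2 h3]].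
apply: (@MS_intro (fun z => iC x * f z)).
- by apply: rigid_of_on => n; apply: rigid_onM; [exact: rigid_on_const|exact: h1].
- by move=> g z gu hz e; rewrite {}/e (h2 g z gu hz) mulrCA.
by rewrite rmorphM /= fps_mapC; apply: uxM => //; apply: uxC.
Qed.

Lemma MS_D k m (c c' : fps K) : MS k m c -> MS k m c' -> MS k m (c + c').
Proof.
move=> /MS_elim [f [h1 h2 h3]] /MS_elim [f' [h1' h2' h3']].
apply: (@MS_intro (fun z => f z + f' z)); last by rewrite rmorphD; apply: uxD.
  by apply: rigid_of_on => n; apply: rigid_onD; [exact: h1|exact: h1'].
by move=> g z gu hz e; rewrite {}/e (h2 g z gu hz) (h2' g z gu hz) -mulrDr.
Qed.

Lemma MS_1 : MS 0 0 (1 : fps K).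
Proof.
apply: (@MS_intro (fun=> 1)).
- by apply: rigid_of_on => n; apply: rigid_on_const.
- by move=> g z gu hz e; rewrite expr0z expr0 invr1 !mul1r.
by rewrite rmorph1 -(rmorph1 (@fpsC C)); apply: uxC.
Qed.

Lemma MS_X (k : nat) (c : fps K) n : MS k 0 c -> MS (k * n)%N 0 (c ^+ n).
Proof.
move=> h; elim: n => [|n IH]; first by rewrite muln0 expr0; apply: MS_1.
by rewrite exprS mulnS PoszD -[0 : Zmod _](add0r 0); apply: MS_M.
Qed.

(** The i-th hyperderivative expands as (-w)^i Theta^i, and the orders in each term add up to r; the
    factor (-w)^-r therefore brings the coefficients back to K. *)
Lemma MS_serre (k L r : nat) m (c phi : fps K) : (0 < k)%N -> L%:R = 1 :> C ->
  MS k m c -> MS L 0 phi ->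
  MS (k + 2 * r + r * L)%N (m + Zmod_of_int _ r) (serreS k r c phi).
Proof.
move=> k0 L1 /MS_elim [f [h1 h2 h3]] /MS_elim [f' [h1' h2' h3']].
have w0 := w_neq0 hp hw; have w0' : - w != 0 by rewrite oppr_eq0.
have th (g : C -> C) (d : fps K) i : ux g (fps_map iC d) ->
    ux (hd g i) (fpsC ((- w) ^+ i) * fps_map iC (thK i d)).
  move=> /uxP /(u_expansion_hd hp hw i) /uxP; rewrite thetaG_map.
  by rewrite (_ : (fun N => _) = fpsC ((- w) ^+ i) * fps_map iC (thK i d)) //;
    apply/funext => N; rewrite fpsCM.
apply: (@MS_intro (fun z => (- w) ^- r * serreF k r f f' z)).
- apply: rigid_of_on => n; apply: rigid_onM; first exact: rigid_on_const.
  apply: rigid_on_sum => i _; apply: rigid_onM; last exact: (rigid_on_hd hp _ (h1 n)).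
  apply: rigid_onM; last exact: (rigid_onX _ (h1' n)).
  apply: rigid_onM; first exact: rigid_on_const.
  apply: rigid_onX; apply: rigid_on_eq (rigid_onM (rigid_on_const n (-1)) (rigid_on_hd hp 1 (h1' n))).
  by move=> z _; rewrite mulN1r.
- move=> g z gu hz e; rewrite {}/e (modular_serreF hp r k0 L1 h1 h2 h1' h2' gu hz); exact: mulrCA.
apply: (@eq_ux (fun z => \sum_(i < r.+1) (- w) ^- r * ('C((k + r).-1, i)%:R *
    (- hd f' 1 z) ^+ i * f' z ^+ (r - i) * hd f (r - i) z))).
  by move=> z; rewrite -mulr_sumr.
rewrite /serreS rmorph_sum; apply: ux_sum => i _; have ir : (i <= r)%N by rewrite -ltnS.
rewrite 3!rmorphM /= fps_mapC rmorph_nat.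
have -> : fpsC 'C((k + r).-1, i)%:R * fps_map iC ((- thK 1 phi) ^+ i) * fps_map iC (phi ^+ (r - i)) *
    fps_map iC (thK (r - i) c) = fpsC ((- w) ^- r) * (fpsC 'C((k + r).-1, i)%:R *
    (- (fpsC ((- w) ^+ 1) * fps_map iC (thK 1 phi))) ^+ i * (fps_map iC phi) ^+ (r - i) *
    (fpsC ((- w) ^+ (r - i)) * fps_map iC (thK (r - i) c))) :> fps C.
  have E : fpsC ((- w) ^- r) * (fpsC ((- w) ^+ 1)) ^+ i * fpsC ((- w) ^+ (r - i)) = 1 :> fps C.
    rewrite -rmorphXn -!rmorphM -mulrA expr1 -exprD subnKC // mulVf ?rmorph1 //.
    by rewrite expf_neq0.
  have -> : fps_map iC ((- thK 1 phi) ^+ i) = (- fps_map iC (thK 1 phi)) ^+ i.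
    by rewrite rmorphXn rmorphN.
  have -> : fps_map iC (phi ^+ (r - i)) = fps_map iC phi ^+ (r - i) by rewrite rmorphXn.
  rewrite -[- (fpsC _ * _)]mulrN exprMn.
  exact: mul_shuffle E.
apply: uxM; first exact: uxC.
apply: uxM; last exact: th.
apply: uxM; last exact: uxX.
apply: uxM; first exact: uxC.
by apply: uxX; apply: uxN; apply: th.
Qed.
End ModularSeries.

(** * Carlitz polynomials *)

Section DerivShuffle.
Variable S : comNzRingType.
Add Ring Sring10 : (rT_ring S).
Lemma deriv_shuffle (y g T v Z : S) : y * g * (v * Z) = y * Z ->
  - y * Z + v * (- T * Z) = - (y * g + T) * (v * Z).
Proof. by move=> E; rewrite [RHS]mulNr mulrDl E; crring S. Qed.
End DerivShuffle.

(** * Newton's formula for power sums of roots *)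

Section FpsPoly.
Variable S : comNzRingType.

Definition pfps (g : {poly S}) : fps S := fun n => g`_n.

Lemma pfps_is_zmod_morphism : zmod_morphism pfps.
Proof. by move=> x y; apply/funext => n; rewrite fpsBE /pfps coefB. Qed.
Lemma pfps_is_monoid_morphism : monoid_morphism pfps.
Proof.
split; first by apply/funext => n; rewrite /pfps fps1E coef1.
by move=> x y; apply/funext => n; rewrite fpsME /pfps coefM.
Qed.
HB.instance Definition _ := GRing.isZmodMorphism.Build {poly S} (fps S) pfps pfps_is_zmod_morphism.
HB.instance Definition _ := GRing.isMonoidMorphism.Build {poly S} (fps S) pfps pfps_is_monoid_morphism.

Lemma pfpsC k : pfps k%:P = fpsC k.
Proof. by apply/funext => n; rewrite /pfps coefC /fpsC. Qed.
Lemma pfpsX : pfps 'X = fpsX S.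
Proof. by apply/funext => n; rewrite /pfps coefX /fpsX. Qed.

(* The inverse of [1 - s]; only meaningful when [s] has no constant term. *)
Definition geo (s : fps S) : fps S := fun n => \sum_(j < n.+1) (s ^+ j) n.

Lemma geo_wide (s : fps S) n N : s 0%N = 0 -> (n < N)%N ->
  geo s n = \sum_(j < N) (s ^+ j) n.
Proof.
move=> s0 nN; rewrite /geo (big_ord_widen N (fun j => (s ^+ j) n) nN) big_mkcond.
by apply: eq_bigr => j _; case: ltnP => // jn; rewrite fps_exp_lt'.
Qed.

Lemma geoE (s : fps S) : s 0%N = 0 -> (1 - s) * geo s = 1.
Proof.
move=> s0; apply/funext => n.
have -> : ((1 - s) * geo s) n = ((1 - s) * \sum_(j < n.+1) s ^+ j) n.
  rewrite !fpsME; apply: eq_bigr => i _; congr (_ * _).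
  by rewrite fps_sumE (@geo_wide s _ n.+1) // ltnS leq_subr.
rewrite -[1 - s]opprB mulNr -subrX1 opprB fpsBE fps_exp_lt' ?subr0 //.
Qed.

Lemma geo_const (y : S) n : geo (fpsC y * fpsX S) n = y ^+ n.
Proof.
rewrite /geo big_ord_recr /= big1 => [|j _].
  by rewrite add0r exprMn -rmorphXn fpsCM fpsXnE eqxx mulr1.
by rewrite exprMn -rmorphXn fpsCM fpsXnE gtn_eqF ?mulr0 //; apply: ltn_ord.
Qed.

Definition power_sums (ys : seq S) : fps S := fun n => \sum_(y <- ys) y ^+ n.+1.

(** The logarithmic derivative of the product: each factor contributes -y / (1 - yX), a geometric
    series. *)
Lemma power_sum_deriv (ys : seq S) :
  pfps ((\prod_(y <- ys) (1 - y *: 'X))^`()) =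
  - power_sums ys * pfps (\prod_(y <- ys) (1 - y *: 'X)).
Proof.
elim: ys => [|y ys IH].
  rewrite big_nil derivC rmorph0 rmorph1 mulr1; apply/funext => n.
  by rewrite fpsNE /power_sums big_nil oppr0.
rewrite !big_cons derivM rmorphD !rmorphM /= IH.
pose g := geo (fpsC y * fpsX S).
have -> : power_sums (y :: ys) = fpsC y * g + power_sums ys.
  by apply/funext => n; rewrite fpsDE fpsCM /g geo_const -exprS /power_sums big_cons.
have gE : (1 - fpsC y * fpsX S) * g = 1.
  by apply: geoE; rewrite fpsCM mulr0.
have -> : pfps (1 - y *: 'X) = 1 - fpsC y * fpsX S.
  by rewrite rmorphB rmorph1 -mul_polyC rmorphM /= pfpsC pfpsX.
have -> : pfps (1 - y *: 'X)^`() = - fpsC y.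
  by rewrite derivB derivC derivZ derivX sub0r rmorphN /= alg_polyC pfpsC.
set v := 1 - _ in gE *; set Z := pfps _.
have E1 : (fpsC y * g) * (v * Z) = fpsC y * Z.
  by rewrite -mulrA [g * _]mulrA [g * v]mulrC gE mul1r.
exact: deriv_shuffle E1.
Qed.
End FpsPoly.

(** Passing to inverse roots turns G - v into 1 - G/v. Its derivative is the constant -a/v, so the
    logarithmic derivative is a constant over 1 - G/v. Additive polynomials such as C_a have
    constant derivative. *)
Lemma power_sum (L : fieldType) (xs : seq L) (G : {poly L}) (v a : L) : v != 0 ->
  G`_0 = 0 -> G^`() = a%:P -> G - v%:P = \prod_(x <- xs) ('X - x%:P) -> forall n,
  \sum_(x <- xs) x^-1 ^+ n.+1 = v^-1 * a * geo (pfps (v^-1 *: G)) n.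
Proof.
move=> v0 G0 G' GE n.
have x0 x : x \in xs -> x != 0.
  move=> xx; apply/eqP => E; have : root (G - v%:P) x by rewrite GE root_prod_XsubC.
  by rewrite E /root hornerD hornerN hornerC horner_coef0 G0 add0r oppr_eq0 (negbTE v0).
pose ys := [seq x^-1 | x <- xs].
have PE : \prod_(y <- ys) (1 - y *: 'X) = 1 - v^-1 *: G.
  have [k kE] : exists k : L, \prod_(y <- ys) (1 - y *: 'X) = k *: (G - v%:P).
    rewrite GE /ys big_map; elim: (xs) x0 => [|x s IH] h.
      by exists 1; rewrite !big_nil scale1r.
    have [k kE] := IH (fun y ys' => h y (mem_behead (s := x :: s) ys')).
    exists (- x^-1 * k); rewrite !big_cons kE.
    have -> : 1 - x^-1 *: 'X = - x^-1 *: ('X - x%:P).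
      rewrite scalerBr !scaleNr opprK addrC; congr (_ + _).
      by rewrite -mul_polyC -polyCM mulVf // h ?mem_head.
    by rewrite -scalerAl -scalerAr scalerA.
  have := congr1 (fun g => g.[0]) kE; rewrite horner_prod hornerZ hornerD hornerN hornerC.
  rewrite horner_coef0 G0 add0r big1 => [|y _]; last first.
    by rewrite hornerD hornerN hornerZ hornerX hornerC mulr0 subr0.
  move=> k1; rewrite kE; have -> : k = - v^-1.
    by apply: (mulIf (x := - v)); rewrite ?oppr_eq0 // -k1 mulrNN mulVf.
  by rewrite scaleNr scalerBr opprB -mul_polyC -polyCM mulVf.
have := power_sum_deriv ys; rewrite PE.
pose s : fps L := pfps (v^-1 *: G); have s0 : s 0%N = 0 by rewrite /s /pfps coefZ G0 mulr0.
have -> : pfps (1 - v^-1 *: G) = 1 - s by rewrite rmorphB rmorph1.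
rewrite derivB derivC derivZ G' sub0r rmorphN /= -mul_polyC -polyCM pfpsC mulNr => /oppr_inj E.
have : power_sums ys = fpsC (v^-1 * a) * geo s.
  by rewrite E -mulrA geoE // mulr1.
move=> /(congr1 (fun h => h n)); rewrite fpsCM -/s => <-.
by rewrite /power_sums /ys big_map.
Qed.

Lemma fps_map_geo (S T : comNzRingType) (h : {rmorphism S -> T}) (s : fps S) :
  fps_map h (geo s) = geo (fps_map h s).
Proof.
apply/funext => n; rewrite fps_mapE /geo rmorph_sum.
by apply: eq_bigr => j _; rewrite -fps_mapE rmorphXn.
Qed.

Lemma deriv_exp_pchar (S : comNzRingType) (g : {poly S}) n : n%:R = 0 :> S -> (g ^+ n)^`() = 0.
Proof. by move=> n0; rewrite deriv_exp -mulr_natr -polyC_natr n0 mulr0. Qed.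

(** * The Carlitz module *)

Section CarlitzPoly.
Variable F : finFieldType.
Notation A := {poly F}.
Notation q := #|F|.
Let qn1 : (1 < q)%N := card_finField_gt1 F.
Let qn0 : (0 < q)%N := ltnW qn1.

(** [CX j] is C_(theta^j) for the Carlitz module C_theta(X) = theta X + X^q, and [carl a] is C_a by
    linearity over the constants. *)
Definition CX (j : nat) : {poly A} := iter j (fun g => ('X : A)%:P * g + g ^+ q) 'X.
Definition carl (a : A) : {poly A} := \sum_(i < size a) ((a`_i)%:P)%:P * CX i.

Lemma CXS j : CX j.+1 = ('X : A)%:P * CX j + CX j ^+ q. Proof. by []. Qed.

Lemma CX_monic_size j : CX j \is monic /\ size (CX j) = (q ^ j).+1.
Proof.
elim: j => [|j [m s]]; first by rewrite monicX size_polyX.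
have sq : size (CX j ^+ q) = (q ^ j.+1).+1.
  have : (size (CX j ^+ q)).-1 = (q ^ j.+1)%N by rewrite size_exp s /= -expnSr.
  have : CX j ^+ q != 0 by rewrite monic_neq0 // monic_exp.
  by rewrite -size_poly_gt0 => h <-; rewrite prednK.
have lt : (size (('X : A)%:P * CX j)%R < size (CX j ^+ q)%R)%N.
  rewrite sq mul_polyC size_scale ?polyX_eq0 // s ltnS.
  by rewrite ltn_exp2l.
rewrite CXS addrC; split; last by rewrite size_polyDl.
by rewrite monicE lead_coefDl // (monicP (monic_exp _ m)).
Qed.

Lemma CX_coef0 j : (CX j)`_0 = 0.
Proof.
elim: j => [|j IH]; first by rewrite coefX.
rewrite CXS -!horner_coef0 hornerD hornerM horner_exp !horner_coef0 IH mulr0 add0r.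
by rewrite expr0n; case: (q) qn0.
Qed.

Lemma carl_coef0 a : (carl a)`_0 = 0.
Proof. by rewrite /carl coef_sum big1 // => i _; rewrite coefCM CX_coef0 mulr0. Qed.

Lemma carl_size_lead a : a != 0 ->
  size (carl a) = (q ^ (size a).-1).+1 /\ lead_coef (carl a) = (lead_coef a)%:P.
Proof.
move=> a0; rewrite /carl; have sa : size a = (size a).-1.+1 by rewrite prednK // size_poly_gt0.
rewrite [lead_coef a]lead_coefE; set n := (size a).-1 in sa *; rewrite sa big_ord_recr /=.
have ln : a`_n != 0 by rewrite -lead_coef_eq0 in a0; move: a0; rewrite lead_coefE.
have [m s] := CX_monic_size n.
have lt : (size (\sum_(i < n) ((a`_i)%:P)%:P * CX i)%R < size (((a`_n)%:P)%:P * CX n)%R)%N.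
  rewrite mul_polyC size_scale ?polyC_eq0 // s ltnS.
  apply: leq_trans (size_sum _ _ _) _; apply/bigmax_leqP => i _.
  have [-> |ai] := eqVneq (a`_i) 0; first by rewrite !rmorph0 mul0r size_poly0.
  rewrite mul_polyC size_scale ?polyC_eq0 //; have [_ ->] := CX_monic_size i.
  by rewrite ltn_exp2l.
rewrite addrC size_polyDl // lead_coefDl // mul_polyC size_scale ?polyC_eq0 // s.
by rewrite lead_coefZ (monicP m) mulr1.
Qed.

Variable p : nat.
Hypothesis hp : p \in [pchar F].

Lemma card_F0 : q%:R = 0 :> F.
Proof.
have [pp _] := andP hp; have := pnat_card_finField hp => /p_natP [[|n] E].
  by move: qn1; rewrite E.
by rewrite E expnS natrM (pcharf0 hp) mul0r.
Qed.

Lemma card_A0 : q%:R = 0 :> A.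
Proof. by rewrite -polyC_natr card_F0. Qed.

Lemma deriv_CX j : (CX j)^`() = ('X^j : A)%:P.
Proof.
elim: j => [|j IH]; first by rewrite derivX expr0.
by rewrite CXS derivD deriv_mulC IH (deriv_exp_pchar _ card_A0) addr0 -polyCM -exprS.
Qed.

Lemma deriv_carl a : (carl a)^`() = a%:P.
Proof.
rewrite /carl raddf_sum /= -[in RHS](coefK a) poly_def rmorph_sum.
by apply: eq_bigr => i _; rewrite deriv_mulC deriv_CX -polyCM mul_polyC.
Qed.

Lemma coef_carl_dvd a m : (carl a)`_m *+ m = if m == 1%N then a else 0.
Proof.
case: m => [|m]; first by rewrite mulr0n.
by rewrite -coef_deriv deriv_carl coefC eqSS.
Qed.

(* [u^Q C_a(1/u)], where [Q] is the degree of [C_a]. *)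
Definition revC (a : A) : fps A :=
  fun i => if (i <= q ^ (size a).-1)%N then (carl a)`_(q ^ (size a).-1 - i) else 0.

(** The constant term of [revC a] is the leading coefficient of [a]; after division by it, [sC a]
    has no constant term and [geo (sC a)] inverts the normalised [revC a]. *)
Definition sC (a : A) : fps A := 1 - fpsC (((lead_coef a)^-1)%:P) * revC a.

(* The expansion of [u(az)] in powers of [u(z)]. *)
Definition UC (a : A) : fps A :=
  fpsC (((lead_coef a)^-1)%:P) * (fpsX A ^+ (q ^ (size a).-1) * geo (sC a)).

Lemma sC0 a : a != 0 -> sC a 0%N = 0.
Proof.
move=> a0; rewrite /sC fpsBE fps1E fpsCM /revC /= subn0.
have [s l] := carl_size_lead a0; move: l; rewrite lead_coefE s /= => ->.
by rewrite -polyCM mulVf ?lead_coef_eq0 // subrr.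
Qed.

Lemma UC_lt (a : A) n : (n < q ^ (size a).-1)%N -> UC a n = 0.
Proof. by move=> h; rewrite /UC fpsCM fpsXnM leqNgt h mulr0. Qed.
End CarlitzPoly.

Section CarlitzEval.
Variables (R : realType) (F : finFieldType) (C : Cinfty R F) (p : nat).
Hypothesis hp : p \in [pchar F].
Notation A := {poly F}.
Notation K := {fraction {poly F}}.
Notation aC := (@absC R F C).
Notation iC := (@KtoC R F C).
Notation iA := (@iA R F C).
Notation q := #|F|.
Notation qR := (#|F|%:R : R).
Notation e := (@carlitz_exp R F C).
Add Ring Cring11 : (rT_ring C).
Let ha := absC_nonarch C.
Let hc := @absC_complete R F C.
Let q1 : 1 < qR := qR_gt1 R F.
Let q0 : 0 < qR := qR_gt0 R F.
Let qge1 : 1 <= qR := qR_ge1 R F.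
Let qn1 : (1 < q)%N := card_finField_gt1 F.
Let qn0 : (0 < q)%N := ltnW qn1.
Hint Resolve q1 q0 qge1 qn1 qn0 : core.
Notation cC a := (map_poly iA (carl a)).

Lemma e_CX j x : (map_poly iA (CX F j)).[e x] = e (iA 'X ^+ j * x).
Proof.
elim: j => [|j IH]; first by rewrite map_polyX hornerX expr0 mul1r.
rewrite CXS rmorphD rmorphM rmorphXn /= map_polyC hornerD hornerM horner_exp hornerC IH.
by rewrite exprS -mulrA (e_theta hp).
Qed.

Lemma e_carl a x : (cC a).[e x] = e (iA a * x).
Proof.
have -> : iA a = \sum_(i < size a) iA (a`_i)%:P * iA 'X ^+ i.
  rewrite -{1}(coefK a) poly_def rmorph_sum; apply: eq_bigr => i _.
  by rewrite -mul_polyC rmorphM rmorphXn.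
rewrite /carl rmorph_sum horner_sum mulr_suml (e_sum hp).
apply: eq_bigr => i _; rewrite rmorphM /= map_polyC hornerM hornerC e_CX.
by rewrite -mulrA e_const.
Qed.

(** On a circle of radius B >= q, theta times the polynomial is dominated by the bound for its q-th
    power. *)
Lemma CX_bound B j : qR <= B -> cbound (pfps (map_poly iA (CX F j))) B (B ^+ (q ^ j)).
Proof.
move=> qB; have B1 : 1 <= B by apply: le_trans qB.
have B0 : 0 <= B by apply: le_trans B1.
elim: j => [|j IH] m.
  rewrite /pfps map_polyX coefX expr1; case: eqP => [->|_].
    by rewrite na1 // mul1r expr1.
  by rewrite na0 // mul0r.
rewrite CXS rmorphD rmorphM rmorphXn /= map_polyC /= rmorphD rmorphM rmorphXn /=.
rewrite fpsDE pfpsC fpsCM.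
have [B00|Bm] := eqVneq (B ^+ m) 0; first by rewrite B00 mulr0 exprn_ge0.
have Bm0 : 0 < B ^+ m by rewrite lt_neqAle eq_sym Bm exprn_ge0.
rewrite -ler_pdivlMr //; apply: na_leD => //; rewrite ler_pdivlMr //.
  rewrite naM // aC_theta -mulrA; apply: (@le_trans _ _ (B * B ^+ (q ^ j))).
    apply: ler_pM => //; rewrite ?mulr_ge0 ?exprn_ge0 ?(na_ge0 ha) ?(ltW q0) //; exact: IH.
  rewrite -exprS ler_weXn2l // expnS.
  apply: (@leq_trans (2 * q ^ j)); last by rewrite leq_mul2r qn1 orbT.
  by rewrite mul2n -addnn -addn1 leq_add2l expn_gt0 qn0.
have := cboundX q B0 (exprn_ge0 _ B0) IH m.
by rewrite -exprM -expnSr.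
Qed.

Lemma carl_bound B a : qR <= B -> cbound (pfps (cC a)) B (B ^+ (q ^ (size a).-1)).
Proof.
move=> qB m; have B1 : 1 <= B by apply: le_trans qB.
have B0 : 0 < B by apply: lt_le_trans B1.
rewrite -ler_pdivlMr ?exprn_gt0 // /carl rmorph_sum rmorph_sum fps_sumE.
apply: na_sum_le => //; first by rewrite divr_ge0 ?exprn_ge0 ?(ltW B0).
move=> i _ _; rewrite rmorphM /= map_polyC rmorphM /= pfpsC fpsCM naM //.
rewrite ler_pdivlMr ?exprn_gt0 // -mulrA; apply: (@le_trans _ _ (B ^+ (q ^ i))).
  rewrite -[leRHS]mul1r; apply: ler_pM; rewrite ?mulr_ge0 ?exprn_ge0 ?(na_ge0 ha) ?(ltW B0) //.
    exact: aC_const.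
  exact: CX_bound.
have si := ltn_ord i; have s0 : (0 < size a)%N by apply: leq_ltn_trans si.
by rewrite ler_weXn2l // leq_exp2l // -ltnS prednK.
Qed.

Lemma sC_bound B a : qR <= B -> cbound (fps_map iA (sC a)) B^-1 1.
Proof.
move=> qB n; have B0 : 0 < B by apply: lt_le_trans qB.
have Bn : 0 < B^-1 ^+ n by rewrite exprn_gt0 // invr_gt0.
rewrite -ler_pdivlMr // /sC rmorphB rmorph1 rmorphM /= fps_mapC fpsBE fpsCM.
have B1 : 1 <= 1 / B^-1 ^+ n.
  by rewrite div1r -exprVn invrK exprn_ege1 // (le_trans qge1).
apply: na_leB => //.
  by rewrite fps1E; case: eqP => _; [rewrite (na1 ha)|rewrite (na0 ha) (le_trans ler01)].
rewrite naM // fps_mapE /revC; case: leqP => [nQ|_]; last by rewrite rmorph0 na0 // mulr0 (le_trans ler01).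
set Q := (q ^ _)%N in nQ *.
have := carl_bound a qB (Q - n)%N; rewrite /pfps coef_map -/Q => h.
rewrite -[leRHS]mul1r; apply: ler_pM; rewrite ?(na_ge0 ha) ?aC_const //.
rewrite div1r -exprVn invrK.
have : aC (iA (carl a)`_(Q - n)) * B ^+ (Q - n) <= B ^+ n * B ^+ (Q - n).
  by rewrite -exprD subnKC.
by rewrite ler_pM2r // exprn_gt0.
Qed.

Lemma geo_bound (s : fps C) t : 0 <= t -> cbound s t 1 -> cbound (geo s) t 1.
Proof.
move=> t0 h n; have [tn0|tn] := eqVneq (t ^+ n) 0; first by rewrite tn0 mulr0 ler01.
have tn1 : 0 < t ^+ n by rewrite lt_neqAle eq_sym tn exprn_ge0.
rewrite -ler_pdivlMr //; apply: na_sum_le => //; first by rewrite divr_ge0 // ltW.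
by move=> j _ _; rewrite ler_pdivlMr //; have := cboundX j t0 ler01 h n; rewrite expr1n.
Qed.

Lemma fpsX_bound t n : 0 <= t -> cbound (fpsX C ^+ n) t (t ^+ n).
Proof.
move=> t0 m; rewrite fpsXnE; case: eqP => [->|_]; first by rewrite na1 // mul1r.
by rewrite na0 // mul0r exprn_ge0.
Qed.

Lemma UC_bound B a : qR <= B ->
  cbound (fps_map iA (UC a)) B^-1 (B^-1 ^+ (q ^ (size a).-1)).
Proof.
move=> qB; have B0 : 0 <= B^-1 by rewrite invr_ge0 (le_trans _ qB) // ltW.
rewrite /UC !rmorphM /= fps_mapC rmorphXn /=.
have -> : fps_map iA (fpsX A) = fpsX C.
  by apply/funext => n; rewrite fps_mapE rmorph_nat.
move=> n; rewrite fpsCM naM // -mulrA -[leRHS]mul1r.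
apply: ler_pM; rewrite ?mulr_ge0 ?exprn_ge0 ?(na_ge0 ha) ?aC_const //.
rewrite -[leRHS]mulr1; apply: cboundM => //; rewrite ?exprn_ge0 //.
  exact: fpsX_bound.
by rewrite fps_map_geo; apply: geo_bound => //; apply: sC_bound.
Qed.

Lemma cbound_ev c t D x : 0 < t -> cbound c t D -> aC x < t -> exists S, ev aC c x S.
Proof.
move=> t0 h xt; apply: null_ev => //.
have D0 : 0 <= D by apply: le_trans (h 0%N); rewrite mulr_ge0 ?(na_ge0 ha) // expr0.
apply: (@rnull_le _ _ _ (fun n => D * (aC x / t) ^+ n)); last first.
  apply: rnull_scale => //; apply: rnull_geom.
  by rewrite divr_ge0 ?(na_ge0 ha) ?(ltW t0) //= ltr_pdivrMr // mul1r.
move=> n; rewrite expr_div_n [leRHS]mulrCA mulrC.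
apply: ler_wpM2l; first by rewrite exprn_ge0 ?(na_ge0 ha).
by rewrite ler_pdivlMr ?exprn_gt0.
Qed.

(** 1 / C_a(1/x) equals x^Q over the reversed polynomial, which [geo] inverts; the circle of radius
    1/B bounds all the series involved. *)
Lemma ev_UC B a x : qR <= B -> a != 0 -> x != 0 -> aC x < B^-1 ->
  ev aC (fps_map iA (UC a)) x ((cC a).[x^-1])^-1.
Proof.
move=> qB a0 x0 xB; have Bi0 : 0 < B^-1 by rewrite invr_gt0 (lt_le_trans _ qB).
set k := (lead_coef a)^-1; set Q := (q ^ (size a).-1)%N.
pose rv := \poly_(i < Q.+1) (cC a)`_(Q - i).
have [sz _] := carl_size_lead a0.
have iAinj : injective iA.
  by move=> y z /eqP; rewrite -subr_eq0 -rmorphB iA_eq0 subr_eq0 => /eqP.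
have szC : size (cC a) = Q.+1 by rewrite size_map_inj_poly // rmorph0.
have rvE : rv.[x] = x ^+ Q * (cC a).[x^-1].
  rewrite horner_poly (reindex_inj rev_ord_inj) /= horner_coef szC mulr_sumr.
  apply: eq_bigr => i _; have iQ : (i <= Q)%N by rewrite -ltnS.
  rewrite subSS subKn // mulrCA exprVn; congr (_ * _).
  by apply: (mulIf (expf_neq0 i x0)); rewrite divfK ?expf_neq0 // -exprD subnK.
have evs : ev aC (fps_map iA (sC a)) x (1 - iA k%:P * rv.[x]).
  rewrite /sC rmorphB rmorph1 rmorphM /= fps_mapC; apply: (evB ha); first exact: (ev1 ha).
  apply: (evZ ha hc); have := ev_poly rv x; congr (ev _ _ _ _); apply/funext => n.
  rewrite coef_poly ltnS fps_mapE /revC -/Q coef_map; case: leqP => //.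
  by rewrite rmorph0.
have [S hS] := cbound_ev Bi0 (geo_bound (ltW Bi0) (sC_bound a qB)) xB.
have s0 : fps_map iA (sC a) 0%N = 0 by rewrite fps_mapE sC0 // rmorph0.
have k0 : iA k%:P != 0 by rewrite iA_eq0 polyC_eq0 invr_eq0 lead_coef_eq0.
have h1 := evM ha hc (evB ha (ev1 ha x) evs) hS.
rewrite geoE // subKr in h1.
have S1 : iA k%:P * rv.[x] * S = 1 by apply: (ev_uniq ha h1); apply: (ev1 ha).
have SE : S = (iA k%:P * rv.[x])^-1.
  apply: (mulfI (x := iA k%:P * rv.[x])); last first.
    rewrite S1 mulfV //; apply/eqP => E; move: S1; rewrite E mul0r => /esym/eqP.
    by rewrite oner_eq0.
  by apply/eqP => E; move: S1; rewrite E mul0r => /esym/eqP; rewrite oner_eq0.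
rewrite /UC !rmorphM /= fps_mapC rmorphXn /= fps_map_geo.
have -> : fps_map iA (fpsX A) = fpsX C.
  by apply/funext => n; rewrite fps_mapE rmorph_nat.
have := evZ ha hc (iA k%:P) (evM ha hc (evXn ha hc Q (evX ha x)) hS).
congr (ev _ _ _ _); rewrite SE rvE !invfM.
by rewrite mulrCA mulVKf // mulrA mulfV ?mul1r // expf_neq0.
Qed.

Lemma ev_UC_u (w : C) a z : a != 0 -> e (w * z) != 0 -> aC (u_param w z) < qR^-1 ->
  ev aC (fps_map iA (UC a)) (u_param w z) (u_param w (iA a * z)).
Proof.
move=> a0 ez zq; have := ev_UC (lexx _) a0 (_ : u_param w z != 0) zq.
rewrite invr_eq0 => /(_ ez); congr (ev _ _ _ _).
by rewrite invrK e_carl mulrCA.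
Qed.
End CarlitzEval.

(** * The Hecke operator at P *)

Lemma big_option (S : nmodType) (T : finType) (G : option T -> S) :
  \sum_(o : option T) G o = G None + \sum_(x : T) G (Some x).
Proof.
rewrite (bigD1 None) //=; congr (_ + _).
rewrite (reindex_omap Some id) /=; last by case.
by apply: eq_bigl => x; rewrite /= eqxx.
Qed.

Lemma size_contra (x y : nat) : (0 < x)%N -> (0 < y)%N -> ((x + y).-1 <= y.-1)%N -> False.
Proof. lia. Qed.

Section Compo.
Variable S : comNzRingType.
(* [c(U(x))], meaningful when [U] has no constant term. *)
Definition compo (c U : fps S) : fps S := fun m => \sum_(n < m.+1) c n * (U ^+ n) m.
End Compo.

Lemma fps_map_compo (S T : comNzRingType) (h : {rmorphism S -> T}) (c U : fps S) :
  fps_map h (compo c U) = compo (fps_map h c) (fps_map h U).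
Proof.
apply/funext => m; rewrite fps_mapE /compo rmorph_sum; apply: eq_bigr => n _.
by rewrite rmorphM -[h ((U ^+ n) m)]fps_mapE rmorphXn.
Qed.

Section Hecke.
Variables (R : realType) (F : finFieldType) (C : Cinfty R F) (p : nat).
Hypothesis hp : p \in [pchar F].
Notation A := {poly F}.
Notation K := {fraction {poly F}}.
Notation aC := (@absC R F C).
Notation iC := (@KtoC R F C).
Notation iA := (@iA R F C).
Notation q := #|F|.
Notation qR := (#|F|%:R : R).
Notation e := (@carlitz_exp R F C).
Add Ring Cring12 : (rT_ring C).
Let AR : comNzRingType := {poly F}.
Add Ring Aring12 : (rT_ring AR).
Add Ring Rring12 : (rT_ring R).
Let ha := absC_nonarch C.
Let hc := @absC_complete R F C.
Let q1 : 1 < qR := qR_gt1 R F.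
Let q0 : 0 < qR := qR_gt0 R F.
Let qge1 : 1 <= qR := qR_ge1 R F.
Let qn1 : (1 < q)%N := card_finField_gt1 F.
Let qn0 : (0 < q)%N := ltnW qn1.
Hint Resolve q1 q0 qge1 qn1 qn0 : core.
Notation cC a := (map_poly iA (carl a)).
Variable (w : C).
Hypothesis hw : carlitz_period w.
Notation u := (@u_param R F C w).

(** [D] bounds U on the circle of radius t and lies within the radius of convergence of [c], so the
    double series of c_n (U^n)_m x^m is null and its sums may be exchanged. *)
Lemma compo_ev (c U : fps C) (x y S : C) (t D : R) : 0 < t -> 0 <= D -> U 0%N = 0 ->
  rnull (fun n => aC (c n) * D ^+ n) -> cbound U t D -> aC x < t ->
  ev aC U x y -> ev aC c y S -> ev aC (compo c U) x S.
Proof.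
move=> t0 D0 U0 cn hU xt hy hS.
pose X (nm : nat * nat) := c nm.1 * ((U ^+ nm.1) nm.2 * x ^+ nm.2).
have Xn : null aC X.
  apply: (null_le (b := fun nm => (aC (c nm.1) * D ^+ nm.1) * (aC x / t) ^+ nm.2)).
    move=> [n m]; rewrite /X /= (naM ha) (naM ha) (naX ha) -[leRHS]mulrA.
    apply: ler_wpM2l; rewrite ?(na_ge0 ha) //.
    rewrite expr_div_n [leRHS]mulrCA mulrC; apply: ler_wpM2l; rewrite ?exprn_ge0 ?(na_ge0 ha) //.
    by rewrite ler_pdivlMr ?exprn_gt0 //; apply: (cboundX n (ltW t0) D0 hU m).
  apply: (rnullM (b := fun n => aC (c n) * D ^+ n) (c := fun m => (aC x / t) ^+ m)) => //.
  - by move=> i; rewrite mulr_ge0 ?exprn_ge0 ?(na_ge0 ha).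
  - by move=> i; rewrite exprn_ge0 // divr_ge0 ?(na_ge0 ha) // ltW.
  by apply: rnull_geom; rewrite divr_ge0 ?(na_ge0 ha) ?(ltW t0) //= ltr_pdivrMr // mul1r.
apply: (hsum_exchange ha hc Xn (r := fun n => c n * y ^+ n)) hS => [n|m].
  exact: (hsumZ ha (c n) (evXn ha hc n hy)).
rewrite /compo mulr_suml.
rewrite (_ : \sum_(i < m.+1) _ = \sum_(n <- iota 0 m.+1) X (n, m)).
  apply: hsum_fin => //; first exact: iota_uniq.
  move=> n; rewrite mem_iota add0n /= -leqNgt => mn.
  by rewrite /X /= fps_exp_lt' // mul0r mulr0.
rewrite -[iota 0 m.+1]/(index_iota 0 m.+1) big_mkord; apply: eq_bigr => n _.
by rewrite /X /= mulrA.
Qed.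

Section Fiber.
Variable a : A.
Hypothesis am : a \is monic.
Let n := (size a).-1.
Let a0 : a != 0 := monic_neq0 am.

(** Up to translation by A, the points that multiplication by [a] sends to [z]; row vectors encode
    the polynomials of degree below that of [a]. *)
Definition fib (b : 'rV[F]_n) (z : C) : C := (z + iA (rVpoly b)) / iA a.

(** The q^n values e(w(z + b)/a) are distinct roots of the monic polynomial C_a - e(wz) of degree
    q^n: if two agree, (b - b')/a lies in A, which degrees forbid unless b = b'. *)
Lemma fiber_poly z : e (w * z) != 0 ->
  cC a - (e (w * z))%:P = \prod_(x <- [seq e (w * fib b z) | b : 'rV[F]_n]) ('X - x%:P).
Proof.
move=> ez; set xs := [seq _ | b : _].
have ia0 : iA a != 0 by rewrite iA_eq0.
have iAinj : injective iA.
  by move=> y y' /eqP; rewrite -subr_eq0 -rmorphB iA_eq0 subr_eq0 => /eqP.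
have [sz ld] := carl_size_lead a0.
have szC : size (cC a) = (q ^ n).+1 by rewrite size_map_inj_poly // rmorph0.
have lt : (size (- (e (w * z))%:P) < size (cC a))%N.
  by rewrite size_polyN szC (leq_ltn_trans (size_polyC_leq1 _)) // ltnS expn_gt0 qn0.
have szG : size (cC a - (e (w * z))%:P) = (q ^ n).+1 by rewrite size_polyDl.
have ldG : lead_coef (cC a - (e (w * z))%:P) = 1.
  rewrite lead_coefDl // lead_coef_map_inj ?rmorph0 // ld (monicP am).
  by rewrite /= rmorph1.
have sxs : size xs = (q ^ n)%N by rewrite size_map -cardE card_mx mul1n.
have uxs : uniq xs.
  rewrite map_inj_uniq ?enum_uniq // => b b' /eqP.
  rewrite -subr_eq0 -(eB hp) => /eqP /hw [k].
  rewrite -mulrBr mulrC => /(mulIf (w_neq0 hp hw)).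
  rewrite /fib -mulrBl opprD addrACA subrr add0r -rmorphB => /(canRL (divfK ia0)).
  move=> E'; have E : rVpoly b - rVpoly b' = k * a by apply: iAinj; rewrite rmorphM.
  suff : rVpoly b - rVpoly b' = 0 by move=> /subr0_eq /(can_inj rVpolyK).
  rewrite E; have [->|k0] := eqVneq k 0; first by rewrite mul0r.
  have : (size (rVpoly b - rVpoly b')%R <= n)%N by rewrite -raddfB size_poly.
  rewrite E size_mul // => h; exfalso; move: k0 a0 h; rewrite -!size_poly_gt0.
  exact: size_contra.
rewrite [LHS](@all_roots_prod_XsubC _ _ xs) ?ldG ?scale1r //.
- by rewrite szG sxs.
- apply/allP => _ /mapP [b _ ->]; rewrite rootE hornerD hornerN hornerC (e_carl hp).
  rewrite mulrCA /fib [iA a * _]mulrC divfK // mulrDr (eD hp) mulrC -[e (w * iA _)](_ : 0 = _).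
    by rewrite addr0 [z * w]mulrC subrr.
  by rewrite mulrC (e_iAw hw).
by rewrite uniq_rootsE.
Qed.

Lemma fiber_power_sum z k : e (w * z) != 0 ->
  \sum_b u (fib b z) ^+ k.+1 = u z * iA a * geo (pfps (u z *: cC a)) k.
Proof.
move=> ez; have G0 : (cC a)`_0 = 0 by rewrite coef_map carl_coef0 /= rmorph0.
have G' : (cC a)^`() = (iA a)%:P by rewrite deriv_map (deriv_carl hp) map_polyC.
rewrite /u_param -(power_sum ez G0 G' (fiber_poly ez)) big_map /= -big_enum /=.
by [].
Qed.

Lemma fib_far b0 z b : far b0 z -> far (b0 / aC (iA a)) (fib b z).
Proof.
move=> hz; have k0 : (inK a)^-1 != 0 by rewrite invr_eq0 /inK tofrac_eq0.
have := far_scale k0 (far_shift (inK (rVpoly b)) hz).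
by rewrite fmorphV (naV ha) mulrC [_^-1 * (_ + _)]mulrC.
Qed.

Lemma far_fmul b0 z : far b0 z -> far (aC (iA a) * b0) (iA a * z).
Proof. by apply: far_scale; rewrite // /inK tofrac_eq0. Qed.

Lemma aC_ia_ge1 : 1 <= aC (iA a).
Proof. exact: aC_iA_ge1. Qed.

Lemma aC_rVpoly (b : 'rV[F]_n) : aC (iA (rVpoly b)) <= aC (iA a).
Proof.
have [->|r0] := eqVneq (rVpoly b) 0; first by rewrite rmorph0 na0 // na_ge0.
rewrite !aC_iA // ler_weXn2l //.
have : (size (rVpoly b) <= n)%N by apply: size_poly.
by rewrite /n; lia.
Qed.

Lemma fib_Omega_aff j b z : Omega_aff j z -> Omega_aff (j + n) (fib b z).
Proof.
move=> /Omega_affP [h1 h2]; apply/Omega_affP; split.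
  rewrite /fib naM // naV // ler_pdivrMr ?(lt_le_trans ltr01 aC_ia_ge1) //.
  have h3 := aC_rVpoly b; have h4 := aC_ia_ge1.
  have h5 : 1 <= qR ^+ (j + n) by rewrite exprn_ege1.
  apply: na_leD => //.
    apply: (le_trans h1); apply: (@le_trans _ _ (qR ^+ (j + n))).
      by rewrite ler_weXn2l // leq_addr.
    by rewrite ler_peMr // (le_trans ler01).
  by apply: (le_trans h3); rewrite ler_peMl // (le_trans ler01).
apply: far_le (fib_far b h2).
by rewrite aC_iA // -/n -invfM -exprD.
Qed.

Lemma fmul_Omega_aff j z : Omega_aff j z -> Omega_aff (j + n) (iA a * z).
Proof.
move=> /Omega_affP [h1 h2]; apply/Omega_affP; split.
  by rewrite naM // aC_iA // -/n exprD mulrC ler_wpM2r ?exprn_ge0 ?(ltW q0).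
apply: far_le (far_fmul h2); rewrite -[leLHS]mul1r.
apply: ler_pM; rewrite ?invr_ge0 ?exprn_ge0 ?aC_ia_ge1 ?(ltW q0) //.
by rewrite lef_pV2 ?posrE ?exprn_gt0 // ler_weXn2l // leq_addr.
Qed.
End Fiber.

Section HeckeSeries.
Variable P : A.
Hypotheses (Pm : P \is monic) (Pirr : irreducible_poly P).
Let d := (size P).-1.
Let P0 : P != 0 := monic_neq0 Pm.
Let d0 : (0 < d)%N.
Proof. by case: Pirr => h _; rewrite /d -ltnS prednK // ltnW. Qed.
Let iP0 : iA P != 0.
Proof. by rewrite iA_eq0. Qed.

(** The expansion of the sum of f over the fibre. By [fiber_power_sum] the sum of the (i+1)-st
    powers of u over the fibre is P times the sum over j of u^(j+1) (C_P^j)_i. The constant term of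
    [c] contributes q^d c_0 = 0. *)
Definition Uop (c : fps K) : fps K := fun N => if N is M.+1 then
  inK P * \sum_(i < size (carl P ^+ M)) c i.+1 * inK (carl P ^+ M)`_i else 0.
Definition Vop (c : fps K) : fps K := compo c (fps_map (@inK F) (UC P)).
Definition heckeS (k : nat) (c : fps K) : fps K := fpsC (inK P ^+ k) * Vop c + Uop c.

Lemma ux_V f c : ux w f (fps_map iC c) -> ux w (fun z => f (iA P * z)) (fps_map iC (Vop c)).
Proof.
move=> uf; have [s s0 cs] := u_expansion_null hp hw ((uxP w _ _).2 uf).
have [b b0 h] := uf.
(* [B^-1] is at most [s], where [c] converges, and at most q^-1, where the coefficients of [UC P]
   are under control. *)
pose B := Num.max qR s^-1; have qB : qR <= B by rewrite le_max lexx.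
have B0 : 0 < B by apply: lt_le_trans qB.
have B1 : 1 <= B by apply: le_trans qB.
have Bs : B^-1 <= s by rewrite invf_ple ?posrE // le_max lexx orbT.
have Bi0 : 0 < B^-1 by rewrite invr_gt0.
have U0 : fps_map iA (UC P) 0%N = 0.
  by rewrite fps_mapE UC_lt ?rmorph0 // expn_gt0 qn0.
have q1s : aC (iA P) >= 1 by apply: aC_iA_ge1.
pose rho := B^-1 / 2; have rho0 : 0 < rho by rewrite divr_gt0.
have rhoB : rho < B^-1 by rewrite /rho ltr_pdivrMr // ltr_pMr // ltr1n.
have [b' b'0 hb'] := far_u hp hw rho0.
exists (Num.max b b'); first by rewrite lt_max b0.
move=> z hz; have fb : far b z by apply: far_le hz; rewrite le_max lexx.
have fb' : far b' z by apply: far_le hz; rewrite le_max lexx orbT.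
have uB : aC (u z) < B^-1 by apply: le_lt_trans rhoB; apply: hb'.
have uq : aC (u z) < qR^-1 by apply: lt_le_trans uB _; rewrite lef_pV2 ?posrE.
have ez := e_wz_neq0 hp hw (far_Omega b0 fb).
rewrite /Vop fps_map_compo.
have -> : fps_map iC (fps_map (@inK F) (UC P)) = fps_map iA (UC P) by [].
apply: (compo_ev (t := B^-1) (D := B^-1 ^+ (q ^ (size P).-1)) Bi0 _ U0 _ _ uB).
- by rewrite exprn_ge0 // ltW.
- apply: (@rnull_le _ _ _ (fun n => aC (iC (c n)) * s ^+ n)) => // n.
  apply: ler_wpM2l; rewrite ?(na_ge0 ha) //.
  apply: lerXn2r; rewrite ?nnegrE ?exprn_ge0 ?(ltW Bi0) ?(ltW s0) //.
  apply: le_trans Bs; rewrite -[leRHS]expr1; apply: ler_wiXn2l; rewrite ?(ltW Bi0) ?invf_le1 //.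
  by rewrite expn_gt0 qn0.
- exact: UC_bound.
- exact: (ev_UC_u hp P0 ez uq).
by apply: h; apply: far_le (far_fmul Pm fb); rewrite ler_peMl // ltW.
Qed.

Definition Uf (f : C -> C) (z : C) : C := \sum_b f (@fib P b z).

Lemma ux_U f c : ux w f (fps_map iC c) -> ux w (Uf f) (fps_map iC (Uop c)).
Proof.
move=> uf; have [s s0 cs] := u_expansion_null hp hw ((uxP w _ _).2 uf).
have [b b0 h] := uf.
pose B := Num.max qR s^-1; have qB : qR <= B by rewrite le_max lexx.
have B0 : 0 < B by apply: lt_le_trans qB.
have B1 : 1 <= B by apply: le_trans qB.
have Bs : B^-1 <= s by rewrite invf_ple ?posrE // le_max lexx orbT.
have Bi0 : 0 < B^-1 by rewrite invr_gt0.
set Q := (q ^ (size P).-1)%N.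
pose rho := B ^- Q / 2; have BQ0 : 0 < B ^- Q by rewrite invr_gt0 exprn_gt0.
have rho0 : 0 < rho by rewrite divr_gt0.
have rhoB : rho < B ^- Q by rewrite /rho ltr_pdivrMr // ltr_pMr // ltr1n.
have [b' b'0 hb'] := far_u hp hw rho0.
have aP1 : 1 <= aC (iA P) by apply: aC_iA_ge1.
have aP0 : 0 < aC (iA P) by apply: lt_le_trans aP1.
exists (Num.max (b * aC (iA P)) b'); first by rewrite lt_max b'0 orbT.
move=> z hz; have fb : far (b * aC (iA P)) z by apply: far_le hz; rewrite le_max lexx.
have fb' : far b' z by apply: far_le hz; rewrite le_max lexx orbT.
have uB : aC (u z) < B ^- Q by apply: le_lt_trans rhoB; apply: hb'.
have ez := e_wz_neq0 hp hw (far_Omega b'0 fb').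
have fibE t : ev aC (fps_map iC c) (u (@fib P t z)) (f (@fib P t z)).
  by apply: h; have := fib_far Pm t fb; rewrite mulfK // gt_eqF.
pose G := cC P; pose Gj j i := (G ^+ j)`_i.
have GjE j i : Gj j i = iA (carl P ^+ j)`_i by rewrite /Gj /G -rmorphXn coef_map.
have Gj0 j i : (i < j)%N -> Gj j i = 0.
  have pG0 : pfps G 0%N = 0 by rewrite /pfps /G coef_map carl_coef0 /= rmorph0.
  by move=> ij; rewrite /Gj -/(pfps (G ^+ j) i) rmorphXn; apply: fps_exp_lt'.
have Gjb j i : aC (Gj j i) <= (B ^+ Q) ^+ j * B^-1 ^+ i.
  have := cboundX j (ltW B0) (exprn_ge0 Q (ltW B0)) (carl_bound C P qB) i.
  by rewrite -rmorphXn /= -ler_pdivlMr ?exprn_gt0 // exprVn.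
pose X (p0 : nat * nat) := iC (c p0.1.+1) * (iA P * (u z ^+ p0.2.+1 * Gj p0.2 p0.1)).
have Xn : null aC X.
  pose k := aC (iA P) * aC (u z) / s.
  apply: (null_le (b := fun p0 => k * ((aC (iC (c p0.1.+1)) * s ^+ p0.1.+1) * (B ^+ Q * aC (u z)) ^+ p0.2))).
    move=> [i j]; rewrite /X /= !(naM ha) (naX ha).
    have -> : k * (aC (iC (c i.+1)) * s ^+ i.+1 * (B ^+ Q * aC (u z)) ^+ j) =
      aC (iC (c i.+1)) * (aC (iA P) * (aC (u z) ^+ j.+1 * ((B ^+ Q) ^+ j * s ^+ i))).
      rewrite /k exprMn [s ^+ i.+1]exprS [aC (u z) ^+ j.+1]exprS.
      have s0' : s != 0 by rewrite gt_eqF.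
      by rewrite -[RHS]mul1r -(mulVf s0'); rring R.
    apply: ler_wpM2l; rewrite ?(na_ge0 ha) //; apply: ler_wpM2l; rewrite ?(na_ge0 ha) //.
    apply: ler_wpM2l; rewrite ?exprn_ge0 ?(na_ge0 ha) //; apply: (le_trans (Gjb j i)).
    apply: ler_wpM2l; rewrite ?exprn_ge0 ?(ltW B0) //.
    by apply: lerXn2r; rewrite ?nnegrE ?(ltW Bi0) ?(ltW s0).
  apply: rnull_scale; first by rewrite !mulr_ge0 ?(na_ge0 ha) // invr_ge0 ltW.
  apply: (rnullM (b := fun i => aC (iC (c i.+1)) * s ^+ i.+1) (c := fun j => (B ^+ Q * aC (u z)) ^+ j)).
  - by move=> i; rewrite mulr_ge0 ?exprn_ge0 ?(na_ge0 ha) // ltW.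
  - by move=> j; rewrite exprn_ge0 // mulr_ge0 ?exprn_ge0 ?(na_ge0 ha) // ltW.
  - exact: (rnull_comp succn_inj cs).
  apply: rnull_geom; rewrite mulr_ge0 ?exprn_ge0 ?(na_ge0 ha) ?(ltW B0) //=.
  by move: uB; rewrite -[B ^- Q]mul1r ltr_pdivlMr ?exprn_gt0 // mulrC.
pose r i := iC (c i.+1) * \sum_t u (@fib P t z) ^+ i.+1.
have hr i : hsum aC (fun j => X (i, j)) (r i).
  rewrite /r (fiber_power_sum Pm) // /geo !mulr_sumr.
  rewrite (_ : \sum_(j < i.+1) _ = \sum_(j <- iota 0 i.+1) X (i, j)).
    apply: hsum_fin => //; first exact: iota_uniq.
    by move=> j; rewrite mem_iota add0n /= -leqNgt => ij; rewrite /X /= Gj0 // !mulr0.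
  rewrite -[iota 0 i.+1]/(index_iota 0 i.+1) big_mkord; apply: eq_bigr => j _.
  rewrite -rmorphXn /X /= /Gj /pfps exprZn coefZ exprS -/G -!mulrA; congr (_ * _); exact: mulrCA.
have hS : hsum aC r (Uf f z).
  have h1 : hsum aC (fun n => iC (c n) * \sum_t u (@fib P t z) ^+ n) (Uf f z).
    have : hsum aC (fun n => \sum_t iC (c n) * u (@fib P t z) ^+ n) (Uf f z).
      rewrite /Uf; elim: (index_enum _) => [|t l IH].
        rewrite big_nil; apply: hsum_fin0 => // i; by rewrite big_nil.
      rewrite big_cons; have := hsumD ha (fibE t) IH.
      by apply: eq_hsum => i; rewrite big_cons.
    by apply: eq_hsum => i; rewrite mulr_sumr.
  have [S hS] := null_hsum ha hc (rnull_comp succn_inj (hsum_null ha h1)).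
  have := hsum_recl ha (x := fun n => iC (c n) * \sum_t u (@fib P t z) ^+ n) hS.
  (* The zeroth powers count the q^d points of the fibre, and this number is 0 in C. *)
  have -> : \sum_t u (@fib P t z) ^+ 0 = 0.
    rewrite sumr_const card_mx mul1n -mulr_natl mulr1 natrX.
    have -> : q%:R = 0 :> C by rewrite -(rmorph_nat iA) (card_A0 hp) rmorph0.
    have d0' : (0 < (size P).-1)%N := d0.
    by rewrite expr0n; case: (size P).-1 d0'.
  by rewrite mulr0 add0r => /(hsum_uniq ha h1) ->.
apply/(@hsum_reindex _ _ _ _ _ succn) => //; first exact: succn_inj.
  by case=> [|n]; [rewrite fps_mapE /Uop rmorph0 mul0r eqxx|exists n].
apply: (hsum_exchange ha hc Xn hr) hS => j /=.
rewrite (_ : fps_map iC (Uop c) j.+1 * u z ^+ j.+1 = \sum_(i <- iota 0 (size (carl P ^+ j))) X (i, j)).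
  apply: hsum_fin => //; first exact: iota_uniq.
  move=> i; rewrite mem_iota add0n /= -leqNgt => si.
  by rewrite /X /= GjE nth_default // rmorph0 !mulr0.
have -> : iota 0 (size (carl P ^+ j)) = index_iota 0 (size (carl P ^+ j)).
  by rewrite /index_iota subn0.
rewrite big_mkord fps_mapE /Uop rmorphM rmorph_sum.
rewrite mulr_sumr mulr_suml; apply: eq_bigr => i _.
rewrite /X /= GjE rmorphM -!iAE -!mulrA mulrCA; congr (_ * _); congr (_ * _); exact: mulrC.
Qed.

Definition heckeF (k : nat) (f : C -> C) (z : C) : C := iA P ^+ k * f (iA P * z) + Uf f z.

Lemma ux_hecke k f c : ux w f (fps_map iC c) -> ux w (heckeF k f) (fps_map iC (heckeS k c)).
Proof.
move=> uf; rewrite /heckeS rmorphD rmorphM /= fps_mapC rmorphXn.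
apply: (uxD (f := fun z => iA P ^+ k * f (iA P * z))); last exact: ux_U.
by apply: (uxM (f := fun=> iA P ^+ k)); [exact: uxC|exact: ux_V].
Qed.

Lemma rigid_hecke k f : rigid_analytic f -> rigid_analytic (heckeF k f).
Proof.
move=> hf; apply: rigid_of_on => n; apply: rigid_onD.
  apply: rigid_onM; first exact: rigid_on_const.
  have := @rigid_on_comp R F C n (n + d)%N f (iA P) 0 _ (hf _).
  move=> h; apply: rigid_on_eq (h _) => [z _|z hz]; rewrite addr0 //.
  exact: (fmul_Omega_aff Pm hz).
apply: rigid_on_sum => b _.
have := @rigid_on_comp R F C n (n + d)%N f (iA P)^-1 (iA (rVpoly b) / iA P) _ (hf _).
move=> h; apply: rigid_on_eq (h _) => [z _|z hz].
  by rewrite /fib mulrDl mulrC.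
by have := fib_Omega_aff Pm b hz; rewrite /fib mulrDl mulrC.
Qed.

(** [None] stands for z -> Pz and [Some b] for z -> (z + b)/P; together they are the q^d + 1 cosets
    of the Hecke correspondence. *)
Definition hpt (M : option 'rV[F]_d) (z : C) : C :=
  if M is Some b then @fib P b z else iA P * z.
Definition hden (M : option 'rV[F]_d) : A := if M is Some _ then P else 1.
Definition hvec (M : option 'rV[F]_d) : A * A := if M is Some b then (1, rVpoly b) else (0, 1).

Lemma heckeFE k f z : heckeF k f z =
  \sum_M iA P ^+ k / iA (hden M) ^+ k * f (hpt M z).
Proof.
rewrite big_option /heckeF /Uf /= rmorph1 expr1n divr1; congr (_ + _).
by apply: eq_bigr => b _; rewrite divff ?mul1r // expf_neq0.
Qed.

Definition hrow1 (g : 'M[A]_2) M := (hvec M).1 * g 0 0 + (hvec M).2 * g 1 0.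
Definition hrow2 (g : 'M[A]_2) M := (hvec M).1 * g 0 1 + (hvec M).2 * g 1 1.

(* [M'] represents the coset of [M g]: the bottom row of [M g], reduced modulo
   [P], is proportional to that of [M']. *)
Definition hrel (g : 'M[A]_2) (M M' : option 'rV[F]_d) : bool :=
  if M' is Some b then P %| hrow2 g M - rVpoly b * hrow1 g M else P %| hrow1 g M.

Lemma hrel_ex g M : exists M', hrel g M M'.
Proof.
rewrite /hrel; move: (hrow1 g M) (hrow2 g M) => x y.
have [Px|nPx] := boolP (P %| x); first by exists None.
have cop : coprimep P x.
  rewrite /coprimep; apply: contraNT nPx => s1; have [_ hP] := Pirr.
  by rewrite -(eqp_dvdl _ (hP _ s1 (dvdp_gcdl P x))) dvdp_gcdr.
have /Bezout_eq1_coprimepP [[v v'] /= hv] := cop.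
exists (Some (poly_rV ((y * v') %% P))).
have szm : (size ((y * v') %% P)%R <= d)%N.
  by rewrite -ltnS /d prednK ?size_poly_gt0 // ltn_modp.
rewrite poly_rV_K //.
have -> : y - (y * v') %% P * x = (y * v + (y * v') %/ P * x) * P.
  have E := divp_eq (y * v') P; set k := _ %/ _ in E *; set m := _ %% _ in E *.
  have -> : m = y * v' - k * P by rewrite E addrC addKr.
  by rewrite -{1}[y]mulr1 -hv; crring AR.
exact: dvdp_mulIr.
Qed.

(** Two rows that are both proportional modulo P to that of [M'] have a determinant divisible by P.
    It equals det g times the determinant of the original labels, whose entries have degree below d,
    so that one vanishes and the labels agree. *)
Lemma hrel_inj g M1 M2 M' : g \in unitmx -> hrel g M1 M' -> hrel g M2 M' -> M1 = M2.
Proof.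
move=> gu; have [k k0 dk] := det_unit gu; have dg := det2 g; rewrite dk in dg.
rewrite /hrel => h1 h2; set x1 := hrow1 g M1 in h1 *; set y1 := hrow2 g M1 in h1 *.
set x2 := hrow1 g M2 in h2 *; set y2 := hrow2 g M2 in h2 *.
have : P %| x1 * y2 - x2 * y1.
  case: M' h1 h2 => [b|] h1 h2; last by rewrite dvdp_sub // dvdp_mulr.
  have -> : x1 * y2 - x2 * y1 = x1 * (y2 - rVpoly b * x2) - x2 * (y1 - rVpoly b * x1).
    by crring AR.
  by rewrite dvdp_sub // dvdp_mull.
have -> : x1 * y2 - x2 * y1 = k%:P * ((hvec M1).1 * (hvec M2).2 - (hvec M2).1 * (hvec M1).2).
  by rewrite dg /x1 /x2 /y1 /y2 /hrow1 /hrow2; crring AR.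
rewrite mul_polyC dvdpZr // => dv.
have small (f1 : A) : (size f1 <= d)%N -> P %| f1 -> f1 = 0.
  move=> sf df; apply/eqP; apply: contraTT df => f0; apply/negP => /dvdp_leq -/(_ f0).
  by move=> /leq_trans /(_ sf); rewrite leqNgt /d ltn_predL size_poly_gt0 P0.
have d1 : (1 <= d)%N := d0.
case: M1 M2 {x1 y1 x2 y2 h1 h2} dv => [b1|] [b2|] //=.
- rewrite !mul1r => /small -/(_ _) h; congr Some; apply: (can_inj rVpolyK).
  apply/esym/subr0_eq; apply: h; by rewrite -raddfB size_poly.
- by rewrite mul1r mul0r subr0 => /small; rewrite size_poly1 => /(_ d1)/eqP; rewrite oner_eq0.
- rewrite mul0r mul1r sub0r dvdpNr => /small; rewrite size_poly1 => /(_ d1)/eqP.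
  by rewrite oner_eq0.
Qed.

Definition mx2 (a b c e : A) : 'M[A]_2 := \matrix_(i, j)
  if i == 0 then (if j == 0 then a else b) else (if j == 0 then c else e).

Lemma mx2E a b c e : (mx2 a b c e 0 0 = a) * (mx2 a b c e 0 1 = b) *
  (mx2 a b c e 1 0 = c) * (mx2 a b c e 1 1 = e).
Proof. by rewrite /mx2 !mxE. Qed.

Lemma mx2_unit (g : 'M[A]_2) a b c e : g \in unitmx -> a * e - b * c = \det g -> 
  mx2 a b c e \in unitmx /\ \det (mx2 a b c e) = \det g.
Proof.
move=> gu h; have E : \det (mx2 a b c e) = \det g by rewrite det2 !mx2E.
by rewrite unitmxE E -unitmxE.
Qed.

(** In each of the four cases [g'] is the matrix M g M'^-1; its only entry that might fail to be
    integral is built from the quotient [t] of the divisibility [hrel]. *)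
Lemma hrel_coset g M M' : g \in unitmx -> hrel g M M' ->
  exists2 g' : 'M[A]_2, g' \in unitmx /\ \det g' = \det g &
    forall z : C, Omega z -> hpt M (mob g z) = mob g' (hpt M' z) /\
      iA (hden M') * jfac g' (hpt M' z) = iA (hden M) * jfac g z.
Proof.
move=> gu; have dg := det2 g.
have cross (n1 d1 n2 d2 : C) : d1 != 0 -> d2 != 0 -> n1 * d2 = n2 * d1 -> n1 / d1 = n2 / d2.
  by move=> h1 h2 h; apply/eqP; rewrite eqr_div // h.
have fibP (b : 'rV[F]_d) z : iA P * @fib P b z = z + iA (rVpoly b).
  by rewrite /fib mulrC divfK.
pose a := g 0 0; pose b := g 0 1; pose c := g 1 0; pose e' := g 1 1.
rewrite /hrel /hrow1 /hrow2 -/a -/b -/c -/e' in dg *.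
have PJ z : Omega z -> iA P * jfac g z != 0 by move=> hz; rewrite mulf_neq0 // jfac_neq0.
have XM (m : 'rV[F]_d) z : Omega z -> @fib P m (mob g z) =
    (iA a * z + iA b + iA (rVpoly m) * jfac g z) / (iA P * jfac g z).
  move=> hz; have J0 := jfac_neq0 gu hz.
  rewrite [iA P * _]mulrC invfM mulrA; congr (_ / _).
  by rewrite [in RHS]mulrDl mulfK.
case: M => [m|]; case: M' => [m'|] /=; rewrite ?mul0r ?mul1r ?add0r => /dvdpP [t ht].
- have yE : b + rVpoly m * e' = rVpoly m' * (a + rVpoly m * c) + t * P.
    by rewrite -ht subrKC.
  have dE : (a + rVpoly m * c) * (e' - rVpoly m' * c) - t * (P * c) = \det g.
    transitivity ((a + rVpoly m * c) * e' - c * (rVpoly m' * (a + rVpoly m * c) + t * P)).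
      by crring AR.
    by rewrite -yE dg; crring AR.
  have [gu' dg'] := mx2_unit gu dE; exists (mx2 (a + rVpoly m * c) t (P * c) (e' - rVpoly m' * c)) => // z hz.
  have JE : jfac (mx2 (a + rVpoly m * c) t (P * c) (e' - rVpoly m' * c)) (@fib P m' z) = jfac g z.
    rewrite /jfac !mx2E -/c -/e' rmorphB !rmorphM /=.
    transitivity (iA c * (iA P * @fib P m' z) + (iA e' - iA (rVpoly m') * iA c)).
      by rring C.
    by rewrite fibP; rring C.
  rewrite JE; split=> //; rewrite XM // /mob JE !mx2E; apply: cross; rewrite ?PJ ?jfac_neq0 //.
  have := congr1 iA yE; rewrite !(rmorphD, rmorphM) /= => yC.
  transitivity (((iA a + iA (rVpoly m) * iA c) * (iA P * @fib P m' z) + iA t * iA P) * jfac g z).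
    rewrite fibP; congr (_ * _); rewrite /jfac -/c -/e'.
    transitivity (iA a * z + (iA b + iA (rVpoly m) * iA e') + iA (rVpoly m) * iA c * z); first by rring C.
    by rewrite yC; rring C.
  by rring C.
- have dE : t * (P * e') - (b + rVpoly m * e') * c = \det g.
    transitivity ((t * P) * e' - (b + rVpoly m * e') * c); first by crring AR.
    by rewrite -ht dg; crring AR.
  have [gu' dg'] := mx2_unit gu dE; exists (mx2 t (b + rVpoly m * e') c (P * e')) => // z hz.
  have JE : jfac (mx2 t (b + rVpoly m * e') c (P * e')) (iA P * z) = iA P * jfac g z.
    by rewrite /jfac !mx2E -/c -/e' rmorphM /=; rring C.
  rewrite JE rmorph1 mul1r; split=> //.
  rewrite XM // /mob JE !mx2E; congr (_ / _).
  have := congr1 iA ht; rewrite !(rmorphD, rmorphM) /= => htC.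
  by rewrite mulrA -htC /jfac -/c -/e'; rring C.
- have eE : e' = rVpoly m' * c + t * P by rewrite -ht subrKC.
  have dE : P * a * t - (b - rVpoly m' * a) * c = \det g.
    by rewrite dg eE; crring AR.
  have [gu' dg'] := mx2_unit gu dE; exists (mx2 (P * a) (b - rVpoly m' * a) c t) => // z hz.
  have := congr1 iA eE; rewrite !(rmorphD, rmorphM) /= => eC.
  have JE : iA P * jfac (mx2 (P * a) (b - rVpoly m' * a) c t) (@fib P m' z) = iA 1 * jfac g z.
    rewrite /jfac !mx2E -/c -/e' eC rmorph1 mul1r.
    transitivity (iA c * (iA P * @fib P m' z) + iA P * iA t); first by rring C.
    by rewrite fibP; rring C.
  split=> //; have J0 := jfac_neq0 gu hz.
  have J'0 : jfac (mx2 (P * a) (b - rVpoly m' * a) c t) (@fib P m' z) != 0.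
    by apply: contraNneq J0 => E; move: JE; rewrite E mulr0 rmorph1 mul1r => <-.
  rewrite /mob mulrA; apply: cross => //; rewrite mulrAC JE rmorph1 mul1r mulrC; congr (_ * _).
  rewrite !mx2E -/a -/b rmorphB !rmorphM /=.
  transitivity (iA a * z + iA b); first by rring C.
  transitivity (iA a * (iA P * @fib P m' z) + (iA b - iA (rVpoly m') * iA a)); last by rring C.
  by rewrite fibP; rring C.
have dE : a * e' - P * b * t = \det g.
  by rewrite dg ht; crring AR.
have [gu' dg'] := mx2_unit gu dE; exists (mx2 a (P * b) t e') => // z hz.
have := congr1 iA ht; rewrite !(rmorphD, rmorphM) /= => tC.
have JE : jfac (mx2 a (P * b) t e') (iA P * z) = jfac g z.
  by rewrite /jfac !mx2E -/c -/e' tC; rring C.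
rewrite JE; split=> //; rewrite {2}/mob JE !mx2E /mob -/a -/b mulrA; congr (_ / _).
by rewrite rmorphM /=; rring C.
Qed.

(** [g] permutes the cosets: the map [s] is injective on a finite set, hence reindexes the sum, and
    [hrel_coset] compares the terms. *)
Lemma modular_hecke f (k : nat) (m : Zmod q.-1) :
  modular_function (C := C) k m f -> modular_function (C := C) k m (heckeF k f).
Proof.
move=> hf g z gu hz e'; rewrite {}/e'.
rewrite -!iAE -[iA (g 1 0) * z + _]/(jfac g z) -[(_ + _) / jfac g z]/(mob g z) -exprnP.
have /choice [s hs] := hrel_ex g.
have sinj : injective s by move=> M1 M2 E; apply: (hrel_inj gu (hs M1)); rewrite E; exact: hs.
rewrite !heckeFE [in RHS](reindex_inj sinj) mulr_sumr; apply: eq_bigr => M _.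
have [g' [gu' dg'] h] := hrel_coset gu (hs M); have [h1 h2] := h z hz.
have hO : Omega (hpt (s M) z).
  have [n hn] := Omega_ex hz; case: (s M) => [b|] /=; apply: (@Omega_aff_Omega _ _ _ (n + d)).
    exact: (fib_Omega_aff Pm b hn).
  exact: (fmul_Omega_aff Pm hn).
rewrite h1 (hf g' _ gu' hO) -!iAE -/(jfac g' (hpt (s M) z)) dg' -exprnP.
have hd0 M0 : iA (hden M0) != 0 by case: M0 => [b|] /=; rewrite ?rmorph1 ?oner_neq0.
have -> : jfac g z ^+ k = iA (hden (s M)) ^+ k * jfac g' (hpt (s M) z) ^+ k / iA (hden M) ^+ k.
  by rewrite -exprMn h2 exprMn mulrAC divff ?mul1r // expf_neq0.
move: (f _) (jfac g' _ ^+ k) (iA (\det g) ^- m) => v1 v2 v3.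
have e1 : iA (hden (s M)) ^+ k != 0 by rewrite expf_neq0.
rewrite -[LHS]mul1r -(divff e1); rring C.
Qed.

Lemma MS_hecke k m (c : fps K) : modular_series w (Posz k) m c ->
  modular_series w (Posz k) m (heckeS k c).
Proof.
move=> /(MS_elim (w := w)) [f [h1 h2 h3]]; apply: (@MS_intro _ _ _ w (heckeF k f)).
- exact: rigid_hecke.
- exact: modular_hecke.
exact: ux_hecke.
Qed.
End HeckeSeries.
End Hecke.

(** * Eisenstein series *)

Section PolyFinite.
Variables (R : realType) (F : finFieldType).
Notation A := {poly F}.
Notation q := #|F|.
Notation qR := (#|F|%:R : R).

Definition small_polys (n : nat) : seq A := [seq rVpoly v | v : 'rV[F]_n].

Lemma mem_small_polys n (b : A) : (b \in small_polys n) = (size b <= n)%N.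
Proof.
apply/mapP/idP => [[v _ ->]|h]; first exact: size_poly.
by exists (poly_rV b); rewrite ?mem_enum // poly_rV_K.
Qed.

Lemma uniq_small_polys n : uniq (small_polys n).
Proof. by rewrite map_inj_uniq ?enum_uniq //; apply: can_inj (@rVpolyK _ _). Qed.

Lemma rnull_size : rnull (fun b : A => qR ^- size b).
Proof.
move=> e e0; have q1 := qR_gt1 R F; have q0 := qR_gt0 R F.
have [N hN] := q_archi F e^-1.
exists (small_polys N.+1) => b; rewrite mem_small_polys -ltnNge => Nb.
rewrite invf_plt ?posrE ?exprn_gt0 //; apply: le_lt_trans hN _.
by rewrite ltr_eXn2l // ltnW.
Qed.
End PolyFinite.

Section Eisenstein.
Variables (R : realType) (F : finFieldType) (C : Cinfty R F) (p : nat).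
Hypothesis hp : p \in [pchar F].
Notation A := {poly F}.
Notation K := {fraction {poly F}}.
Notation aC := (@absC R F C).
Notation iC := (@KtoC R F C).
Notation iA := (@iA R F C).
Notation q := #|F|.
Notation qR := (#|F|%:R : R).
Notation e := (@carlitz_exp R F C).
Add Ring Cring13 : (rT_ring C).
Let AR : comNzRingType := {poly F}.
Add Ring Aring13 : (rT_ring AR).
Let ha := absC_nonarch C.
Let hc := @absC_complete R F C.
Let q1 : 1 < qR := qR_gt1 R F.
Let q0 : 0 < qR := qR_gt0 R F.
Let qge1 : 1 <= qR := qR_ge1 R F.
Let qn1 : (1 < q)%N := card_finField_gt1 F.
Let qn0 : (0 < q)%N := ltnW qn1.
Hint Resolve q1 q0 qge1 qn1 qn0 : core.
Variable (w : C).
Hypothesis hw : carlitz_period w.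
Notation u := (@u_param R F C w).

Lemma aC_iA_sizeV (b : A) : b != 0 -> (aC (iA b))^-1 = qR * qR ^- size b.
Proof.
move=> b0; rewrite aC_iA //; have sb : size b = (size b).-1.+1 by rewrite prednK // size_poly_gt0.
by rewrite [in RHS]sb exprS invfM mulVKf // gt_eqF.
Qed.

Lemma e_sub_sq x : aC x <= 1 -> aC (e x - x) <= aC x ^+ 2.
Proof.
move=> x1; have B0 : 0 <= aC x ^+ 2 by rewrite exprn_ge0 ?(na_ge0 ha).
have [S hS] := null_hsum ha hc (rnull_comp succn_inj (eterm_null x)).
have := hsum_recl ha hS; rewrite /eterm expn0 expr1 rmorph1 divr1 => h.
rewrite (hsum_uniq ha (e_hsum x) h) addrC addKr.
apply: (hsum_le ha B0 _ hS) => i /=; rewrite aC_eterm.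
apply: (@le_trans _ _ (aC x ^+ (q ^ i.+1))).
  apply: lerXn2r; rewrite ?nnegrE ?divr_ge0 ?(na_ge0 ha) ?exprn_ge0 ?(ltW q0) //.
  by rewrite ler_pdivrMr ?exprn_gt0 // ler_peMr ?(na_ge0 ha) // exprn_ege1.
apply: ler_wiXn2l; rewrite ?(na_ge0 ha) // expnS.
by apply: leq_trans qn1 _; rewrite leq_pmulr // expn_gt0 qn0.
Qed.

Lemma aC_add_poly (z : C) (b : A) : aC z < aC (iA b) -> aC (z + iA b) = aC (iA b).
Proof. exact: na_addr. Qed.

Lemma null_inv_add z j : (forall b, z + iA b != 0) -> (0 < j)%N ->
  null aC (fun b : A => (z + iA b) ^- j).
Proof.
move=> hz j0 t t0.
have [n hn] := q_archi F (aC z + 1).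
have [N hN] := q_archi F t^-1.
exists (small_polys F (maxn n N).+1) => b; rewrite mem_small_polys -ltnNge => nb.
have b0 : b != 0 by rewrite -size_poly_gt0 (leq_trans _ nb).
have ab : qR ^+ (maxn n N).+1 <= aC (iA b).
  by rewrite aC_iA // ler_weXn2l // -ltnS prednK // size_poly_gt0.
have zb : aC z < aC (iA b).
  apply: lt_le_trans ab; apply: (@lt_le_trans _ _ (aC z + 1)); first by rewrite ltrDl.
  by apply: le_trans hn _; rewrite ler_weXn2l // leqW // leq_maxl.
rewrite naV // naX // aC_add_poly //.
have ab1 : 1 <= aC (iA b) by apply: aC_iA_ge1.
have abt : t^-1 < aC (iA b).
  apply: lt_le_trans ab; apply: le_lt_trans hN _.
  by rewrite ltr_eXn2l // ltnS leq_maxr.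
rewrite invf_plt ?posrE ?exprn_gt0 ?(lt_le_trans ltr01 ab1) //.
by apply: lt_le_trans abt _; rewrite -[leLHS]expr1 ler_weXn2l.
Qed.

Lemma ez_add z b : e (w * z) != 0 -> z + iA b != 0.
Proof.
apply: contraNneq => /addr0_eq zE; rewrite -[z]opprK zE mulrN (eN hp) mulrC (e_iAw hw).
by rewrite oppr0.
Qed.

Lemma power_sum_small n (a : A) z k : (size a).-1 = n -> a \is monic -> e (w * z) != 0 ->
  \sum_(b <- small_polys F n) u ((z + iA b) / iA a) ^+ k.+1 =
  u z * iA a * geo (pfps (u z *: map_poly iA (carl a))) k.
Proof. by move=> <- am ez; rewrite -(fiber_power_sum hp hw am k ez) big_map big_enum. Qed.

(** With x = w (z + b)/theta^n the comparison is between 1/x and 1/e(x). For |x| <= 1 it follows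
    from e(x) = x + O(x^2). For larger x, both inverses are at most 1, because x is smaller than
    every nonzero period. *)
Lemma inv_near n z (b : A) : aC z < qR ^+ n -> (size b <= n)%N -> e (w * z) != 0 ->
  aC ((z + iA b)^-1 - w / iA 'X^n * u ((z + iA b) / iA 'X^n)) <= aC w / qR ^+ n.
Proof.
move=> zn bn ez; have zb := ez_add b ez; have w0 := w_neq0 hp hw.
have aw1 : 1 <= aC w by apply: le_trans (w_ge hp hw); apply/ltW/rr_gt1.
have ath : aC (iA 'X^n : C) = qR ^+ n by rewrite aC_iA ?monic_neq0 ?monicXn // size_polyXn.
have th0 : (iA 'X^n : C) != 0 by rewrite iA_eq0 monic_neq0 ?monicXn.
have zbn : aC (z + iA b) < qR ^+ n.
  apply: (na_ltD ha) => //; have [->|b0] := eqVneq b 0.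
    by rewrite rmorph0 na0 // exprn_gt0.
  by rewrite aC_iA // ltr_eXn2l // prednK // size_poly_gt0.
set x := w * ((z + iA b) / iA 'X^n).
have x0 : x != 0 by rewrite !mulf_neq0 // invr_eq0.
have xw : aC x < aC w.
  by rewrite naM // gtr_pMr ?na_gt0 // naM // naV // ath ltr_pdivrMr ?exprn_gt0 // mul1r.
have -> : (z + iA b)^-1 = w / iA 'X^n * x^-1.
  by rewrite /x !invfM invrK mulrACA mulfV // mul1r mulrCA mulVf // mulr1.
rewrite /u_param -/x -mulrBr naM // naM // naV // ath -[leRHS]mulr1.
apply: ler_wpM2l; first by rewrite divr_ge0 ?(na_ge0 ha) ?exprn_ge0 // ltW.
have [x1|x1] := leP (aC x) 1.
  have ex : aC (e x) = aC x by apply: (aC_e_small hp); apply: le_trans x1 _; apply/ltW/rr_gt1.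
  have ex0 : e x != 0 by rewrite -(na_gt0 ha) ex na_gt0.
  have -> : x^-1 - (e x)^-1 = (e x - x) / (x * e x).
    apply: (canRL (mulfK _)); first by rewrite mulf_neq0.
    by rewrite mulrBl mulKf // mulrCA mulVf // mulr1.
  rewrite naM // naV // naM // ex -expr2 ler_pdivrMr ?exprn_gt0 ?na_gt0 // mul1r.
  exact: e_sub_sq.
have ex1 : 1 <= aC (e x).
  rewrite leNgt; apply/negP => ex1.
  have [|a ha'] := e_near hp hw (x := x); first by apply: ltW; apply: lt_trans ex1 (rr_gt1 _ _).
  have [a0|a0] := eqVneq a 0.
    by move: ex1; rewrite -ha' a0 rmorph0 mul0r subr0 ltNge (ltW x1).
  have wa : aC w <= aC (iA a * w) by rewrite naM // ler_peMl ?(na_ge0 ha) // aC_iA_ge1.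
  move: ex1; rewrite -ha' -naN // opprB (na_addl ha) ?naN //; last exact: lt_le_trans xw wa.
  by rewrite ltNge (le_trans aw1 wa).
by apply: (na_leB ha); rewrite naV // invf_le1 ?(lt_le_trans ltr01) // ltW.
Qed.

(** The partial fraction expansion of w u(z), obtained without the product formula for [e]:
    [power_sum_small] with a = theta^n is a finite identity for w u(z), and [inv_near] compares it
    term by term with the sum of 1/(z + b) over deg b < n. *)
Lemma sum_inv z : e (w * z) != 0 -> hsum aC (fun b : A => (z + iA b)^-1) (w * u z).
Proof.
move=> ez; have zb b := ez_add b ez.
have nx : null aC (fun b : A => (z + iA b)^-1).
  by have := null_inv_add zb (isT : (0 < 1)%N); apply: rnull_le => b; rewrite expr1.
have [S hS] := null_hsum ha hc nx; suff <- : S = w * u z by [].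
apply: (na_eq_small ha) => t t0.
have [B hB] := hS t t0.
have [n1 hn1] := q_archi F (aC z + 1).
have [n2 hn2] := q_archi F ((aC w + 1) / t).
pose n := maxn (maxn n1 n2) (\max_(b <- B) size b).
have zn : aC z < qR ^+ n.
  apply: (@lt_le_trans _ _ (aC z + 1)); first by rewrite ltrDl.
  by apply: le_trans hn1 _; rewrite ler_weXn2l // /n !leq_max leqnn.
have wt : aC w / qR ^+ n < t.
  rewrite ltr_pdivrMr ?exprn_gt0 // mulrC -ltr_pdivrMr //.
  apply: (@lt_le_trans _ _ ((aC w + 1) / t)); first by rewrite ltr_pM2r ?invr_gt0 // ltrDl.
  by apply: le_trans hn2 _; rewrite ler_weXn2l // /n !leq_max leqnn orbT.
have th0 : (iA 'X^n : C) != 0 by rewrite iA_eq0 monic_neq0 ?monicXn.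
have sumE : w * u z = \sum_(b <- small_polys F n) w / iA 'X^n * u ((z + iA b) / iA 'X^n).
  have := @power_sum_small n 'X^n z 0; rewrite size_polyXn monicXn => /(_ erefl isT ez).
  rewrite /geo big_ord_recl big_ord0 expr0 fps1E /= addr0 mulr1 -mulr_sumr => ->.
  by rewrite [u z * _]mulrC mulrA divfK.
have Bn : {subset B <= small_polys F n}.
  move=> b bB; rewrite mem_small_polys; apply: leq_trans (leq_maxr _ _).
  exact: (@leq_bigmax_seq _ B xpredT (fun b : A => size b) b bB isT).
have h1 := hB _ (uniq_small_polys F n) Bn; rewrite -opprB naN // in h1.
rewrite -(subrK (\sum_(b <- small_polys F n) (z + iA b)^-1) S) -addrA.
apply: (na_ltD ha) => //; rewrite sumE -sumrB; apply: le_lt_trans wt.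
apply: (na_sum_le ha); first by rewrite divr_ge0 ?(na_ge0 ha) ?exprn_ge0 // ltW.
by move=> b; rewrite mem_small_polys => bn _; apply: inv_near.
Qed.

(** Both sides are, up to the same sign and factor, the r-th coefficient of w u(z + t) in t: one by
    [lexp_u], the other by expanding each 1/(z + t + b) in [sum_inv]. *)
Lemma sum_inv_pow z r : Omega z ->
  hsum aC (fun b : A => (z + iA b) ^- r.+1) (w ^+ r.+1 * (map_poly iC (goss F r.+1)).[u z]).
Proof.
move=> hz; have ez := e_wz_neq0 hp hw hz; have zb b := ez_add b ez.
have /choice [S hS] j : exists S, hsum aC (fun b : A => (z + iA b) ^- j.+1) S.
  by apply: (null_hsum ha hc); apply: null_inv_add.
have /OmegaP [b b0 hb] := hz.
pose G r := (map_poly iC (goss F r.+1)).[u z].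
suff E : (fun r => w * ((-w) ^+ r * G r)) = (fun r => (-1) ^+ r * S r) :> fps C.
  have -> : w ^+ r.+1 * G r = S r; last by [].
  apply: (@mulfI _ ((-1) ^+ r)); first by rewrite signr_eq0.
  by have /= <- := congr1 (fun c : fps C => c r) E; rewrite (exprNn w) exprS -!mulrA mulrCA.
apply: (@lexp_uniq _ _ C (fun z => w * u z) z).
  have [d d0 hd] := lexp_u hp hw hz; exists d => // t td.
  have := evZ ha hc w (hd t td); apply: eq_hsum => n; by rewrite fpsCM.
exists b => // t tb.
have zt : Omega (z + t).
  by apply: (far_Omega b0); apply: far_add.
have hsumi := sum_inv (e_wz_neq0 hp hw zt).
have btb (a : A) : b <= aC (z + iA a) by have := hb (- inK a); rewrite rmorphN opprK iAE.
pose x (ij : A * nat) := (z + iA ij.1)^-1 ^+ ij.2.+1 * (- t) ^+ ij.2.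
have nx : null aC x.
  apply: (@null_le _ _ _ _ _ (fun ij : A * nat => aC (z + iA ij.1)^-1 * (aC t / b) ^+ ij.2)).
    move=> [a n]; rewrite /x /= exprS -mulrA naM // ler_wpM2l ?(na_ge0 ha) //.
    rewrite (naM ha) !(naX ha) naN // naV // exprMn mulrC ler_wpM2l ?exprn_ge0 ?(na_ge0 ha) //.
    apply: lerXn2r; rewrite ?nnegrE ?invr_ge0 ?(na_ge0 ha) ?(ltW b0) //.
    by rewrite lef_pV2 ?posrE ?na_gt0.
  apply: (rnullM (b := fun a : A => aC (z + iA a)^-1) (c := fun n => (aC t / b) ^+ n)).
  - by move=> a; apply: na_ge0.
  - by move=> n; rewrite exprn_ge0 // divr_ge0 ?(na_ge0 ha) // ltW.
  - by have := null_inv_add zb (isT : (0 < 1)%N); apply: rnull_le => a; rewrite expr1.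
  - by apply: rnull_geom; rewrite divr_ge0 ?(na_ge0 ha) ?ltW //= ltr_pdivrMr // mul1r.
have h1 (a : A) : hsum aC (fun n => x (a, n)) (z + t + iA a)^-1.
  have := @ev_inv_lin _ _ C (z + iA a) (- t); rewrite naN // opprK addrAC; apply.
  exact: lt_le_trans tb (btb a).
have h2 n : hsum aC (fun a => x (a, n)) (S n * (- t) ^+ n).
  have := hsumZr ha ((- t) ^+ n) (hS n); apply: eq_hsum => a.
  by rewrite /x /= exprVn.
have := hsum_exchange ha hc nx h1 h2 hsumi; apply: eq_hsum => n.
by rewrite (exprNn t) mulrCA mulrA.
Qed.
End Eisenstein.

(** * Zeta values at the infinite place *)

Section Scale.
Variables (S : comNzRingType) (k : S).
Definition fps_scale (c : fps S) : fps S := fun n => k ^+ n * c n.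
Lemma fps_scaleM c d : fps_scale (c * d) = fps_scale c * fps_scale d.
Proof.
apply/funext => n; rewrite /fps_scale !fpsME mulr_sumr; apply: eq_bigr => i _.
by rewrite mulrACA -exprD subnKC // -ltnS.
Qed.
Lemma fps_scale1 : fps_scale 1 = 1.
Proof.
by apply/funext => n; rewrite /fps_scale fps1E; case: n => [|n]; rewrite ?mulr1 ?mulr0.
Qed.
End Scale.

Section ZetaDef.
Variable F : finFieldType.
Notation K := {fraction {poly F}}.
(** The series e_C(x)/x; its inverse x/e_C(x) is the generating series of the Bernoulli-Carlitz
    numbers. *)
Definition carlitz_quot : fps K := fun n => carlitz_series F n.+1.
Definition carlitz_quotV : fps K := geo (1 - carlitz_quot).

Lemma carlitz_quot0 : carlitz_quot 0%N = 1.
Proof.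
have := @carlitz_series_pow F 0; rewrite expn0 /carlitz_quot => ->.
by rewrite /= rmorph1 invr1.
Qed.

Lemma carlitz_quotK : carlitz_quot * carlitz_quotV = 1.
Proof.
have := @geoE _ (1 - carlitz_quot); rewrite subKr; apply.
by rewrite fpsBE fps1E carlitz_quot0 subrr.
Qed.

(** By [sum_invA] this is w^-(k+1) times the sum of b^-(k+1) over the nonzero b in A. It is a
    coefficient of x/e_C(x), hence in K. *)
Definition zetaK (k : nat) : K := (-1) ^+ k * carlitz_quotV k.+1.
End ZetaDef.

Section Zeta.
Variables (R : realType) (F : finFieldType) (C : Cinfty R F) (p : nat).
Hypothesis hp : p \in [pchar F].
Notation A := {poly F}.
Notation K := {fraction {poly F}}.
Notation aC := (@absC R F C).
Notation iC := (@KtoC R F C).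
Notation iA := (@iA R F C).
Notation q := #|F|.
Notation qR := (#|F|%:R : R).
Notation e := (@carlitz_exp R F C).
Let ha := absC_nonarch C.
Let hc := @absC_complete R F C.
Let q1 : 1 < qR := qR_gt1 R F.
Let q0 : 0 < qR := qR_gt0 R F.
Let qge1 : 1 <= qR := qR_ge1 R F.
Hint Resolve q1 q0 qge1 : core.
Variable (w : C).
Hypothesis hw : carlitz_period w.
Notation u := (@u_param R F C w).

Lemma aC_invA_le (b : A) k : aC ((iA b) ^- k.+1) <= qR * qR ^- size b.
Proof.
have [->|b0] := eqVneq b 0.
  by rewrite rmorph0 expr0n invr0 na0 // size_poly0 expr0 invr1 mulr1.
rewrite naV // naX // -(aC_iA_sizeV C) // lef_pV2 ?posrE ?exprn_gt0 ?na_gt0 ?iA_eq0 //.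
by rewrite -[leLHS]expr1 ler_weXn2l // aC_iA_ge1.
Qed.

Lemma null_invA k : null aC (fun b : A => (iA b) ^- k.+1).
Proof.
apply: (@null_le _ _ _ _ _ (fun b : A => qR * qR ^- size b)) => [b|].
  exact: aC_invA_le.
by apply: rnull_scale; [exact: ltW|exact: rnull_size].
Qed.

Lemma zeta_local (T : nat -> C) z : (forall k, hsum aC (fun b : A => (iA b) ^- k.+1) (T k)) ->
  z != 0 -> aC (w * z) < 1 ->
  ev aC (fun n => (-1) ^+ n * T n) z (w * u z - z^-1).
Proof.
move=> hT z0 wz1; have w0 := w_neq0 hp hw.
have aw1 : 1 <= aC w by apply: le_trans (w_ge hp hw); apply/ltW/rr_gt1.
have ez : e (w * z) != 0.
  rewrite -(na_gt0 ha) (aC_e_small hp) ?na_gt0 ?mulf_neq0 //.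
  by apply: ltW; apply: lt_trans wz1 (rr_gt1 _ _).
have z1 : aC z < 1 by apply: le_lt_trans wz1; rewrite naM // ler_peMl ?(na_ge0 ha).
pose x (ij : A * nat) := (iA ij.1)^-1 ^+ ij.2.+1 * (- z) ^+ ij.2.
have nx : null aC x.
  apply: (@null_le _ _ _ _ _ (fun ij : A * nat => (qR * qR ^- size ij.1) * (aC z) ^+ ij.2)).
    move=> [a n]; rewrite /x /= naM // !(naX ha) naN // ler_wpM2r ?exprn_ge0 ?(na_ge0 ha) //.
    by rewrite -(naX ha) exprVn aC_invA_le.
  apply: (rnullM (b := fun a : A => qR * qR ^- size a) (c := fun n => (aC z) ^+ n)).
  - by move=> a; rewrite mulr_ge0 ?invr_ge0 ?exprn_ge0 ?ltW.
  - by move=> n; rewrite exprn_ge0 // (na_ge0 ha).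
  - by apply: rnull_scale; [exact: ltW|exact: rnull_size].
  - by apply: rnull_geom; rewrite (na_ge0 ha).
pose y (b : A) := (z + iA b)^-1 - (if b == 0 then z^-1 else 0).
have h0 : hsum aC y (w * u z - z^-1).
  apply: (hsumB ha (sum_inv hp hw ez)).
  have := @hsum_fin _ _ _ ha _ (fun b : A => if b == 0 then z^-1 else 0) [:: 0] isT.
  by rewrite big_seq1 eqxx; apply => b; rewrite inE => /negPf ->.
have h1 (a : A) : hsum aC (fun n => x (a, n)) (y a).
  have [->|a0] := eqVneq a 0.
    rewrite /y eqxx rmorph0 addr0 subrr; apply: hsum_fin0 => // n.
    by rewrite /x /= rmorph0 invr0 expr0n mul0r.
  rewrite /y (negPf a0) subr0; have := @ev_inv_lin _ _ C (iA a) (- z).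
  rewrite naN // opprK addrC; apply; apply: lt_le_trans z1 _; exact: aC_iA_ge1.
have h2 n : hsum aC (fun a => x (a, n)) (T n * (- z) ^+ n).
  have := hsumZr ha ((- z) ^+ n) (hT n); apply: eq_hsum => a.
  by rewrite /x /= exprVn.
have := hsum_exchange ha hc nx h1 h2 h0; apply: eq_hsum => n.
by rewrite (exprNn z) mulrCA mulrA.
Qed.

(** The term b = 0 vanishes, as the inverse of 0 is 0. Near 0, [zeta_local] says that wz/e(wz) is 1
    plus z times the signed generating series of the sums [T]; comparing with x/e_C(x) by uniqueness
    of power series gives the values. *)
Lemma sum_invA k : hsum aC (fun b : A => (iA b) ^- k.+1) (w ^+ k.+1 * iC (zetaK F k)).
Proof.
have /choice [T hT] j : exists S, hsum aC (fun b : A => (iA b) ^- j.+1) S.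
  by apply: (null_hsum ha hc); apply: null_invA.
suff -> : w ^+ k.+1 * iC (zetaK F k) = T k by exact: hT.
have w0 := w_neq0 hp hw.
have aw1 : 1 <= aC w by apply: le_trans (w_ge hp hw); apply/ltW/rr_gt1.
pose T' : fps C := fun n => (-1) ^+ n * T n.
pose c1 : fps C := fps_scale w (fps_map iC (carlitz_series F)).
pose E1 : fps C := fps_scale w (fps_map iC (carlitz_quot F)).
have c1E : c1 = fpsX C * (fpsC w * E1).
  apply/funext => -[|n]; first by rewrite fpsXM0 /c1 /fps_scale fps_mapE carlitz_series0 rmorph0 mulr0.
  by rewrite fpsXM fpsCM /c1 /E1 /fps_scale mulrA -exprS.
have [n hn] := q_archi F (aC w + 1).
have loc z : z != 0 -> aC z <= aC (tdisc C n) -> ev aC (c1 * (1 + fpsX C * T') - fpsX C * fpsC w) z 0.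
  rewrite aC_tdisc => z0 zn; have wz : aC (w * z) < 1.
    rewrite naM //; apply: (@le_lt_trans _ _ (aC w * qR ^- n.+1)); first by rewrite ler_wpM2l ?(na_ge0 ha).
    rewrite ltr_pdivrMr ?exprn_gt0 // mul1r; apply: (@lt_le_trans _ _ (aC w + 1)); first by rewrite ltrDl.
    by apply: le_trans hn _; rewrite ler_weXn2l.
  have ez : e (w * z) != 0.
    rewrite -(na_gt0 ha) (aC_e_small hp) ?na_gt0 ?mulf_neq0 //.
    by apply: ltW; apply: lt_trans wz (rr_gt1 _ _).
  have h1 : ev aC c1 z (e (w * z)).
    have := ev_cs (w * z); apply: eq_hsum => j.
    by rewrite /c1 /fps_scale exprMn mulrA [_ * w ^+ _]mulrC.
  have h2 := evM ha hc (evX ha z) (zeta_local hT z0 wz).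
  have h3 := evB ha (evM ha hc h1 (evD ha (ev1 ha z) h2)) (evM ha hc (evX ha z) (evC ha w z)).
  have E : e (w * z) * (1 + z * (w * u z - z^-1)) - z * w = 0.
    rewrite mulrBr mulfV // (addrC 1) subrK /u_param.
    by rewrite [z * (_ * _)]mulrA mulrCA mulfV // mulr1 subrr.
  by rewrite E in h3.
have E0 : c1 * (1 + fpsX C * T') - fpsX C * fpsC w = 0.
  have iX0 : (iA 'X : C) != 0 by rewrite iA_eq0 polyX_eq0.
  have aX : aC (iA 'X : C) = qR by rewrite aC_iA ?polyX_eq0 // size_polyX expr1.
  have eX : 0 < aC (iA 'X)^-1 < 1 by rewrite naV // aX invr_gt0 q0 invf_lt1.
  have eX0 : (iA 'X : C)^-1 != 0 by rewrite invr_eq0.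
  apply: (pseries_uniq ha (tdisc_neq0 C n) eX eX0) => j; apply: loc.
    by rewrite mulf_neq0 ?tdisc_neq0 ?expf_neq0.
  rewrite naM // naX // ger_pMr ?na_gt0 ?tdisc_neq0 // exprn_ile1 ?(na_ge0 ha) //.
  by case/andP: eX => _ /ltW.
have E2 : E1 * (1 + fpsX C * T') = 1.
  apply/funext => j; apply: (mulfI w0); rewrite -!fpsCM mulr1.
  move/eqP: E0; rewrite subr_eq0 c1E -!mulrA => /eqP /(congr1 (fun c : fps C => c j.+1)).
  by rewrite !fpsXM.
have E3 : E1 * fps_scale w (fps_map iC (carlitz_quotV F)) = 1.
  by rewrite -fps_scaleM -rmorphM carlitz_quotK rmorph1 fps_scale1.
have E4 : 1 + fpsX C * T' = fps_scale w (fps_map iC (carlitz_quotV F)).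
  by rewrite -[LHS]mul1r -{1}E3 mulrAC E2 mul1r.
have := congr1 (fun c : fps C => c k.+1) E4.
rewrite fpsDE fps1E add0r fpsXM /fps_scale fps_mapE /T' /zetaK => E5.
apply: (@mulfI _ ((-1) ^+ k)); first by rewrite signr_eq0.
rewrite E5 rmorphM rmorphXn rmorphN1 mulrCA; congr (_ * _).
by rewrite mulrA -exprMn mulrNN mulr1 expr1n mul1r.
Qed.
End Zeta.

(** * Eisenstein series and their expansions *)

Section EisensteinK.
Variable F : finFieldType.
Notation A := {poly F}.
Notation K := {fraction {poly F}}.
Notation q := #|F|.
Let qn1 : (1 < q)%N := card_finField_gt1 F.

(** The expansion of the row with [c] fixed: a zeta value for c = 0, and otherwise the Goss
    polynomial evaluated at the expansion of u(cz). *)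
Definition eisV (k : nat) (c : A) : fps K :=
  if c == 0 then fpsC (zetaK F k)
  else \sum_(j < size (goss F k.+1)) fpsC (goss F k.+1)`_j * fps_map (@inK F) (UC c) ^+ j.

(* The Eisenstein series sum_(c,b) (cz+b)^-(k+1), divided by the (k+1)-st power of the period. *)
Definition eisS (k : nat) : fps K := fun n => \sum_(c <- small_polys F n) eisV k c n.

Lemma goss0 k : (goss F k)`_0 = 0.
Proof. by rewrite coef_sum big1 // => j _; rewrite coefZ coefXn mulr0. Qed.

(** u(cz) starts in degree q^(deg c), which is at least [size c]. This makes each coefficient of
    [eisS] a finite sum. *)
Lemma eisV_lt k (c : A) n : (n < size c)%N -> eisV k c n = 0.
Proof.
move=> nc; have c0 : c != 0 by rewrite -size_poly_gt0 (leq_ltn_trans _ nc).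
rewrite /eisV (negPf c0) fps_sumE big1 // => -[[|j] /= _] _; first by rewrite goss0 rmorph0 mul0r.
rewrite fpsCM exprS fpsME big1 ?mulr0 // => i _; rewrite fps_mapE UC_lt ?rmorph0 ?mul0r //.
rewrite (leq_ltn_trans (leq_ord i)) // (leq_trans _ (ltn_expl (size c).-1 qn1)) //.
by rewrite ltnS -ltnS prednK // size_poly_gt0.
Qed.
End EisensteinK.

Section EisensteinForm.
Variables (R : realType) (F : finFieldType) (C : Cinfty R F) (p : nat).
Hypothesis hp : p \in [pchar F].
Notation A := {poly F}.
Notation K := {fraction {poly F}}.
Notation aC := (@absC R F C).
Notation iC := (@KtoC R F C).
Notation iA := (@iA R F C).
Notation q := #|F|.
Notation qR := (#|F|%:R : R).
Notation e := (@carlitz_exp R F C).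
Add Ring Cring15 : (rT_ring C).
Let AR : comNzRingType := {poly F}.
Add Ring Aring15 : (rT_ring AR).
Let ha := absC_nonarch C.
Let hc := @absC_complete R F C.
Let q1 : 1 < qR := qR_gt1 R F.
Let q0 : 0 < qR := qR_gt0 R F.
Let qge1 : 1 <= qR := qR_ge1 R F.
Let qn1 : (1 < q)%N := card_finField_gt1 F.
Hint Resolve q1 q0 qge1 : core.
Variable (w : C).
Hypothesis hw : carlitz_period w.
Notation u := (@u_param R F C w).

Lemma hsum_tail (I : eqType) (x : I -> C) S (B : seq I) t : 0 <= t -> uniq B ->
  (forall i, i \notin B -> aC (x i) <= t) -> hsum aC x S -> aC (S - \sum_(i <- B) x i) <= t.
Proof.
move=> t0 uB hB hS.
have h : hsum aC (fun i => if i \in B then x i else 0) (\sum_(i <- B) x i).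
  rewrite (eq_big_seq (fun i => if i \in B then x i else 0)) => [|i ->] //.
  by apply: hsum_fin => // i /negPf ->.
apply: (hsum_le ha t0 _ (hsumB ha hS h)) => i.
by case: ifPn => [_|/hB]; rewrite ?subrr ?na0 ?subr0.
Qed.

Notation mx2 := (fun cb : A * A => maxn (size cb.1) (size cb.2)).

Definition small_pairs n : seq (A * A) := [seq (c, b) | c <- small_polys F n, b <- small_polys F n].

Lemma mem_small_pairs n cb : (cb \in small_pairs n) = (mx2 cb <= n)%N.
Proof.
case: cb => c b; apply/allpairsP/idP => [[[c' b'] /= [h1 h2 [-> ->]]]|/=].
  by rewrite geq_max -!mem_small_polys h1.
by rewrite geq_max => /andP[h1 h2]; exists (c, b); rewrite !mem_small_polys.
Qed.

Lemma rnull_size2 (M : R) : 0 <= M -> rnull (fun cb : A * A => M * qR ^- mx2 cb).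
Proof.
move=> M0; apply: rnull_scale => // t t0; have [N hN] := q_archi F t^-1.
exists (small_pairs N.+1) => cb; rewrite mem_small_pairs -ltnNge => Nb.
rewrite invf_plt ?posrE ?exprn_gt0 //; apply: le_lt_trans hN _.
by rewrite ltr_eXn2l // ltnW.
Qed.

Lemma linA_lower n z (c b : A) : Omega_aff n z ->
  aC (iA c) <= qR ^+ (n + n) * aC (iA c * z + iA b) /\
  aC (iA b) <= qR ^+ (n + n) * aC (iA c * z + iA b).
Proof.
move=> /Omega_affP [zn hz]; have qn : 0 < qR ^- n by rewrite invr_gt0 exprn_gt0.
have := far_lin (inK c) (inK b) qn hz; rewrite -!iAE ler_pdivrMr ?exprn_gt0 // mulrC => h.
have h1 : aC (iA c) <= qR ^+ (n + n) * aC (iA c * z + iA b).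
  apply: le_trans h _; rewrite ler_wpM2r ?(na_ge0 ha) //.
  by rewrite ler_weXn2l // leq_addr.
split=> //; have {1}-> : iA b = iA c * z + iA b - iA c * z by rewrite addrAC subrr add0r.
apply: (na_leB ha).
  by rewrite ler_peMl ?(na_ge0 ha) // exprn_ege1.
rewrite naM // exprD -mulrA [leRHS]mulrC.
by apply: ler_pM => //; rewrite (na_ge0 ha).
Qed.

Variable k0 : nat.
(** The pair (0, 0) contributes the inverse of 0, that is 0, so the sum may run over all pairs. *)
Let trm (z : C) (cb : A * A) : C := (iA cb.1 * z + iA cb.2) ^- k0.+1.
Let Mn n : R := (qR ^+ (n + n) * qR) ^+ k0.+1.

Lemma Mn_ge0 n : 0 <= Mn n.
Proof. by rewrite /Mn exprn_ge0 // mulr_ge0 // ?exprn_ge0 // ltW. Qed.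
Hint Resolve Mn_ge0 : core.

Lemma aC_trm n z cb : Omega_aff n z -> aC (trm z cb) <= Mn n * qR ^- mx2 cb.
Proof.
case: cb => c b hz; rewrite /trm /=.
have [/eqP|m0] := eqVneq (maxn (size c) (size b)) 0%N.
  rewrite -leqn0 geq_max !leqn0 !size_poly_eq0 => /andP[/eqP -> /eqP ->].
  by rewrite !rmorph0 mul0r addr0 expr0n invr0 na0 // size_poly0 maxnn expr0 invr1 mulr1.
have [h1 h2] := linA_lower c b hz; set x := _ + _ in h1 h2 *.
have h : qR ^+ (maxn (size c) (size b)) <= qR ^+ (n + n) * qR * aC x.
  have key (d : A) : (size d != 0)%N -> aC (iA d) <= qR ^+ (n + n) * aC x ->
      qR ^+ size d <= qR ^+ (n + n) * qR * aC x.
    rewrite size_poly_eq0 => d0 h; have -> : qR ^+ size d = qR * aC (iA d).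
      by rewrite aC_iA // -exprS prednK // size_poly_gt0.
    by rewrite mulrAC [leRHS]mulrC ler_wpM2l // ltW.
  case: (leqP (size c) (size b)) m0 => hcb m0; apply: key => //.
have x0 : 0 < aC x.
  rewrite lt_neqAle eq_sym (na_ge0 ha) andbT; apply: contraTneq h => ->.
  by rewrite mulr0 -ltNge exprn_gt0.
rewrite naV // naX //; set s := qR ^+ maxn _ _ in h *.
have s1 : 1 <= s by rewrite exprn_ege1.
have s0 : 0 < s by apply: lt_le_trans s1.
rewrite ler_pdivlMr // mulrC ler_pdivrMr ?exprn_gt0 // /Mn -exprMn.
apply: le_trans (_ : s ^+ k0.+1 <= _); first by rewrite -[leLHS]expr1 ler_weXn2l.
by apply: lerXn2r; rewrite ?nnegrE ?(ltW s0) //; apply: le_trans h; exact: ltW.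
Qed.

Lemma null_trm z : Omega z -> null aC (trm z).
Proof.
move=> /Omega_ex [n hz]; apply: (@null_le _ _ _ _ _ (fun cb : A * A => Mn n * qR ^- mx2 cb)).
  by move=> cb; apply: aC_trm.
exact: rnull_size2.
Qed.

Let f (z : C) : C := xget 0 [set S | hsum aC (trm z) S].

Lemma f_hsum z : Omega z -> hsum aC (trm z) (f z).
Proof.
move=> hz; rewrite /f; case: xgetP => [S _ //|h].
by have [S hS] := null_hsum ha hc (null_trm hz); case: (h S).
Qed.

Lemma rigid_f : rigid_analytic f.
Proof.
apply: rigid_of_on => n; apply: rigid_on_lim => t t0.
have t2 : 0 < t / 2 by rewrite divr_gt0.
have [B hB] := rnull_size2 (Mn_ge0 n) t2.
exists (fun z => \sum_(i <- undup B) trm z i).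
  apply: rigid_on_sum => -[c b] _; have [[-> ->]|cb0] := eqVneq (c, b) (0, 0).
    apply: (@rigid_on_eq _ _ _ n (fun=> 0 : C)) => [z _|]; last exact: rigid_on_const.
    by rewrite /trm !rmorph0 mul0r addr0 expr0n invr0.
  pose g : {poly C} := (iA c *: 'X + (iA b)%:P) ^+ k0.+1.
  have gE z : g.[z] = (iA c * z + iA b) ^+ k0.+1.
    by rewrite /g horner_exp hornerD hornerZ hornerX hornerC.
  apply: (@rigid_on_eq _ _ _ n (fun z => 1%:P.[z] / g.[z])) => [z _|].
    by rewrite hornerC gE mul1r.
  apply: rigid_on_rat => z hz; rewrite gE expf_neq0 //; have [h1 h2] := linA_lower c b hz.
  apply: contra_neq cb0 => x0; rewrite x0 na0 // mulr0 in h1 h2.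
  have z0 (d : A) : aC (iA d) <= 0 -> d = 0.
    move=> h; apply/eqP; rewrite -(iA_eq0 C) -(na_eq0 ha); apply/eqP/le_anti.
    by rewrite h (na_ge0 ha).
  by rewrite (z0 _ h1) (z0 _ h2).
move=> z hz; apply: (@le_lt_trans _ _ (t / 2)); last by rewrite ltr_pdivrMr // ltr_pMr // ltr1n.
apply: (@hsum_tail _ (trm z)); rewrite ?undup_uniq ?(ltW t2) //.
  by move=> i; rewrite mem_undup => /hB h; apply: le_trans (aC_trm i hz) (ltW h).
by apply: f_hsum; apply: Omega_aff_Omega hz.
Qed.

Lemma row_act_bij (g : 'M[A]_2) : g \in unitmx ->
  let phi (cb : A * A) := (cb.1 * g 0 0 + cb.2 * g 1 0, cb.1 * g 0 1 + cb.2 * g 1 1) in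
  injective phi /\ forall xy, exists cb, phi cb = xy.
Proof.
move=> gu phi; have dE := det2 g.
have du : \det g \is a GRing.unit by rewrite -unitmxE.
move: dE du; set D := \det g; set a := g 0 0; set b := g 0 1; set c := g 1 0; set d := g 1 1.
move=> dE du; split=> [[x y] [x' y']|[x y]].
  rewrite /phi /= -/a -/b -/c -/d => -[E1 E2].
  have E3 : x * D = x' * D.
    have -> : x * D = (x * a + y * c) * d - (x * b + y * d) * c by rewrite dE; crring AR.
    by rewrite E1 E2 dE; crring AR.
  have E4 : y * D = y' * D.
    have -> : y * D = (x * b + y * d) * a - (x * a + y * c) * b by rewrite dE; crring AR.
    by rewrite E1 E2 dE; crring AR.
  by rewrite (mulIr du E3) (mulIr du E4).
exists ((x * d - y * c) * D^-1, (y * a - x * b) * D^-1); rewrite /phi /= -/a -/b -/c -/d.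
have h : D * D^-1 = 1 by rewrite divrr.
congr (_, _).
  have -> : (x * d - y * c) / D * a + (y * a - x * b) / D * c = x * (D / D).
    by move: (D^-1) => D'; rewrite dE; crring AR.
  by rewrite h mulr1.
have -> : (x * d - y * c) / D * b + (y * a - x * b) / D * d = y * (D / D).
  by move: (D^-1) => D'; rewrite dE; crring AR.
by rewrite h mulr1.
Qed.

Lemma modular_f m : m = 0 -> modular_function k0.+1 m f.
Proof.
move=> -> g z gu hz /=; rewrite expr0 invr1 mul1r -!iAE -/(jfac g z) -/(mob g z).
have J0 := jfac_neq0 gu hz; have hm := mob_Omega gu hz.
have [injp surp] := row_act_bij gu; set phi := (fun cb : A * A => _) in injp surp.
have h S : hsum aC (trm z \o phi) S <-> hsum aC (trm z) S.
  by apply: (@hsum_reindex _ _ _ _ _ phi) => // i _; apply: surp.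
apply: (hsum_uniq ha (f_hsum hm)).
have /h h' := f_hsum hz; have := hsumZ ha (jfac g z ^+ k0.+1) h'; apply: eq_hsum => -[c b].
rewrite /trm /= /mob.
have -> : iA c * ((iA (g 0 0) * z + iA (g 0 1)) / jfac g z) + iA b =
    (iA (c * g 0 0 + b * g 1 0) * z + iA (c * g 0 1 + b * g 1 1)) / jfac g z.
  rewrite -[iA b](mulfK J0) mulrA -mulrDl; congr (_ / _); rewrite /jfac !rmorphD !rmorphM /=.
  by rring C.
by rewrite expr_div_n invf_div.
Qed.

(** The decay in [size c], uniform in the exponent after scaling, permits exchanging the sum over
    [c] with the expansion in u. *)
Lemma eisV_bound : exists2 M, 0 <= M & forall c : A,
  cbound (fps_map iC (eisV k0 c)) qR^-1 (M * qR ^- size c).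
Proof.
pose g := goss F k0.+1; pose M1 := \sum_(j < size g) aC (iC g`_j).
have M10 : 0 <= M1 by apply: sumr_ge0 => j _; apply: na_ge0.
exists (aC (iC (zetaK F k0)) + M1); first by rewrite addr_ge0 ?(na_ge0 ha).
move=> c; have t0 : 0 < qR^-1 by rewrite invr_gt0.
have tn0 n : 0 < qR^-1 ^+ n by rewrite exprn_gt0.
have Mc : 0 <= (aC (iC (zetaK F k0)) + M1) * qR ^- size c.
  apply: mulr_ge0; first by apply: addr_ge0 => //; apply: (na_ge0 ha).
  by rewrite invr_ge0 exprn_ge0 // ltW.
move=> n; rewrite fps_mapE /eisV; case: eqVneq Mc => [->|c0] Mc.
  rewrite size_poly0 expr0 invr1 mulr1 /fpsC; case: eqP => [->|_].
    by rewrite expr0 mulr1 lerDl.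
  by rewrite rmorph0 na0 // mul0r addr_ge0 ?(na_ge0 ha).
rewrite -ler_pdivlMr // fps_sumE rmorph_sum; apply: (na_sum_le ha).
  by rewrite divr_ge0 // ltW.
move=> j _ _; rewrite ler_pdivlMr // fpsCM rmorphM naM // -mulrA.
case: j => -[|j] ltj /=; first by rewrite goss0 rmorph0 na0 // mul0r.
have gM : aC (iC g`_j.+1) <= aC (iC (zetaK F k0)) + M1.
  rewrite /M1 (bigD1 (Ordinal ltj)) //= addrCA lerDl addr_ge0 ?(na_ge0 ha) //.
  by apply: sumr_ge0 => i _; apply: na_ge0.
have hU : cbound (fps_map iC (fps_map (@inK F) (UC c))) qR^-1 (qR^-1 ^+ (q ^ (size c).-1)).
  by have := UC_bound C c (lexx qR).
apply: ler_pM => //; rewrite ?(na_ge0 ha) ?mulr_ge0 ?(na_ge0 ha) ?(ltW (tn0 _)) //.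
have := cboundX j.+1 (ltW t0) (ltW (tn0 _)) hU n; rewrite -rmorphXn => h.
apply: le_trans h _; rewrite -exprVn -exprM.
apply: ler_wiXn2l; rewrite ?(ltW t0) ?invf_le1 //.
apply: leq_trans (leq_pmulr _ _) => //.
by rewrite -[X in (X <= _)%N]prednK ?size_poly_gt0 // ltn_expl.
Qed.

Lemma eisV_ev z c : Omega z -> aC (u z) < qR^-1 ->
  ev aC (fps_map iC (eisV k0 c)) (u z)
    (if c == 0 then iC (zetaK F k0) else (map_poly iC (goss F k0.+1)).[u (iA c * z)]).
Proof.
move=> hz uz; rewrite /eisV; case: eqVneq => [_|c0]; first by rewrite fps_mapC; apply: evC.
rewrite rmorph_sum horner_coef size_map_poly; apply: ev_sum => // j _.
rewrite coef_map rmorphM /= fps_mapC rmorphXn; apply: evZ => //; apply: evXn => //.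
exact: (ev_UC_u hp c0 (e_wz_neq0 hp hw hz) uz).
Qed.

Lemma ux_f : ux w (fun z => w ^- k0.+1 * f z) (fps_map iC (eisS F k0)).
Proof.
have w0 := w_neq0 hp hw.
have s0 : 0 < qR ^- 2 by rewrite invr_gt0 exprn_gt0.
have [b b0 hb] := far_u hp hw s0.
exists b => // z zb; have hz := far_Omega b0 zb.
have qu : qR * aC (u z) < 1.
  rewrite mulrC -ltr_pdivlMr // mul1r; apply: le_lt_trans (hb z zb) _.
  by rewrite ltf_pV2 ?posrE ?exprn_gt0 // -[ltLHS]expr1 ltr_eXn2l.
have uz : aC (u z) < qR^-1 by rewrite -[qR^-1]mul1r ltr_pdivlMr // mulrC.
have [M M0 hM] := eisV_bound.
pose v (c : A) := if c == 0 then iC (zetaK F k0) else (map_poly iC (goss F k0.+1)).[u (iA c * z)].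
have rowc (c : A) : hsum aC (fun b => trm z (c, b)) (w ^+ k0.+1 * v c).
  rewrite /v; case: eqVneq => [->|c0].
    have := sum_invA hp hw k0; apply: eq_hsum => a.
    by rewrite /trm /= rmorph0 mul0r add0r.
  have c0' : inK c != 0 by rewrite -(fmorph_eq0 iC) -iAE iA_eq0.
  have b1 : 0 < aC (iC (inK c)) * b by rewrite mulr_gt0 // na_gt0 // fmorph_eq0.
  exact: (sum_inv_pow hp hw k0 (far_Omega b1 (far_scale c0' zb))).
have hv : hsum aC v (w ^- k0.+1 * f z).
  have := hsumZ ha (w ^- k0.+1) (hsum_Fubini ha rowc (f_hsum hz)); apply: eq_hsum => c.
  by rewrite mulKf // expf_neq0.
pose x (cn : A * nat) := iC (eisV k0 cn.1 cn.2) * u z ^+ cn.2.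
have nx : null aC x.
  apply: (@null_le _ _ _ _ _ (fun cn : A * nat => (M * qR ^- size cn.1) * (qR * aC (u z)) ^+ cn.2)).
    move=> [c n]; rewrite /x /= naM // naX // exprMn mulrA.
    rewrite ler_wpM2r ?exprn_ge0 ?(na_ge0 ha) // -ler_pdivrMr ?exprn_gt0 // -exprVn.
    exact: hM.
  apply: (rnullM (b := fun c : A => M * qR ^- size c) (c := fun n => (qR * aC (u z)) ^+ n)).
  - by move=> c; rewrite mulr_ge0 // invr_ge0 exprn_ge0 // ltW.
  - by move=> n; rewrite exprn_ge0 // mulr_ge0 ?(na_ge0 ha) ?ltW.
  - by apply: rnull_scale => //; exact: rnull_size.
  - by apply: rnull_geom; rewrite qu andbT mulr_ge0 ?(na_ge0 ha) ?ltW.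
have h1 c : hsum aC (fun n => x (c, n)) (v c) by apply: eisV_ev.
have h2 n : hsum aC (fun c => x (c, n)) (fps_map iC (eisS F k0) n * u z ^+ n).
  rewrite fps_mapE /eisS rmorph_sum mulr_suml.
  apply: (@hsum_fin _ _ _ ha _ (fun c => x (c, n)) _ (uniq_small_polys F n)) => c.
  by rewrite mem_small_polys -ltnNge => nc; rewrite /x /= eisV_lt // rmorph0 mul0r.
exact: (hsum_exchange ha hc nx h1 h2 hv).
Qed.

Lemma MS_eis : modular_series w k0.+1 0 (eisS F k0).
Proof.
apply: (@MS_intro _ _ _ _ (fun z => w ^- k0.+1 * f z)); last exact: ux_f.
  by apply: rigid_of_on => n; apply: rigid_onM; [exact: rigid_on_const|exact: rigid_f].
by move=> g z gu hz e'; rewrite {}/e' (@modular_f 0 erefl g z gu hz) mulrCA.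
Qed.
End EisensteinForm.

(** * Arithmetic of the Carlitz factorials modulo P *)

Section Brackets.
Variables (F : finFieldType) (p : nat).
Let AR : comNzRingType := {poly F}.
Add Ring Aring16 : (rT_ring AR).
Hypothesis hp : p \in [pchar F].
Notation A := {poly F}.
Notation q := #|F|.
Let qn1 : (1 < q)%N := card_finField_gt1 F.
Let qn0 : (0 < q)%N := ltnW qn1.
Variables (P : A) (Pm : P \is monic) (Pirr : irreducible_poly P).
Notation d := (size P).-1.

Lemma poly_prime a b : P %| a * b -> (P %| a) || (P %| b).
Proof.
have [|Pa] := boolP (P %| a) => //= h.
by have := h; rewrite Gauss_dvdpr // irreducible_poly_coprime.
Qed.

Lemma prime_prod (s : seq A) : P %| \prod_(b <- s) b -> has (fun b => P %| b) s.
Proof.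
elim: s => [|b s IH]; last by rewrite big_cons => /poly_prime /orP[|/IH] /= ->; rewrite ?orbT.
rewrite big_nil dvdp1 => /eqP s1; have [] := Pirr; by rewrite s1.
Qed.

Lemma small_ndvd b : b \in small_polys F d -> b != 0 -> ~~ (P %| b).
Proof.
rewrite mem_small_polys => sb b0; apply/negP => /(dvdp_leq b0).
have [s1 _] := Pirr; rewrite leqNgt (leq_ltn_trans sb) // prednK //; exact: ltnW.
Qed.

Lemma small_inj (b b' : A) : b \in small_polys F d -> b' \in small_polys F d -> P %| b - b' -> b = b'.
Proof.
rewrite !mem_small_polys => sb sb'; have [/eqP|ne /(dvdp_leq ne)] := eqVneq (b - b') 0.
  by rewrite subr_eq0 => /eqP.
have [s1 _] := Pirr; have sd : (size (b - b')%R <= d)%N.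
  by apply: leq_trans (size_polyD _ _) _; rewrite size_polyN geq_max sb.
by rewrite leqNgt (leq_ltn_trans sd) // prednK //; exact: ltnW.
Qed.

Lemma size_small_polys n : size (small_polys F n) = (q ^ n)%N.
Proof. by rewrite size_map -cardE card_mx mul1n. Qed.

Lemma size_Pn0 : size P != 0%N.
Proof. by have [s _] := Pirr; rewrite -lt0n ltnW. Qed.

(** For [a] prime to P, multiplication by [a] permutes the nonzero residues of degree below d;
    comparing their products gives a^(q^d - 1) = 1 modulo P. *)
Lemma fermat_poly a : P %| a ^+ (q ^ d) - a.
Proof.
have [Pa|Pa] := boolP (P %| a).
  by rewrite dvdp_sub // dvdp_exp // expn_gt0 qn0.
pose s := [seq b <- small_polys F d | b != 0].
have us : uniq s by rewrite filter_uniq // uniq_small_polys.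
have ss : size s = (q ^ d).-1.
  have := count_predC (pred1 (0 : A)) (small_polys F d).
  rewrite count_uniq_mem ?uniq_small_polys // mem_small_polys size_poly0 size_small_polys => <-.
  by rewrite add1n /= /s size_filter.
pose g b := (a * b) %% P.
have P0 : P != 0 by rewrite -size_poly_eq0 size_Pn0.
have gP b : P %| g b - a * b by rewrite -dvdpNr opprB {1}(divp_eq (a * b) P) addrK dvdp_mulIr.
have gs : {subset map g s <= s}.
  move=> x /mapP[b]; rewrite !mem_filter => /andP[b0 bs] ->; apply/andP; split.
    apply: contraNneq Pa => gb; have := gP b; rewrite gb sub0r dvdpNr => /poly_prime.
    by rewrite (negPf (small_ndvd bs b0)) orbF.
  by rewrite mem_small_polys -ltnS prednK ?lt0n ?size_Pn0 // ltn_modp.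
have ug : uniq (map g s).
  rewrite map_inj_in_uniq // => b b'; rewrite !mem_filter => /andP[b0 bs] /andP[b'0 b's] E.
  apply: small_inj => //; have : P %| a * (b - b').
    have -> : a * (b - b') = (g b' - a * b') - (g b - a * b) by rewrite E; move: (g b') => y; crring AR.
    by rewrite dvdp_sub.
  by move=> /poly_prime; rewrite (negPf Pa).
have gperm : perm_eq (map g s) s.
  by have [|_ E] := uniq_min_size ug gs; [rewrite size_map|exact: uniq_perm].
have cong (l : seq A) : P %| \prod_(b <- l) g b - a ^+ size l * \prod_(b <- l) b.
  elim: l => [|b l IH]; first by rewrite !big_nil expr0 mul1r subrr dvdp0.
  rewrite !big_cons /= exprS.
  have -> : g b * \prod_(j <- l) g j - a * a ^+ size l * (b * \prod_(j <- l) j) =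
      g b * (\prod_(j <- l) g j - a ^+ size l * \prod_(j <- l) j) +
      (g b - a * b) * (a ^+ size l * \prod_(j <- l) j).
    by rewrite mulrBr mulrBl addrA subrK mulrACA.
  by apply: dvdp_add; [apply: dvdp_mull|apply: dvdp_mulr].
have h := cong s; rewrite -(big_map g xpredT id) (perm_big _ gperm) ss /= -[X in X - _]mul1r -mulrBl in h.
have : P %| 1 - a ^+ (q ^ d).-1.
  case/orP: (poly_prime h) => // /prime_prod /hasP[b]; rewrite mem_filter => /andP[b0 bs].
  by rewrite (negPf (small_ndvd bs b0)).
rewrite -dvdpNr opprB => h1; have -> : a ^+ (q ^ d) - a = a * (a ^+ (q ^ d).-1 - 1).
  by rewrite mulrBr mulr1 -exprS prednK // expn_gt0 qn0.
by rewrite dvdp_mull.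
Qed.

Lemma bracket_dvd : P %| carlitz_bracket F d.
Proof. exact: fermat_poly. Qed.

(** Lagrange's bound on the number of roots over A/P, with divisibility by P in place of equality; g
    - g(b) is factored in A itself. *)
Lemma roots_mod_prime (s : seq A) (g : {poly A}) : g \is monic ->
  {in s &, forall b b', P %| b - b' -> b = b'} -> uniq s ->
  (forall b, b \in s -> P %| g.[b]) -> (size s < size g)%N.
Proof.
elim: s g => [|b s IH] g gm inj us hg; first by rewrite size_poly_gt0 monic_neq0.
pose h := g - (g.[b])%:P; have /factor_theorem [k kE] : root h b.
  by rewrite /root hornerD hornerN hornerC subrr.
have sg : (1 < size g)%N.
  rewrite ltnNge; apply/negP => s1; have gE := size1_polyC s1.
  have := monicP gm; rewrite gE lead_coefC => g1; have := hg b; rewrite mem_head gE hornerC g1.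
  by move=> /(_ isT); rewrite dvdp1 => /eqP sP; have [] := Pirr; rewrite sP.
have hE : lead_coef h = 1 /\ size h = size g.
  have lt : (size (- (g.[b])%:P) < size g)%N.
    by rewrite size_polyN (leq_ltn_trans (size_polyC_leq1 _)).
  by rewrite /h lead_coefDl // size_polyDl //; split=> //; apply/eqP.
have km : k \is monic.
  rewrite monicE; have := hE.1; rewrite kE lead_coef_Mmonic ?monicXsubC //; by move=> ->.
have sk : size g = (size k).+1.
  by rewrite -hE.2 kE size_Mmonic ?monicXsubC ?monic_neq0 // size_XsubC addn2.
move: us => /= /andP[bs us]; rewrite sk ltnS; apply: IH => //.
  by move=> x y xs ys; apply: inj; rewrite inE ?xs ?ys orbT.
move=> x xs; have : P %| k.[x] * (x - b).
  have -> : k.[x] * (x - b) = g.[x] - g.[b].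
    by have := congr1 (fun g => g.[x]) kE; rewrite /h hornerM hornerXsubC !hornerE.
  by rewrite dvdp_sub // hg ?mem_head // inE xs orbT.
move=> /poly_prime /orP[//|/inj E]; move: bs; rewrite -(E _ _) ?xs ?mem_head // inE xs orbT //.
Qed.

(** If P divided theta^(q^i) - theta, the Frobenius would make all q^d residues roots of X^(q^i) - X
    modulo P, too many when i < d. *)
Lemma bracket_ndvd i : (0 < i < d)%N -> ~~ (P %| carlitz_bracket F i).
Proof.
move=> /andP[i0 id]; apply/negP => hX.
have hpA : p \in [pchar A] by rewrite pchar_poly.
have pn : [pchar A].-nat (q ^ i)%N.
  by rewrite pnatX (eq_pnat _ (pcharf_eq hpA)) pnat_card_finField.
have all_fix (a : A) : P %| a ^+ (q ^ i) - a.
  elim/poly_ind: a => [|a k IH].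
    by rewrite expr0n expn_eq0 (gtn_eqF qn0) subr0 dvdp0.
  rewrite exprDn_pchar // exprMn -polyC_exp expf_cardX opprD addrACA subrr addr0.
  have -> : a ^+ (q ^ i) * 'X ^+ (q ^ i) - a * 'X =
      (a ^+ (q ^ i) - a) * 'X ^+ (q ^ i) + a * ('X ^+ (q ^ i) - 'X).
    by rewrite mulrBl mulrBr addrA subrK.
  by apply: dvdp_add; [apply: dvdp_mulr|apply: dvdp_mull].
pose g : {poly A} := 'X^(q ^ i) - 'X.
have lt : (size (- 'X : {poly A}) < size ('X^(q ^ i) : {poly A}))%N.
  by rewrite size_polyN size_polyX size_polyXn ltnS (leq_trans _ (ltn_expl i qn1)).
have gm : g \is monic by rewrite monicE lead_coefDl // lead_coefXn.
have := roots_mod_prime gm (fun b b' hb hb' => small_inj hb hb') (uniq_small_polys F d).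
rewrite size_small_polys /g size_polyDl // size_polyXn ltnS => h.
have : (q ^ d <= q ^ i)%N by apply: h => b _; rewrite !hornerE; exact: all_fix.
by rewrite leqNgt ltn_exp2l ?id.
Qed.

(** The derivative of theta^(q^d) - theta is -1. *)
Lemma bracket_sq : ~~ (P ^+ 2 %| carlitz_bracket F d).
Proof.
apply/negP => /dvdpP [h E].
have := congr1 (@deriv F) E; rewrite derivB derivXn derivX !derivM.
have -> : 'X^((q ^ d).-1) *+ (q ^ d) = 0 :> A.
  have d0 : (0 < d)%N by have [s _] := Pirr; rewrite -ltnS prednK // ltnW.
  by rewrite -mulr_natr natrX (card_A0 hp) expr0n (gtn_eqF d0) mulr0.
rewrite sub0r => E1; have : P %| 1.
  rewrite -dvdpNr E1; apply: dvdp_add; first by rewrite dvdp_mull // dvdp_exp.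
  by apply: dvdp_mull; apply: dvdp_add; [exact: dvdp_mulIr|exact: dvdp_mulIl].
by rewrite dvdp1 => /eqP s1; have [] := Pirr; rewrite s1.
Qed.
End Brackets.

(** * Carlitz factorials clear the denominators of Goss coefficients *)

Section Integrality.
Variable F : finFieldType.
Notation A := {poly F}.
Notation K := {fraction {poly F}}.
Notation q := #|F|.
Let qn1 : (1 < q)%N := card_finField_gt1 F.
Let qn0 : (0 < q)%N := ltnW qn1.
Notation cs := (carlitz_series F : fps K).
Notation D := (carlitz_D F).

Lemma Aint_sum (I : Type) (s : seq I) (Q : pred I) (G : I -> K) :
  (forall i, Q i -> exists a : A, G i = inK a) -> exists a : A, \sum_(i <- s | Q i) G i = inK a.
Proof.
move=> h; elim/big_ind: _ => [|x y [a ->] [b ->]|i /h //]; first by exists 0; rewrite rmorph0.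
by exists (a + b); rewrite rmorphD.
Qed.

(* The Carlitz factorial with the indices of the factors D_i shifted by s. *)
Definition dprod (n s r : nat) : A := \prod_(i < n) D (s + i) ^+ ((r %/ q ^ i) %% q).

Lemma dprodS n s r : dprod n.+1 s r = D s ^+ (r %% q) * dprod n s.+1 (r %/ q).
Proof.
rewrite /dprod big_ord_recl addn0 expn0 divn1; congr (_ * _); apply: eq_bigr => i _.
by rewrite lift0 addnS addSn expnS divnMA.
Qed.

Lemma pred_muln a b : (0 < a)%N -> (0 < b)%N -> (a * b).-1 = (a.-1 * b + b.-1)%N.
Proof. by case: a => // a; case: b => // b _ _; rewrite mulSn /= addnC. Qed.

(** If the last digit of r is positive, subtracting 1 removes one factor D_s. Otherwise a borrow
    removes a factor of index s + 1 or more, and D_s^q divides D_(s+1), which pays for the q - 1 new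
    factors D_s and the extra one. *)
Lemma dprod_pred n s r : (0 < r < q ^ n)%N -> D s * dprod n s r.-1 %| dprod n s r.
Proof.
elim: n s r => [|n IH] s r /andP[r0 rn]; first by move: rn; rewrite expn0 ltnNge r0.
have rq : (r %/ q < q ^ n)%N by rewrite ltn_divLR // -expnSr.
rewrite !dprodS mulrA -exprS; have rE := divn_eq r q.
case: (posnP (r %% q)) => [r1|r1].
  have rq0 : (0 < r %/ q)%N by rewrite divn_gt0 // dvdn_leq //; apply/eqP.
  have rE' : r.-1 = ((r %/ q).-1 * q + q.-1)%N.
    by rewrite {1}rE r1 addn0 pred_muln.
  have -> : (r.-1 %% q)%N = q.-1 by rewrite rE' modnMDl modn_small // prednK.
  have q1q : (q.-1 < q)%N by rewrite prednK.
  have -> : (r.-1 %/ q)%N = (r %/ q).-1 by rewrite rE' divnMDl // (divn_small q1q) addn0.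
  rewrite r1 expr0 mul1r prednK //; apply: dvdp_trans (IH s.+1 _ _); last by rewrite rq0.
  by apply: dvdp_mul => //=; apply: dvdp_mull.
have rE' : r.-1 = (r %/ q * q + (r %% q).-1)%N by rewrite {1}rE -!subn1 addnBA.
have rm : ((r %% q).-1 < q)%N by apply: leq_ltn_trans (leq_pred _) _; rewrite ltn_mod.
have -> : (r.-1 %% q)%N = (r %% q).-1 by rewrite rE' modnMDl modn_small.
have -> : (r.-1 %/ q)%N = (r %/ q)%N by rewrite rE' divnMDl // (divn_small rm) addn0.
by rewrite prednK.
Qed.

Lemma dprod_sub n s i r : (q ^ i <= r < q ^ n)%N ->
  D (s + i) * dprod n s (r - q ^ i) %| dprod n s r.
Proof.
elim: i n s r => [|i IH] n s r /andP[ir rn].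
  by rewrite addn0 expn0 subn1; apply: dprod_pred; rewrite rn andbT.
case: n rn => [|n] rn.
  by move: rn; rewrite expn0 ltnNge (leq_trans _ ir) // expn_gt0 qn0.
have rq : (r %/ q < q ^ n)%N by rewrite ltn_divLR // -expnSr.
have iq : (q ^ i <= r %/ q)%N by rewrite leq_divRL // -expnSr.
have rE : r = (q ^ i.+1 + (r - q ^ i.+1))%N by rewrite subnKC.
have -> : dprod n.+1 s r = D s ^+ ((r - q ^ i.+1) %% q) * dprod n s.+1 (r %/ q).
  by rewrite dprodS {1}rE expnSr modnMDl.
rewrite dprodS mulrCA; apply: dvdp_mul => //.
have -> : ((r - q ^ i.+1) %/ q = r %/ q - q ^ i)%N.
  by rewrite {2}rE expnSr divnMDl // addKn.
by rewrite addnS -addSn; apply: IH; rewrite iq.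
Qed.

Lemma inK_D_neq0 i : inK (D i) != 0.
Proof.
rewrite tofrac_eq0; elim: i => [|i IH] /=; first by rewrite oner_eq0.
rewrite mulf_neq0 ?expf_neq0 // -size_poly_gt0 size_polyDl ?size_polyXn //.
by rewrite size_polyN size_polyX ltnS (leq_trans _ (ltn_expl i.+1 qn1)).
Qed.

Lemma dprod_cs n j r : (r < q ^ n)%N -> exists a : A, inK (dprod n 0 r) * (cs ^+ j) r = inK a.
Proof.
elim: j r => [|j IH] r rn.
  by exists (dprod n 0 r * (r == 0%N)%:R); rewrite expr0 fps1E rmorphM rmorph_nat.
rewrite exprS fpsME mulr_sumr; apply: Aint_sum => i _.
case: (carlitz_seriesP F i) => [[t iE ->]|->]; last first.
  by exists 0; rewrite mul0r mulr0 rmorph0.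
have ir : (i <= r)%N by rewrite -ltnS.
have /dvdpP [h ->] : D (0 + t) * dprod n 0 (r - q ^ t) %| dprod n 0 r.
  by apply: dprod_sub; rewrite -iE ir.
have [a aE] := IH (r - i)%N (leq_ltn_trans (leq_subr _ _) rn).
have gen (x y z y' : K) : y != 0 -> x * (y * z) * (y^-1 * y') = x * (z * y').
  by move=> y0; rewrite -mulrA mulrACA mulfV // mul1r.
exists (h * a); rewrite add0n -iE !rmorphM /= gen ?inK_D_neq0 //.
by congr (_ * _).
Qed.

Lemma carlitz_factorial_goss r j : exists a : A,
  inK (carlitz_factorial F r) * goss_coef F r j = inK a.
Proof.
rewrite goss_coefE; have [|a aE] := @dprod_cs r.+1 j r.
  by apply: leq_trans (ltn_expl r qn1) _; rewrite leq_exp2l.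
exists a; rewrite -aE; congr (inK _ * _); apply: eq_bigr => i _; rewrite add0n.
Qed.
End Integrality.

Section Cancel.
Variable S : comNzRingType.
Add Ring Sring16 : (rT_ring S).
Lemma euler_cancel (x e r u k y g er : S) : r * g = 1 -> u * r = y -> e * r = - (u * er) ->
  x * er = - (k * y) -> x * e = k * (u * u).
Proof.
move=> rg ur h3 h4; rewrite -[LHS]mulr1 -rg.
have -> : x * e * (r * g) = x * (e * r) * g by crring S.
have -> : x * (e * r) * g = - (u * g) * (x * er) by rewrite h3; crring S.
have -> : - (u * g) * (x * er) = k * (u * u) * (r * g) by rewrite h4 -ur; crring S.
by rewrite rg mulr1.
Qed.
End Cancel.

(** * Commutation of Theta with V *)

Section ChainRule.
Variables (F : finFieldType) (p : nat).
Hypothesis hp : p \in [pchar F].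
Notation A := {poly F}.
Notation K := {fraction {poly F}}.
Notation q := #|F|.
Let qn1 : (1 < q)%N := card_finField_gt1 F.
Let qn0 : (0 < q)%N := ltnW qn1.

Section Euler.
Variable S : comNzRingType.
Definition fps_euler (c : fps S) : fps S := fun n => n%:R * c n.
Lemma fps_eulerM c d : fps_euler (c * d) = fps_euler c * d + c * fps_euler d.
Proof.
apply/funext => n; rewrite fpsDE /fps_euler !fpsME mulr_sumr -big_split; apply: eq_bigr => i _ /=.
have {1}-> : n = (i + (n - i))%N by rewrite subnKC // -ltnS.
by rewrite natrD mulrDl -mulrA mulrCA [_ * (c i * _)]mulrCA.
Qed.
Lemma fps_euler1 : fps_euler 1 = 0.
Proof. by apply/funext => -[|n]; rewrite /fps_euler fps1E ?mul0r ?mulr0. Qed.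
Lemma fps_eulerX c n : fps_euler (c ^+ n.+1) = n.+1%:R * c ^+ n * fps_euler c.
Proof.
elim: n => [|n IH]; first by rewrite expr1 expr0 !mul1r.
rewrite exprS fps_eulerM IH mulrA [c * (n.+1%:R * _)]mulrCA -exprS.
by rewrite [fps_euler c * _]mulrC [n.+2%:R]mulrS !mulrDl mul1r.
Qed.

Lemma euler_pow (U : fps S) k i : fpsX S * fps_euler U = fpsC k * U ^+ 2 ->
  fpsX S * fps_euler (U ^+ i) = fpsC (k * i%:R) * U ^+ i.+1.
Proof.
case: i => [|i] hU; first by rewrite expr0 fps_euler1 !mulr0 rmorph0 mul0r.
rewrite fps_eulerX mulrCA hU rmorphM rmorph_nat [i.+1%:R * _]mulrC -mulrA mulrCA -!mulrA.
by congr (_ * _); rewrite mulrCA -exprD addn2.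
Qed.

(** The chain rule for u^2 d/du, which is Theta by [thK1E]: the hypothesis says that this operator
    sends U to k U^2. *)
Lemma compo_euler (c U : fps S) k : fpsX S * fps_euler U = fpsC k * U ^+ 2 ->
  fpsX S * fps_euler (compo c U) = fpsC k * compo (fpsX S * fps_euler c) U.
Proof.
move=> hU; apply/funext => -[|n].
  by rewrite fpsXM0 fpsCM /compo big_ord_recl big_ord0 fpsXM0 mul0r addr0 mulr0.
rewrite fpsXM fpsCM /fps_euler /compo [in RHS]big_ord_recl fpsXM0 mul0r add0r !mulr_sumr.
apply: eq_bigr => i _; rewrite lift0 fpsXM mulrCA.
have -> : n%:R * (U ^+ i) n = (fpsX S * fps_euler (U ^+ i)) n.+1 by rewrite fpsXM.
rewrite (euler_pow _ hU) fpsCM !mulrA; congr (_ * _).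
by rewrite -[RHS]mulrC mulrA.
Qed.

End Euler.

Lemma thK1E (c : fps K) : thK 1 c = fpsX K * fps_euler c.
Proof.
apply/funext => -[|N]; rewrite ?fpsXM0 ?fpsXM /thK /thetaG.
  rewrite big_mkcond big_ord_recl big_ord1 /= goss_coefE expr0 fps1E.
  by rewrite mulr0 mulr0 addr0.
rewrite big_mkcond big_ord_recl big_ord1 /= !goss_coefE expr0 fps1E expr1 !mulr0 add0r.
have := @carlitz_series_pow F 0; rewrite expn0 => ->; rewrite /= rmorph1 invr1 mulr1 subn1 bin1.
by rewrite mulrC.
Qed.

Variables (P : A) (Pm : P \is monic) (Pirr : irreducible_poly P).
Notation Q := (q ^ (size P).-1)%N.

Lemma cardX_A0 : Q%:R = 0 :> A.
Proof.
have d0 : (0 < (size P).-1)%N by have [s _] := Pirr; rewrite -ltnS prednK // ltnW.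
by rewrite natrX (card_A0 hp) expr0n (gtn_eqF d0).
Qed.

Lemma UC_rev : UC P * revC P = fpsX A ^+ Q /\ revC P * geo (sC P) = 1.
Proof.
have sE : 1 - sC P = revC P by rewrite /sC (monicP Pm) invr1 !rmorph1 mul1r subKr.
have h : revC P * geo (sC P) = 1 by rewrite -sE geoE // sC0 ?monic_neq0.
by rewrite /UC (monicP Pm) invr1 !rmorph1 mul1r -mulrA [geo _ * _]mulrC h mulr1.
Qed.

(** Modulo p the index i of a reversed coefficient is -(Q - i), so the Euler operator sees the
    derivative of C_P, whose only nonzero coefficient is the constant P. *)
Lemma rev_euler : fpsX A * fps_euler (revC P) = - (fpsC P * fpsX A ^+ Q).
Proof.
have Q0 : (0 < Q)%N by rewrite expn_gt0 qn0.
apply/funext => -[|i]; first by rewrite fpsXM0 fpsNE fpsCM fpsXnE eq_sym (gtn_eqF Q0) mulr0 oppr0.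
rewrite fpsXM fpsNE fpsCM fpsXnE /fps_euler /revC; case: leqP => iQ; last first.
  by rewrite mulr0 (gtn_eqF (leqW iQ)) mulr0 oppr0.
have -> : i%:R = - (Q - i)%:R :> A by rewrite natrB // cardX_A0 sub0r opprK.
rewrite mulNr mulr_natl (coef_carl_dvd hp); congr (- _).
have -> : (Q - i == 1)%N = (i.+1 == Q) by rewrite -(eqn_add2r i) subnK // add1n eq_sym.
by case: eqP; rewrite ?mulr1 ?mulr0.
Qed.

(** The Euler operator kills [UC P * revC P], which is X^Q with p dividing Q; the product rule and
    [rev_euler] then determine its value on [UC P]. *)
Lemma UC_euler : fpsX A * fps_euler (UC P) = fpsC P * UC P ^+ 2.
Proof.
have [h1 h2] := UC_rev.
have h3 : fps_euler (UC P) * revC P = - (UC P * fps_euler (revC P)).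
  apply/eqP; rewrite -addr_eq0 -fps_eulerM h1; apply/eqP/funext => n.
  rewrite /fps_euler fpsXnE fps0E; case: eqP => [->|_]; rewrite ?mulr0 //.
  by rewrite cardX_A0 mul0r.
exact: (euler_cancel h2 h1 h3 rev_euler).
Qed.

Lemma thK1_V c : thK 1 (Vop P c) = fpsC (inK P) * Vop P (thK 1 c).
Proof.
rewrite !thK1E; apply: compo_euler.
have e1 : fps_map (@inK F) (fpsX A) = fpsX K.
  by apply/funext => n; rewrite /fps_map /fpsX rmorph_nat.
have e2 : fps_map (@inK F) (fps_euler (UC P)) = fps_euler (fps_map (@inK F) (UC P)).
  by apply/funext => n; rewrite /fps_euler /fps_map rmorphM rmorph_nat.
by rewrite -e2 -e1 -rmorphM UC_euler rmorphM /= fps_mapC rmorphXn.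
Qed.
End ChainRule.

(** * Estimates at v *)

Section Valuation.
Variables (R : realType) (F : finFieldType) (p : nat).
Hypothesis hp : p \in [pchar F].
Notation A := {poly F}.
Notation K := {fraction {poly F}}.
Notation q := #|F|.
Notation qR := (#|F|%:R : R).
Notation cs := (carlitz_series F : fps K).
Let q1 : 1 < qR := qR_gt1 R F.
Let q0 : 0 < qR := qR_gt0 R F.
Let qn1 : (1 < q)%N := card_finField_gt1 F.
Let qn0 : (0 < q)%N := ltnW qn1.
Variables (P : A) (Pm : P \is monic) (Pirr : irreducible_poly P) (Kv : completion R P).
Notation d := (size P).-1.
Definition vK (x : K) : R := @absv R F P Kv (@KtoKv R F P Kv x).
Notation v := vK.
Notation pi := (qR^-1).

Lemma vK_nonarch : nonarch_abs v.
Proof.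
have h := @absv_nonarch R F P Kv; split=> [x|x|x y|x y]; rewrite /vK.
- exact: na_ge0.
- split=> [/eqP|->]; last by rewrite rmorph0 na0.
  by rewrite na_eq0 // fmorph_eq0 => /eqP.
- by rewrite rmorphM naM.
- by rewrite rmorphD; exact: abs_add.
Qed.
Let hv := vK_nonarch.

Lemma pi_ge0 : 0 <= pi. Proof. by rewrite invr_ge0 ltW. Qed.
Lemma pi_gt0 : 0 < pi. Proof. by rewrite invr_gt0. Qed.
Lemma pi_le1 : pi <= 1. Proof. by rewrite invf_le1 // ltW. Qed.
Lemma piX_ge0 n : 0 <= pi ^+ n. Proof. by rewrite exprn_ge0 // pi_ge0. Qed.
Hint Resolve pi_ge0 pi_gt0 pi_le1 piX_ge0 : core.
Lemma piX_le m n : (m <= n)%N -> pi ^+ n <= pi ^+ m.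
Proof. by move=> mn; rewrite ler_wiXn2l. Qed.

Lemma d_gt0 : (0 < d)%N.
Proof. by have [s _] := Pirr; rewrite -ltnS prednK // ltnW. Qed.

Lemma v_unit a : ~~ (P %| a) -> v (inK a) = 1.
Proof. by move=> /(absv_ord Kv 0); rewrite expr0 mul1r expr0 invr1. Qed.

Lemma v_once a : ~~ (P %| a) -> v (inK (P * a)) = pi.
Proof. by move=> /(absv_ord Kv 1); rewrite !expr1. Qed.

Lemma P_ndvd1 : ~~ (P %| 1).
Proof. by rewrite dvdp1; have [s _] := Pirr; rewrite gtn_eqF. Qed.

Lemma v_P : v (inK P) = pi.
Proof. by rewrite -[P]mulr1 v_once // P_ndvd1. Qed.

Lemma v_int a : v (inK a) <= 1.
Proof.
have [n] := ubnP (size a); elim: n a => // n IH a; rewrite ltnS => sa.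
have [/dvdpP [b E]|/v_unit -> //] := boolP (P %| a).
have [->|a0] := eqVneq a 0; first by rewrite rmorph0 na0.
rewrite E rmorphM (naM hv) v_P mulr_ile1 ?(na_ge0 hv) //.
have b0 : b != 0 by apply: contraNneq a0 => b0; rewrite E b0 mul0r.
apply: IH; apply: leq_trans sa; rewrite E size_Mmonic //.
have [s _] := Pirr; move: s; case: (size P) => [|[|k]] // _.
by rewrite !addnS /= ltnS leq_addr.
Qed.

Lemma v_nat n : v n%:R <= 1. Proof. exact: na_nat. Qed.

Definition vb (c : fps K) (B : R) := forall n, v (c n) <= B.

Lemma vb_le c B D : B <= D -> vb c B -> vb c D.
Proof. by move=> BD h n; apply: le_trans (h n) BD. Qed.
Lemma vbD c d B : vb c B -> vb d B -> vb (c + d) B.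
Proof. by move=> h k n; rewrite fpsDE; apply: (na_leD hv). Qed.
Lemma vbN c B : vb c B -> vb (- c) B.
Proof. by move=> h n; rewrite fpsNE naN. Qed.
Lemma vbB c d B : vb c B -> vb d B -> vb (c - d) B.
Proof. by move=> h /vbN; exact: vbD. Qed.
Lemma vbM c d B D : 0 <= B -> 0 <= D -> vb c B -> vb d D -> vb (c * d) (B * D).
Proof.
move=> B0 D0 h k n; rewrite fpsME; apply: (na_sum_le hv) => [|i _ _]; first exact: mulr_ge0.
by rewrite (naM hv) ler_pM ?(na_ge0 hv).
Qed.
Lemma vbM1 c d B : 0 <= B -> vb c 1 -> vb d B -> vb (c * d) B.
Proof. by move=> B0 h k; rewrite -[B]mul1r; apply: vbM. Qed.
Lemma vb1 : vb 1 1.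
Proof. by move=> n; rewrite fps1E v_nat. Qed.
Lemma vbX c B n : 0 <= B -> vb c B -> vb (c ^+ n) (B ^+ n).
Proof.
move=> B0 h; elim: n => [|n IH]; first exact: vb1.
by rewrite !exprS; apply: vbM => //; apply: exprn_ge0.
Qed.
Lemma vbX1 c n : vb c 1 -> vb (c ^+ n) 1.
Proof. by move=> /(vbX n ler01); rewrite expr1n. Qed.
Lemma vbC x c B : vb c B -> vb (fpsC x * c) (v x * B).
Proof. by move=> h n; rewrite fpsCM (naM hv) ler_wpM2l ?(na_ge0 hv). Qed.
Lemma vb_sum (I : eqType) (s : seq I) (Q : pred I) (G : I -> fps K) B : 0 <= B ->
  (forall i, i \in s -> Q i -> vb (G i) B) -> vb (\sum_(i <- s | Q i) G i) B.
Proof. by move=> B0 h n; rewrite fps_sumE; apply: (na_sum_le hv) => // i si Qi; apply: h. Qed.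
Lemma vb_inK (c : fps A) : vb (fps_map (@inK F) c) 1.
Proof. by move=> n; rewrite fps_mapE v_int. Qed.
Lemma vb_near1 c : vb (c - 1) pi -> vb c 1.
Proof. by move=> h; rewrite -[c](subrK 1); apply: vbD vb1; apply: vb_le h. Qed.
Lemma vb_near1M c d : vb (c - 1) pi -> vb (d - 1) pi -> vb (c * d - 1) pi.
Proof.
move=> h k; have -> : c * d - 1 = d * (c - 1) + (d - 1) by rewrite mulrBr mulr1 addrA subrK mulrC.
by apply: vbD => //; apply: vbM1 => //; apply: vb_near1.
Qed.
Lemma vb_near1X c n : vb (c - 1) pi -> vb (c ^+ n - 1) pi.
Proof.
move=> h; elim: n => [|n IH]; last by rewrite exprS; apply: vb_near1M.
by move=> n; rewrite expr0 subrr na0.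
Qed.

Lemma pchar_fpsK : p \in [pchar fps K].
Proof.
apply: pchar_fps; apply: (rmorph_pchar (@inK F)); by rewrite pchar_poly.
Qed.

(** In characteristic p, c^(p^n) - 1 = (c - 1)^(p^n), so the congruence improves exponentially. *)
Lemma vb_frob c n : vb (c - 1) pi -> vb (c ^+ (p ^ n) - 1) (pi ^+ (p ^ n)).
Proof.
move=> h; have hpf := pchar_fpsK; have pn : [pchar fps K].-nat (p ^ n)%N.
  by rewrite pnatX (eq_pnat _ (pcharf_eq hpf)) pnat_id ?(pcharf_prime hp).
have -> : c ^+ (p ^ n) - 1 = (c - 1) ^+ (p ^ n).
  by rewrite -{1}[c](subrK 1) exprDn_pchar // expr1n addrK.
exact: vbX.
Qed.

Lemma VopB c e : Vop P (c - e) = Vop P c - Vop P e.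
Proof.
apply/funext => n; rewrite fpsBE /Vop /compo -sumrB.
by apply: eq_bigr => i _; rewrite fpsBE mulrBl.
Qed.
Lemma UopB c e : Uop P (c - e) = Uop P c - Uop P e.
Proof.
apply/funext => -[|n]; rewrite fpsBE /Uop ?subrr // -mulrBr -sumrB; congr (_ * _).
by apply: eq_bigr => i _; rewrite fpsBE mulrBl.
Qed.
Lemma Vop1 : Vop P 1 = 1.
Proof.
apply/funext => n; rewrite /Vop /compo big_ord_recl big1 => [|i _].
  by rewrite expr0 fps1E eqxx mul1r addr0.
by rewrite fps1E mul0r.
Qed.
Lemma vb_V c B : 0 <= B -> vb c B -> vb (Vop P c) B.
Proof.
move=> B0 h n; rewrite /Vop /compo; apply: (na_sum_le hv) => // i _ _.
rewrite (naM hv) -[B]mulr1 ler_pM ?(na_ge0 hv) //; exact: (vbX1 _ (vb_inK _)).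
Qed.
Lemma vb_U c B : 0 <= B -> vb c B -> vb (Uop P c) B.
Proof.
move=> B0 h [|n]; rewrite /Uop; first by rewrite na0.
rewrite (naM hv) -[B]mul1r ler_pM ?(na_ge0 hv) ?v_int //.
apply: (na_sum_le hv) => // i _ _; rewrite (naM hv) -[B]mulr1 ler_pM ?(na_ge0 hv) ?v_int //.
Qed.

(** A crude common bound for the Goss coefficients up to order r; the summand 1 makes it
    positive. *)
Definition Mth (r : nat) : R := 1 + \sum_(i < r.+1) \sum_(j < r.+1) v (goss_coef F i j).

Lemma Mth_sum_ge0 r : 0 <= \sum_(i < r.+1) \sum_(j < r.+1) v (goss_coef F i j).
Proof. by apply: sumr_ge0 => i _; apply: sumr_ge0 => j _; apply: (na_ge0 hv). Qed.
Lemma Mth_ge1 r : 1 <= Mth r.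
Proof. by rewrite lerDl Mth_sum_ge0. Qed.
Lemma Mth_ge0 r : 0 <= Mth r.
Proof. exact: le_trans ler01 (Mth_ge1 r). Qed.
Lemma v_goss_coef r i j : (i <= r)%N -> (j <= r)%N -> v (goss_coef F i j) <= Mth r.
Proof.
move=> ir' jr'; have ir : (i < r.+1)%N := ir'; have jr : (j < r.+1)%N := jr'; have ge0 := na_ge0 hv; rewrite /Mth.
rewrite (bigD1 (Ordinal ir)) //= (bigD1 (Ordinal jr)) //= addrCA -!addrA lerDl.
rewrite !addr_ge0 //; apply: sumr_ge0 => k _; rewrite ?ge0 //.
by apply: sumr_ge0.
Qed.

Lemma thKB r (c e : fps K) : thK r (c - e) = thK r c - thK r e.
Proof.
apply/funext => n; rewrite fpsBE /thK /thetaG -sumrB.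
by apply: eq_bigr => i _; rewrite fpsBE mulrBl.
Qed.
Lemma thKD r (c e : fps K) : thK r (c + e) = thK r c + thK r e.
Proof.
apply/funext => n; rewrite fpsDE /thK /thetaG -big_split.
by apply: eq_bigr => i _; rewrite fpsDE mulrDl.
Qed.
Lemma vb_th r i c B : (i <= r)%N -> 0 <= B -> vb c B -> vb (thK i c) (B * Mth r).
Proof.
move=> ir B0 h n; rewrite /thK /thetaG; apply: (na_sum_le hv) => [|j _ _].
  by rewrite mulr_ge0 // Mth_ge0.
rewrite (naM hv) ler_pM ?(na_ge0 hv) // (naM hv) -[Mth r]mul1r ler_pM ?(na_ge0 hv) ?v_nat //.
by apply: v_goss_coef => //; apply: leq_trans ir; rewrite -ltnS.
Qed.
Lemma vb_th1 c B : 0 <= B -> vb c B -> vb (thK 1 c) B.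
Proof.
move=> B0 h; rewrite thK1E; apply: vbM1 => //.
  by move=> n; rewrite /fpsX v_nat.
by move=> n; rewrite /fps_euler (naM hv) -[B]mul1r ler_pM ?(na_ge0 hv) ?v_nat.
Qed.

Lemma v_bracket i : (0 < i < d)%N -> v (inK (carlitz_bracket F i)) = 1.
Proof. by move=> h; apply: v_unit; apply: (bracket_ndvd hp Pirr). Qed.

Lemma v_bracket_d : v (inK (carlitz_bracket F d)) = pi.
Proof.
have /dvdpP [h E] := bracket_dvd Pirr; rewrite E mulrC v_once //.
apply: contra (bracket_sq hp Pirr) => /dvdpP [k hE]; rewrite E hE -mulrA -expr2; exact: dvdp_mulIr.
Qed.

Lemma v_D i : (i < d)%N -> v (inK (carlitz_D F i)) = 1.
Proof.
elim: i => [|i IH] id; first by rewrite rmorph1 na1.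
by rewrite /= rmorphM (naM hv) v_bracket // rmorphXn (naX hv) IH ?expr1n ?mulr1 // ltnW.
Qed.

Lemma v_Dd : v (inK (carlitz_D F d)) = pi.
Proof.
have := v_bracket_d; rewrite -(prednK d_gt0) => h.
by rewrite /= rmorphM (naM hv) h rmorphXn (naX hv) v_D ?expr1n ?mulr1 // prednK ?d_gt0.
Qed.

Lemma v_cs n : (n < q ^ d)%N -> v (cs n) <= 1.
Proof.
move=> nd; case: (carlitz_seriesP F n) => [[i nE ->]|->]; last by rewrite na0.
by rewrite (naV hv) v_D ?invr1 // -(ltn_exp2l _ _ qn1) -nE.
Qed.

Lemma v_csX j n : (n < q ^ d)%N -> v ((cs ^+ j) n) <= 1.
Proof.
elim: j n => [|j IH] n nd; first by rewrite expr0 fps1E v_nat.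
rewrite exprS fpsME; apply: (na_sum_le hv) => // i _ _; rewrite (naM hv) mulr_ile1 ?(na_ge0 hv) //.
  by apply: v_cs; apply: leq_ltn_trans nd; rewrite -ltnS.
by apply: IH; apply: leq_ltn_trans nd; rewrite leq_subr.
Qed.

Notation l := (q ^ d).-1.

Lemma qd_gt0 : (0 < q ^ d)%N. Proof. by rewrite expn_gt0 qn0. Qed.
Lemma l_gt0 : (0 < l)%N.
Proof. by rewrite -ltnS prednK ?qd_gt0 // -(expn0 q) ltn_exp2l // d_gt0. Qed.

(** Up to this index only the coefficients of e_C below x^(q^d) enter, and the D_i with i < d are
    units at P. *)
Lemma v_goss j : v ((goss F l)`_j) <= 1.
Proof.
case: j => [|j]; first by rewrite goss0 na0.
have := goss_coefE F l.-1 j; rewrite /goss_coef prednK ?l_gt0 // => ->.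
by apply: v_csX; apply: leq_ltn_trans (leq_pred _) _; rewrite prednK ?qd_gt0.
Qed.

Lemma quotV0 : carlitz_quotV F 0%N = 1.
Proof.
have := congr1 (fun c : fps K => c 0%N) (carlitz_quotK F).
by rewrite fpsME big_ord_recl big_ord0 carlitz_quot0 mul1r addr0 fps1E.
Qed.

Lemma quotV_rec n : carlitz_quotV F n.+1 =
  - \sum_(i < n.+1) carlitz_quot F i.+1 * carlitz_quotV F (n - i)%N.
Proof.
have := congr1 (fun c : fps K => c n.+1) (carlitz_quotK F).
rewrite fpsME big_ord_recl carlitz_quot0 mul1r fps1E => /eqP; rewrite addr_eq0 => /eqP ->.
by congr (- _); apply: eq_bigr => i _; rewrite lift0 subSS.
Qed.

Lemma v_quotV n : (n < l)%N -> v (carlitz_quotV F n) <= 1.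
Proof.
have [m] := ubnP n; elim: m n => // m IH [|n] nm nl; first by rewrite quotV0 na1.
rewrite quotV_rec naN //; apply: (na_sum_le hv) => // i _ _.
rewrite (naM hv) mulr_ile1 ?(na_ge0 hv) //.
  apply: v_cs; rewrite -(prednK qd_gt0) ltnS; apply: leq_ltn_trans nl; exact: ltn_ord.
apply: IH; first by apply: leq_ltn_trans (leq_subr _ _) _; exact: nm.
by apply: leq_ltn_trans nl; apply: leqW; rewrite leq_subr.
Qed.

(** In the recursion for the coefficient of x^(q^d - 1) in x/e_C(x), the term 1/D_d appears exactly
    once, and D_d has valuation 1; all other terms are integral at P. *)
Lemma v_zeta : v (zetaK F l.-1) = qR.
Proof.
rewrite /zetaK (naM hv) (naX hv) naN // na1 // expr1n mul1r prednK ?l_gt0 //.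
have E := prednK l_gt0; rewrite -E quotV_rec naN // big_ord_recr /= subnn quotV0 mulr1.
have hq : v (carlitz_quot F l.-1.+1) = qR.
  by rewrite E /carlitz_quot prednK ?qd_gt0 // carlitz_series_pow (naV hv) v_Dd invrK.
rewrite (na_addr hv) hq //; apply: le_lt_trans q1; apply: (na_sum_le hv) => // i _ _.
rewrite (naM hv) mulr_ile1 ?(na_ge0 hv) //.
  have il : (i.+1 < l)%N by have := ltn_ord i; rewrite -ltnS E.
  by apply: v_cs; apply: leq_ltn_trans il _; rewrite prednK ?qd_gt0.
by apply: v_quotV; apply: leq_ltn_trans (leq_subr _ _) _; rewrite prednK ?l_gt0.
Qed.

Definition phi0 : fps K := fpsC (zetaK F l.-1)^-1 * eisS F l.-1.

(** The rows with c nonzero are integral at P by [v_goss], and dividing by the constant term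
    multiplies their absolute value by q^-1. *)
Lemma phi0_near1 : vb (phi0 - 1) pi.
Proof.
have z0 : zetaK F l.-1 != 0 by rewrite -(na_gt0 hv) v_zeta.
have -> : phi0 - 1 = fpsC (zetaK F l.-1)^-1 *
    (fun n => \sum_(c <- small_polys F n | c != 0) eisV l.-1 c n).
  apply/funext => n; rewrite fpsBE /phi0 !fpsCM /eisS /=.
  rewrite (bigD1_seq (0 : A)) ?uniq_small_polys ?mem_small_polys ?size_poly0 //=.
  rewrite mulrDr /eisV eqxx /fpsC fps1E; case: eqP => _; rewrite ?mulVf // ?mulr0.
    by rewrite addrC addKr.
  by rewrite add0r subr0.
rewrite -[pi]mulr1 -{1}v_zeta -(naV hv); apply: vbC => n.
apply: (na_sum_le hv) => // c _ c0; rewrite /eisV (negPf c0) fps_sumE; apply: (na_sum_le hv) => // j _ _.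
rewrite fpsCM (naM hv) mulr_ile1 ?(na_ge0 hv) //; last exact: (vbX1 _ (vb_inK _)).
by move: (nat_of_ord j) => i; rewrite prednK ?l_gt0 // v_goss.
Qed.
End Valuation.

(** * Approximation of Theta^r by modular series *)

Section HeckeShuffle.
Variable S : comNzRingType.
Add Ring Sring18 : (rT_ring S).
(** Used with x = P^L, y = P^-L, z = P^(lM) and f = phi0^M; primes mark the operators applied to psi
    f. Everything beyond V on the right is small. *)
Lemma hecke_shuffle (f V U x V' U' y z : S) : y * x = 1 ->
  y * (f * (x * V + U) - (x * z * V' + U')) = V + ((f - 1) * V - z * V' + y * ((f - 1) * U - (U' - U))).
Proof.
move=> yx; have -> : y * (f * (x * V + U) - (x * z * V' + U')) =
  (y * x) * (f * V - z * V') + y * (f * U - U') by crring S.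
by rewrite yx; crring S.
Qed.
End HeckeShuffle.

Lemma shift_pos (k : int) (X : nat) : (`|k|%N < X)%N -> exists k1 : nat, k + X%:Z = k1.+1%:Z.
Proof. by move=> h; exists (absz (k + X%:Z)).-1; lia. Qed.

Lemma weight_shuffle (k : int) (k1 r L X M M' : nat) : k + X%:Z = k1.+1%:Z -> M = (r + M')%N ->
  k + (2 * r)%N%:Z + X%:Z + (L * M)%N%:Z = (L * M')%N%:Z + (k1.+1 + 2 * r + r * L)%N%:Z.
Proof. by move=> h ->; rewrite mulnDr [(r * L)%N]mulnC; lia. Qed.

Lemma weight_dvd (k : int) (r n L M a b : nat) : M = (a * b)%N ->
  k + (2 * r)%N%:Z + (n * M)%N%:Z + (L * n * M)%N%:Z = k + (2 * r)%N%:Z + (n * a * (b * (1 + L)))%N%:Z.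
Proof.
move=> ->; rewrite -addrA -PoszD; congr (_ + Posz _).
rewrite mulnDr muln1 mulnDr !mulnA; congr (_ + _)%N.
by rewrite -!mulnA mulnC !mulnA.
Qed.

Section Approximation.
Variables (R : realType) (F : finFieldType) (p : nat).
Hypothesis hp : p \in [pchar F].
Notation A := {poly F}.
Notation K := {fraction {poly F}}.
Notation q := #|F|.
Notation qR := (#|F|%:R : R).
Variables (P : A) (Pm : P \is monic) (Pirr : irreducible_poly P) (Kv : completion R P).
Notation d := (size P).-1.
Notation v := (vK Kv).
Notation vb := (vb Kv).
Notation pi := (qR^-1).
Notation l := (q ^ d).-1.
Notation phi0 := (phi0 P).
Notation Mth := (Mth Kv).
Let hv := vK_nonarch Kv.
Variables (C : Cinfty R F) (w : C).
Hypothesis hw : carlitz_period w.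
Notation MS := (modular_series w).
Let pi0 : 0 <= pi := pi_ge0 R F.
Let pi1 : pi <= 1 := pi_le1 R F.
Let piX0 n : 0 <= pi ^+ n := piX_ge0 R F n.
Hint Resolve pi0 pi1 piX0 : core.
Let p1 : (1 < p)%N := prime_gt1 (pcharf_prime hp).
Let hpC := pchar_C C hp.
Let l0 := l_gt0 Pirr.
Let near : vb (phi0 - 1) pi := phi0_near1 hp Pm Pirr Kv.
Let vbV c B : 0 <= B -> vb c B -> vb (Vop P c) B := @vb_V R F P Pm Pirr Kv c B.
Let vbU c B : 0 <= B -> vb c B -> vb (Uop P c) B := @vb_U R F P Pm Pirr Kv c B.
Let vP : v (inK P) = pi := v_P Pirr Kv.

Lemma MS_phi0X n : MS (l * n)%N 0 (phi0 ^+ n).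
Proof.
apply: MS_X; apply: MS_scale; rewrite -[l in Posz l](prednK l0); exact: (MS_eis hp hw).
Qed.

Lemma MS_B k m c c' : MS k m c -> MS k m c' -> MS k m (c - c').
Proof.
move=> h h'; have -> : c - c' = c + fpsC (-1) * c' by rewrite rmorphN1 mulN1r.
by apply: MS_D => //; apply: MS_scale.
Qed.

Lemma l_natC : l%:R = -1 :> C.
Proof.
have : (l.+1)%:R = 0 :> C.
  rewrite prednK ?qd_gt0 // natrX; have -> : q%:R = 0 :> C.
    by rewrite -(rmorph_nat (@KtoC R F C \o @inK F \o polyC)) (card_F0 hp) rmorph0.
  by rewrite expr0n (gtn_eqF (d_gt0 Pirr)).
by rewrite -natr1 => /eqP; rewrite addr_eq0 => /eqP.
Qed.

(** The condition [l %| L] keeps the weight trivial in the factor Z/(q^d - 1) of the weight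
    space. *)
Definition psi_spec (j L : nat) (psi : fps K) := [/\ MS L 0 psi, L%:R = 1 :> C, (l %| L)%N,
  vb (psi - 1) pi & vb (thK 1 psi) (pi ^+ j)].

Lemma psi_start : exists L psi, psi_spec 0 L psi.
Proof.
(* l = q^d - 1 is -1 modulo p, so the exponent p - 1 gives weight 1 modulo p. *)
exists (l * p.-1)%N, (phi0 ^+ p.-1); split.
- exact: MS_phi0X.
- have : (p.-1).+1%:R = 0 :> C by rewrite prednK ?(ltnW p1) // (pcharf0 hpC).
  rewrite -natr1 => /eqP; rewrite addr_eq0 => /eqP h.
  by rewrite natrM l_natC h mulrNN mulr1.
- exact: dvdn_mulr.
- by apply: vb_near1X; exact: near.
rewrite expr0; apply: vb_th1 => //; apply: vb_near1; apply: vb_near1X; exact: near.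
Qed.

Lemma psi_step j L psi : psi_spec j L psi -> exists L' psi', psi_spec j.+1 L' psi'.
Proof.
(* Dividing by P^L costs L powers of P and j + 1 must remain; M = p^n is at least n. Since n > 0, p
   divides M and the new weight L + lM is still 1 modulo p. *)
move=> [h1 h2 h3 h4 h5]; pose n := (j.+1 + L)%N; pose M := (p ^ n)%N.
have nM : (n <= M)%N by apply/ltnW/ltn_expl.
pose f := phi0 ^+ M; have hf : vb (f - 1) (pi ^+ M) by apply: vb_frob => //; exact: near.
have hf1 : vb (f - 1) pi by apply: vb_near1X; exact: near.
have f1 := vb_near1 hf1; have psi1 := vb_near1 h4.
(* Both Hecke operators act in the weight of their argument. Their U-parts agree up to P^M because f
   = 1 modulo P^M, while the V-part of the second carries P^(L + lM); after division by P^L this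
   leaves V(psi) up to the error [D]. *)
pose psi' := fpsC (inK P ^- L) * (f * heckeS P L psi - heckeS P (L + l * M) (psi * f)).
have P0 : inK P ^+ L != 0.
  by rewrite expf_neq0 // tofrac_eq0 monic_neq0.
have PL : v (inK P ^- L) = qR ^+ L by rewrite naV // naX // vP // exprVn invrK.
pose D := (f - 1) * Vop P psi - fpsC (inK P ^+ (l * M)) * Vop P (psi * f) +
    fpsC (inK P ^- L) * ((f - 1) * Uop P psi - Uop P (psi * (f - 1))).
have psiE : psi' = Vop P psi + D.
  have E : psi * (f - 1) = psi * f - psi by rewrite mulrBr mulr1.
  rewrite /psi' /D /heckeS exprD rmorphM E UopB; apply: hecke_shuffle.
  by rewrite -rmorphM mulVf // rmorph1.
have Mj : pi ^+ M <= pi ^+ j.+1 by apply: piX_le; apply: leq_trans nM; apply: leq_addr.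
have hD : vb D (pi ^+ j.+1).
  apply: vbD; first apply: vbB.
  - rewrite mulrC; apply: vbM1 => //; first exact  : vbV.
    exact: vb_le Mj hf.
  - apply: vb_le Mj _; have := vbC (inK P ^+ (l * M)) (vbV (ltW ltr01) (vbM1 (ltW ltr01) psi1 f1)).
    rewrite naX // vP // mulr1; apply: vb_le; apply: piX_le; exact: leq_pmull.
  apply: vb_le (_ : qR ^+ L * pi ^+ M <= _) _.
    have qL : qR ^+ L * pi ^+ n = pi ^+ j.+1.
      by rewrite /n exprD mulrCA -exprMn mulfV ?expr1n ?mulr1 // gt_eqF ?qR_gt0.
    by rewrite -qL ler_wpM2l ?exprn_ge0 ?piX_le // ltW ?qR_gt0.
  rewrite -PL; apply: vbC; apply: vbB.
    by rewrite mulrC; apply: vbM1 => //; apply: vbU.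
  by apply: vbU => //; apply: vbM1.
exists (L + l * M)%N, psi'; split.
- apply: MS_scale; apply: MS_B.
    rewrite addnC PoszD -[0 : Zmod _](add0r 0); apply: MS_M; first exact: MS_phi0X.
    exact: (MS_hecke hp hw Pm Pirr).
  apply: (MS_hecke hp hw Pm Pirr); rewrite PoszD -[0 : Zmod _](add0r 0).
  by apply: MS_M => //; exact: MS_phi0X.
- by rewrite natrD h2 natrM natrX (pcharf0 hpC) expr0n /= mulr0 addr0.
- by rewrite dvdn_add // dvdn_mulr.
- have -> : psi' - 1 = D + Vop P (psi - 1) by rewrite psiE VopB Vop1 [_ + D]addrC addrA.
  apply: vbD; last exact  : vbV.
  by apply: vb_le hD; rewrite -[leRHS]expr1 piX_le.
(* The factor P gained when Theta passes V raises the exponent from j to j + 1. *)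
rewrite psiE thKD (thK1_V hp Pm Pirr) addrC; apply: vbD; first exact: vb_th1.
by have := vbC (inK P) (vbV (piX0 j) h5); rewrite vP // -exprS.
Qed.

Lemma psi_ex j : exists L psi, psi_spec j L psi.
Proof.
elim: j => [|j [L [psi h]]]; first exact: psi_start.
exact: psi_step h.
Qed.

Lemma pi_small (B e : R) : 0 <= B -> 0 < e -> exists n, forall m, (n <= m)%N -> B * pi ^+ m <= e.
Proof.
move=> B0 e0; have [n hn] := q_archi F (B / e); exists n => m nm.
rewrite exprVn ler_pdivrMr ?exprn_gt0 ?qR_gt0 // mulrC -ler_pdivrMr //.
by apply: le_trans hn _; rewrite ler_weXn2l ?qR_ge1.
Qed.

Lemma theta_approx (k : int) m (c : fps K) (r : nat) (B e : R) (N : nat) : MS k m c -> 0 <= B -> vb c B -> 0 < e ->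
  exists (k' : int) h, [/\ MS k' (m + Zmod_of_int _ r) h, vb (h - thK r c) e &
    exists t : nat, k' = k + (2 * r)%N%:Z + (l * p ^ N * t)%N%:Z].
Proof.
move=> hc B0 cB e0; pose B1 := B * Mth r; have M0 := Mth_ge0 Kv r.
have B10 : 0 <= B1 by apply: mulr_ge0.
have [j hj] := pi_small B10 e0.
have [L [psi [h1 h2 h3 h4 h5]]] := psi_ex j.
(* [N] serves the closeness of the weight, [j] the error of phi0^M, the term in [k] the positivity
   of the weight of [c1], and [r] the completion of psi^r to psi^M. *)
pose n := (N + j + `|k|.+1 + r)%N; pose M := (p ^ n)%N.
have nM : (n <= M)%N by apply/ltnW/ltn_expl.
have eM : B1 * pi ^+ M <= e by apply: hj; apply: leq_trans nM; rewrite /n; lia.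
have rM : (r <= M)%N by apply: leq_trans nM; rewrite /n; lia.
pose f := phi0 ^+ M; have hf : vb (f - 1) (pi ^+ M) by apply: vb_frob => //; exact: near.
have f1 : vb f 1 by apply: vb_near1; apply: vb_near1X; exact: near.
pose c1 := c * f; have c1B : vb c1 B by rewrite /c1 mulrC; apply: vbM1.
have [k1 k1E] : exists k1 : nat, k + (l * M)%N%:Z = k1.+1%:Z.
  have : (`|k|.+1 <= l * M)%N.
    apply: leq_trans (leq_pmull _ l0); apply: leq_trans nM; rewrite /n; lia.
  exact: shift_pos.
have hc1 : MS k1.+1%:Z m c1.
  by rewrite -k1E -[m](addr0 m); apply: MS_M => //; exact: MS_phi0X.
have hS := MS_serre hp hw r (isT : (0 < k1.+1)%N) h2 hc1 h1.
have [M' ME] : exists M', M = (r + M')%N by exists (M - r)%N; rewrite subnKC.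
(* The main term of [serreS] carries psi^r; the factor psi^(M - r) completes it to psi^M, which is 1
   modulo P^M and adds only the weight LM. *)
pose h := psi ^+ M' * serreS k1.+1 r c1 psi.
exists (k + (2 * r)%N%:Z + (l * M)%N%:Z + (L * M)%N%:Z), h; split.
- have -> : k + (2 * r)%N%:Z + (l * M)%N%:Z + (L * M)%N%:Z =
    (L * M')%N%:Z + (k1.+1 + 2 * r + r * L)%N%:Z.
    exact: weight_shuffle.
  by rewrite -[m + _]add0r; apply: MS_M => //; apply: MS_X.
- have psi1 := vb_near1 h4.
  have hpsi : vb (psi ^+ M - 1) (pi ^+ M) by apply: vb_frob.
  (* The term i = 0 is psi^r Theta^r(c1); every other term contains a factor Theta(psi), of absolute
     value at most q^-j. *)
  have rest : vb (serreS k1.+1 r c1 psi - psi ^+ r * thK r c1) e.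
    rewrite /serreS big_ord_recl /= bin0 rmorph1 expr0 !mul1r subn0 addrC addKr.
    apply: vb_le (hj _ (leqnn j)) _; apply: vb_sum => [|i _ _]; first by rewrite mulr_ge0.
    have hC : vb (fpsC 'C(k1 + r, bump 0 i)%:R) 1.
      by move=> s; rewrite /fpsC; case: eqP => _; rewrite ?v_nat ?na0.
    have hT : vb ((- thK 1 psi) ^+ bump 0 i) (pi ^+ j).
      rewrite [bump 0 i]add1n exprS -[pi ^+ j]mulr1; apply: vbM => //; first exact: vbN.
      by apply: vbX1; apply: vbN; apply: vb_le h5; rewrite exprn_ile1.
    have hp' : vb (psi ^+ (r - bump 0 i)) 1 by apply: vbX1.
    have hc' : vb (thK (r - bump 0 i) c1) B1 by apply: vb_th => //; rewrite leq_subr.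
    rewrite [B1 * _]mulrC; apply: vbM => //; rewrite -[pi ^+ j]mulr1; apply: vbM => //.
    by rewrite -[pi ^+ j]mul1r; apply: vbM.
  have -> : h - thK r c = psi ^+ M' * (serreS k1.+1 r c1 psi - psi ^+ r * thK r c1) +
      ((psi ^+ M - 1) * thK r c1 + thK r (c1 - c)).
    by rewrite thKB mulrBr mulrA -exprD [(M' + r)%N]addnC -ME mulrBl mul1r !subrKA.
  apply: vbD; first by apply: vbM1 (ltW e0) _ rest; apply: vbX1.
  apply: vbD; apply: vb_le eM _.
    by rewrite mulrC [B1 * _]mulrC mulrC; apply: vbM => //; apply: vb_th.
  rewrite /B1 mulrAC; apply: vb_th => //; first by rewrite mulr_ge0.
  have -> : c1 - c = c * (f - 1) by rewrite /c1 mulrBr mulr1.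
  exact: vbM.
have [L' LE] := dvdnP h3.
exists ((p ^ (n - N)) * (1 + L'))%N; rewrite LE; apply: weight_dvd.
by rewrite -expnD subnKC // /n -!addnA leq_addr.
Qed.
End Approximation.

(** * The space of v-adic forms *)

Section WeightArithmetic.

Lemma Zmod_of_intD n (a b : int) : (0 < n)%N -> Zmod_of_int n (a + b) = Zmod_of_int n a + Zmod_of_int n b.
Proof.
move=> n0; have nE : n.-1.+1 = n by rewrite prednK.
have nz : n%:Z != 0 by rewrite eqz_nat -lt0n.
apply: val_inj => /=; rewrite nE; apply/eqP.
rewrite -eqz_nat -!modz_nat !PoszD -!modz_nat !gez0_abs ?modz_ge0 // !modz_mod.
by rewrite modzDm.
Qed.

Lemma Zmod_of_int_dvd n (a : int) (t : nat) : (0 < n)%N -> Zmod_of_int n (a + (n * t)%N%:Z) = Zmod_of_int n a.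
Proof.
by move=> n0; rewrite /Zmod_of_int addrC PoszM [n%:Z * _]mulrC modzMDl.
Qed.
End WeightArithmetic.

Section GaussNorm.
Variables (R : realType) (F : finFieldType) (P : {poly F}) (Kv : completion R P).
Notation av := (@absv R F P Kv).
Let ha := @absv_nonarch R F P Kv.

Lemma gauss_norm_le (c : nat -> Kv) (B : R) : (gauss_norm c <= B%:E)%E <-> forall n, av (c n) <= B.
Proof.
split=> [h n|h].
  by rewrite -lee_fin; apply: le_trans h; apply: ereal_sup_ubound; exists n.
by apply: ge_ereal_sup => _ [n _ <-]; rewrite lee_fin.
Qed.

Lemma gauss_norm_cvg0 (c : nat -> nat -> Kv) : (fun i => gauss_norm (c i)) @ \oo --> 0%E <->
  forall e, 0 < e -> exists N, forall i, (N <= i)%N -> forall n, av (c i n) <= e.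
Proof.
split=> [/fine_cvgP [[N1 _ h1] /cvgrPdist_le h] e e0|h].
  have [N2 _ h2] := h e e0; exists (maxn N1 N2) => i; rewrite geq_max => /andP[i1 i2].
  apply/gauss_norm_le; have := h2 i i2; rewrite /= sub0r normrN => h3.
  by rewrite -(fineK (h1 i i1)) lee_fin; apply: le_trans (ler_norm _) h3.
have ge0 i : (0 <= gauss_norm (c i))%E.
  apply: le_trans (_ : (av (c i 0%N))%:E <= _)%E; first by rewrite lee_fin na_ge0.
  by apply: ereal_sup_ubound; exists 0%N.
have fin : \forall i \near \oo, gauss_norm (c i) \is a fin_num.
  have [N hN] := h 1 ltr01; exists N => // i Ni; rewrite ge0_fin_numE //.
  by apply: le_lt_trans (ltry 1); apply/gauss_norm_le; exact: hN.
apply/fine_cvgP; split => //; apply/cvgrPdist_le => e e0.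
have [N hN] := h e e0; near=> i.
rewrite /= sub0r normrN ger0_norm ?fine_ge0 // -lee_fin fineK; last by near: i.
by apply/gauss_norm_le; apply: hN; near: i; exists N.
Unshelve. all: by end_near.
Qed.
End GaussNorm.

Theorem theorem7p3 (R : realType) (F : finFieldType) (p : nat)
  (hp : p \in [pchar F])
  (C : Cinfty R F) (w : C) (hw : carlitz_period w)
  (P : {poly F}) (P_monic : P \is monic) (P_irr : irreducible_poly P)
  (Kv : completion R P) (r : nat)
  (s : weight_space (#|F| ^ (size P).-1).-1 p) (m : Zmod #|F|.-1)
  (f : nat -> Kv) :
  v_modular_form_int w s m f ->
  v_modular_form_int w
    (weight_add s (weight_of_int _ p (2 * r)%N))
    (m + Zmod_of_int _ r)
    (fun n => KtoKv Kv (inK (carlitz_factorial F r)) * Theta r f n).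
Proof.
set l := (#|F| ^ (size P).-1).-1; set Pir := inK (carlitz_factorial F r).
move=> [[fb [k [c [hMS /gauss_norm_cvg0 hcv [hw1 hw2]]]]] fint].
pose av := @absv R F P Kv; pose iv := @KtoKv R F P Kv.
have ha : nonarch_abs av := @absv_nonarch R F P Kv.
have Pir1 : av (iv Pir) <= 1 := v_int P_monic P_irr Kv (carlitz_factorial F r).
have M0 : 0 < Mth Kv r by apply: lt_le_trans ltr01 (Mth_ge1 Kv r).
have theta_bound (g : nat -> Kv) B : 0 <= B -> (forall n, av (g n) <= B) ->
    forall n, av (Theta r g n) <= B * Mth Kv r.
  move=> B0 hg n; rewrite /Theta; apply: (na_sum_le ha) => [|j _ _].
    by rewrite mulr_ge0 // ltW.
  rewrite (naM ha) ler_pM ?(na_ge0 ha) // (naM ha) -[Mth Kv r]mul1r.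
  rewrite ler_pM ?(na_ge0 ha) ?na_nat //; exact: (v_goss_coef Kv (leqnn r) (leq_ord j)).
(* Integrality is checked on [f] itself, not on its approximants: the Carlitz factorial clears each
   Goss coefficient separately. *)
have int_out n : av (iv Pir * Theta r f n) <= 1.
  rewrite /Theta mulr_sumr; apply: (na_sum_le ha) => // j _ _.
  rewrite mulrCA [_ * ('C(_, _)%:R * _)]mulrCA -rmorphM.
  have [a ->] := carlitz_factorial_goss F r j.
  rewrite (naM ha) mulr_ile1 ?(na_ge0 ha) //; first exact: fint.
  by rewrite (naM ha) mulr_ile1 ?(na_ge0 ha) ?na_nat //; exact: (v_int P_monic P_irr Kv a).
split; last exact: int_out.
split; first by apply: le_lt_trans (ltry 1); apply/gauss_norm_le.
(* From [N0] on the approximants of [f] are integral too, so [theta_approx] applies to all of them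
   with B = 1. *)
have [N0 hN0] := hcv 1 ltr01.
have step i : exists kh : int * fps {fraction {poly F}},
    [/\ modular_series w kh.1 (m + Zmod_of_int _ r) kh.2,
        vb Kv (kh.2 - thK r (c (i + N0)%N)) i.+1%:R^-1 &
        exists t : nat, kh.1 = k (i + N0)%N + (2 * r)%N%:Z + (l * p ^ i * t)%N%:Z].
  have cB : vb Kv (c (i + N0)%N) 1.
    move=> n; have := hN0 _ (leq_addl i N0) n; rewrite /vK => h.
    by rewrite -[X in absv X](subrK (f n)); apply: (na_leD ha) => //; exact: fint.
  have e0 : 0 < i.+1%:R^-1 :> R by rewrite invr_gt0 ltr0n.
  have [k' [h [h1 h2 h3]]] :=
    theta_approx hp P_monic P_irr hw r i (hMS (i + N0)%N) ler01 cB e0.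
  by exists (k', h).
have /choice [kh khP] := step.
exists (fun i => (kh i).1), (fun i => fpsC Pir * (kh i).2); split.
- by move=> i; apply: MS_scale; have [] := khP i.
- apply/gauss_norm_cvg0 => e e0; have [N1 hN1] := hcv _ (divr_gt0 e0 M0).
  have [N2 hN2] : exists N, forall i, (N <= i)%N -> i.+1%:R^-1 <= e.
    exists (Num.bound e^-1) => i Ni; rewrite invf_ple ?posrE ?ltr0n //.
    apply: le_trans (ltW (archi_boundP _)) _; first by rewrite invr_ge0 ltW.
    by rewrite ler_nat leqW.
  exists (maxn N1 N2) => i; rewrite geq_max => /andP[i1 i2] n.
  have [_ h2 _] := khP i; set ci := c (i + N0)%N in h2.
  (* Two errors: that of [theta_approx] for [ci], and Theta^r of ci - f, which is bounded by [Mth]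
     times the norm of ci - f. *)
  have -> : iv ((fpsC Pir * (kh i).2) n) - iv Pir * Theta r f n = iv Pir *
      (iv (((kh i).2 - thK r ci) n) + Theta r (fun j => iv (ci j) - f j) n).
    rewrite fpsCM rmorphM -mulrBr fpsBE rmorphB; congr (_ * _).
    have -> : iv (thK r ci n) = Theta r (fun j => iv (ci j)) n.
      exact: (esym (congr1 (fun g => g n) (thetaG_map iv r ci))).
    have -> : Theta r (fun j => iv (ci j) - f j) n = Theta r (fun j => iv (ci j)) n - Theta r f n.
      by rewrite /Theta -sumrB; apply: eq_bigr => j _; rewrite mulrBl.
    by rewrite addrA subrK.
  rewrite -[absv _]/(av _) (naM ha) -[e]mul1r ler_pM ?(na_ge0 ha) //; apply: (na_leD ha).
    exact: le_trans (h2 n) (hN2 i i2).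
  rewrite -[e](divfK (lt0r_neq0 M0)); apply: theta_bound; first by rewrite divr_ge0 // ltW.
  by apply: hN1; apply: leq_trans i1 (leq_addr _ _).
have l0 : (0 < l)%N := l_gt0 P_irr.
have [Na _ hNa] := hw1; split.
  exists Na => // i Ni; have [_ _ [t E]] := khP i.
  rewrite /= E -mulnA Zmod_of_int_dvd // Zmod_of_intD //; congr (_ + _).
  by apply: hNa; apply: leq_trans Ni (leq_addr _ _).
move=> n; have [Nb _ hNb] := hw2 n.
have p0 j : (0 < p ^ j)%N by rewrite expn_gt0 prime_gt0 // (pcharf_prime hp).
exists (maxn n Nb) => // i /=; rewrite geq_max => /andP[ni Ni]; have [_ _ [t E]] := khP i.
(* For i >= n the factor p^n splits off p^i, so the surplus weight vanishes modulo p^n. *)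
have -> : (kh i).1 = k (i + N0)%N + (2 * r)%N%:Z + (p ^ n * (l * p ^ (i - n) * t))%N%:Z.
  rewrite E; congr (_ + Posz _); rewrite -[in LHS](subnKC ni) expnD.
  by rewrite !mulnA [(l * p ^ n)%N]mulnC.
rewrite Zmod_of_int_dvd // Zmod_of_intD //; congr (_ + _).
by apply: hNb; apply: leq_trans Ni (leq_addr _ _).
Qed.
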